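(* Let $C\in\mathbb N_{\ge1}$. Given $N\ge1$ and $T=\frac{\mu_{\mathcal U}}{\mu_{\mathcal V}}N$ (assumed integer), let $\mathrm M_T$ be the matching built by GREEDY on $\mathbf{CM}(\mathbf d^{\mathcal U},\mathbf d^{\mathcal V},C)$. Let $$\Gamma_{\mathcal U}(g)=\phi_{\mathcal U}'(1-g)+\sum_{k=1}^{C-1}\frac{g^k}{k!}\phi_{\mathcal U}^{(k+1)}(1-g),$$ and let $G$ be the unique solution of $$G'(s)=\frac{1-\phi_{\mathcal V}\bigl(1-\frac1{\mu_{\mathcal U}}\Gamma_{\mathcal U}(G(s))\bigr)}{\frac{\mu_{\mathcal V}}{\mu_{\mathcal U}}\Gamma_{\mathcal U}(G(s))},\qquad G(0)=0.$$ Then, in probability as $N\to\infty$, $$\frac{|\mathrm M_T|}{CN}\to1-\sum_{k=0}^{C-1}\frac{1-k/C}{k!}G(1)^k\phi_{\mathcal U}^{(k)}(1-G(1)).$$ Moreover, for every $s\in[0,1]$, if $\mathrm M_T(s)$ is the matching obtained by GREEDY after seeing a proportion $s$ of the vertices of $\mathcal V$, then $\frac{|\mathrm M_T(s)|}{CN}\to1-\sum_{k=0}^{C-1}\frac{1-k/C}{k!}G(s)^k\phi_{\mathcal U}^{(k)}(1-G(s))$ in probability.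
   Context: $\pi_{\mathcal U},\pi_{\mathcal V}$ are sub-Gaussian probability distributions on $\mathbb N$ with means $\mu_{\mathcal U},\mu_{\mathcal V}>0$ and generating functions $\phi_{\mathcal U}(s)=\sum_k\pi_{\mathcal U}(k)s^k$, $\phi_{\mathcal V}(s)=\sum_k\pi_{\mathcal V}(k)s^k$; $\phi^{(k)}$ denotes the $k$-th derivative. $\mathbf{CM}(\mathbf d^{\mathcal U},\mathbf d^{\mathcal V},C)$: with $\mathcal U=\{1,\dots,N\}$, $\mathcal V=\{1,\dots,T\}$, draw $d^{\mathcal U}_1,\dots,d^{\mathcal U}_N$ i.i.d. $\sim\pi_{\mathcal U}$ and independently $d^{\mathcal V}_1,\dots,d^{\mathcal V}_T$ i.i.d. $\sim\pi_{\mathcal V}$; add $d^{\mathcal V}_{T+1}=\max\{\sum_id^{\mathcal U}_i-\sum_jd^{\mathcal V}_j,0\}$ and $d^{\mathcal U}_{N+1}=\max\{\sum_jd^{\mathcal V}_j-\sum_id^{\mathcal U}_i,0\}$; attach that many half-edges to each vertex, pair half-edges of $\mathcal U\cup\{N+1\}$ with those of $\mathcal V\cup\{T+1\}$ uniformly at random (each pair an edge, multi-edges allowed), delete $N+1,T+1$; every $u\in\mathcal U$ gets capacity $C$. A matching is a set of edges in which each $v\in\mathcal V$ lies in at most one edge and each $u\in\mathcal U$ in at most $C$ edges. Vertices of $\mathcal V$ arrive online in order revealing their edges. GREEDY: when $v_t$ arrives, if some edge joins $v_t$ to a vertex of $\mathcal U$ with remaining capacity (matched fewer than $C$ times), add one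 such edge chosen uniformly at random. ''After seeing a proportion $s$'' means after the first $\lfloor sT\rfloor$ arrivals. *)

(* Defs.v *)
From HB Require Import structures.
From mathcomp Require Import all_boot all_order all_algebra.
From mathcomp Require Import all_classical all_reals all_analysis.

Set Implicit Arguments.
Unset Strict Implicit.
Unset Printing Implicit Defensive.
Import Order.TTheory GRing.Theory Num.Theory.
Import numFieldNormedType.Exports.

Local Open Scope ring_scope.

Section Degree_distribution.
Variable R : realType.
Implicit Types pi : probability nat R.

Definition mass pi (k : nat) : R := fine (pi [set k]%classic).

Definition mean pi : R := fine 'E_pi[fun k => k%:R].

Definition sub_gaussian pi : Prop :=
  exists sigma : R, forall lambda : R,
    ('M_pi (fun k => k%:R - mean pi)%R lambda
      <= (expR (sigma ^+ 2 * lambda ^+ 2 / 2))%:E)%E.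

(* For sub-Gaussian [pi] the series converges for every real [s], so that the
   two-sided derivatives used below also make sense at [s = 1].               *)
Definition gen_fun pi (s : R) : R :=
  limn (series (fun k => mass pi k * s ^+ k)).

End Degree_distribution.

(* [None] is the additional vertex that balances the two sides, and truncated
   subtraction is the positive part in its degree.                            *)
Section Configuration_model.
Variables N T : nat.

Definition degrees := ({ffun 'I_N -> nat} * {ffun 'I_T -> nat})%type.

Variable d : degrees.

Definition degU (u : option 'I_N) : nat :=
  if u is Some i then d.1 i else (\sum_j d.2 j - \sum_i d.1 i)%N.

Definition degV (v : option 'I_T) : nat :=
  if v is Some j then d.2 j else (\sum_i d.1 i - \sum_j d.2 j)%N.

Definition halfU := {u : option 'I_N & 'I_(degU u)}.
Definition halfV := {v : option 'I_T & 'I_(degV v)}.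

Definition pairing := {ffun halfU -> halfV}.

Definition perfect_pairings : {set pairing} :=
  [set f : pairing | injectiveb f && [forall h, h \in codom f]].

(* An edge is recorded as its pair of half-edges, so that parallel edges are
   distinct.                                                                  *)
Definition edge := (halfU * halfV)%type.

Definition edges (f : pairing) : {set edge} :=
  [set e : edge | [&& f e.1 == e.2, tag e.1 != None & tag e.2 != None]].

Definition load (M : {set edge}) (u : option 'I_N) : nat :=
  #|[set e in M | tag e.1 == u]|.

Definition available (C : nat) (f : pairing) (M : {set edge}) (t : 'I_T) :
    {set edge} :=
  [set e in edges f | (tag e.2 == Some t) && (load M (tag e.1) < C)%N].

(* [c t] is the edge added, if any, at the arrival of the vertex [t]. *)
Definition choices := {ffun 'I_T -> option edge}.

Definition matching_after (c : choices) (k : nat) : {set edge} :=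
  [set e | [exists t : 'I_T, (t < k)%N && (c t == Some e)]].

(* Conditional probability of the choice [c t] given the graph and the choices
   made at the arrivals before [t].                                           *)
Definition greedy_step (R : realType) (C : nat) (f : pairing) (c : choices)
    (t : 'I_T) : R :=
  let A := available C f (matching_after c t) t in
  if c t is Some e then (e \in A)%:R / #|A|%:R else (#|A| == 0)%:R.

End Configuration_model.

Section Greedy_law.
Variables (R : realType) (piU piV : probability nat R) (C N T : nat).

Definition outcome := {d : degrees N T & (pairing d * choices d)%type}.

Definition out_matching (w : outcome) (k : nat) : {set edge (tag w)} :=
  matching_after (tagged w).2 k.

Definition weight (w : outcome) : R :=
  let: existT d (f, c) := w in
  (\prod_i mass piU (d.1 i)) * (\prod_j mass piV (d.2 j))
  * ((f \in perfect_pairings d)%:R / #|perfect_pairings d|%:R)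
  * \prod_(t < T) greedy_step R C f c t.

Definition greedy_prob (A : set outcome) : \bar R :=
  \esum_(w in A) (weight w)%:E.

End Greedy_law.

Section Limit.
Local Open Scope classical_set_scope.
Variables (R : realType) (piU piV : probability nat R) (C : nat).

Definition Gamma (g : R) : R :=
  derive1 (gen_fun piU) (1 - g)
  + \sum_(1 <= k < C) g ^+ k / k`!%:R * derive1n k.+1 (gen_fun piU) (1 - g).

Definition ode_rhs (g : R) : R :=
  (1 - gen_fun piV (1 - (mean piU)^-1 * Gamma g))
  / (mean piV / mean piU * Gamma g).

(* The equation is imposed in the open interval: at s = 1 the right-hand side
   may be 0 / 0 (e.g. C = 1, piV = dirac 1, piU = dirac 2, where G s = s). The
   one-sided equation at s = 0 follows by continuity.                         *)
Definition is_solution (G : R -> R) : Prop :=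
  [/\ {within `[0, 1], continuous G}, G 0 = 0 &
      forall s : R, 0 < s < 1 -> is_derive s 1 G (ode_rhs (G s))].

Definition limit_ratio (g : R) : R :=
  1 - \sum_(0 <= k < C)
        (1 - k%:R / C%:R) / k`!%:R * g ^+ k * derive1n k (gen_fun piU) (1 - g).

Definition greedy_cvg_in_prob (X : forall N T, outcome N T -> R) (l : R) :
    Prop :=
  forall eps delta : R, 0 < eps -> 0 < delta ->
    \forall N \near \oo, forall T : nat,
      T%:R = mean piU / mean piV * N%:R ->
      (@greedy_prob R piU piV C N T [set w | (eps < `|X N T w - l|)%R]
        < delta%:E)%E.

End Limit.

(* Main.v *)
(* The pairing is revealed lazily. An arriving vertex reads its half-edges one at
   a time, each read exposing a uniform unread half-edge of the other side, and
   stops at the first one that belongs to an unsaturated vertex. Greedy then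
   gives min(C, X_i) edges to the vertex i, X_i being the number of its exposed
   half-edges, so that |M| is a function of the set Q of exposed half-edges.

   Let n = mu_U N and g = |Q| / n. For every degree D and every j, the sum of
   'C(a_i, j) over the vertices of degree D, where a_i counts the unread
   half-edges of i, becomes a martingale once divided by the j-th falling
   factorial of the number of unread half-edges. Hence statistics of Q
   concentrate as if each half-edge were exposed independently with probability
   g: a read hits with probability close to p(g) = Gamma(g) / mu_U, a vertex of
   degree m makes (1 - (1 - p)^m) / p reads on average, and |M| / N is close to
   the mean of min(C, Bin(d, g)). Averaging over m gives the differential
   equation for g as a function of the proportion of arrivals.

   The distance to its solution is controlled in mean square by a discrete
   Gronwall inequality, first given the degrees and then over the degrees. This
   requires a positive proportion of unread half-edges, that is s < 1; the case
   s = 1 follows because an arrival adds at most one edge. *)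
Require Import Defs.
From mathcomp Require Import all_boot all_order all_algebra.
From mathcomp Require Import fingroup perm.
From mathcomp Require Import boolp reals sequences exp.
From mathcomp Require Import ring lra zify.

Set Implicit Arguments.
Unset Strict Implicit.
Unset Printing Implicit Defensive.
Import Order.TTheory GRing.Theory Num.Theory.
Local Open Scope ring_scope.

(** * The greedy algorithm by deferred decisions *)

(** On a given pairing the reader and greedy may pick different edges; what coincides is the sum,
    over all perfect pairings, of any function of the matching size. Concentration is then a matter
    of second moments: uniform reads make the binomial statistics martingales, and stopping at a hit
    preserves a bound on squares.

    Degrees are unbounded and outcomes infinitely many, while all averages are finite sums. A
    probability is a supremum over finite sets of outcomes, whose degrees lie below some [B]; it is
    bounded by a mean under truncated laws that dominate the true masses. Every estimate must thus
    be uniform in large [B]. Atypical degrees are not removed by an event: a penalty, at least 1 on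
    them and small in mean, multiplies the trivial bound [C ^ 2].

    The cubed degrees enter because the hit probability drifts while one vertex reads: each read
    shifts it by order 1 / n, the mean number of reads is Lipschitz with constant m^2, and m reads
    accumulate. Their normalised sum stays of order 1; Markov's inequality with a large threshold
    [K3] controls it, so [theta] is chosen after [K3]. *)

Section Sequential_sampling.
Variables (R : realFieldType) (A : finType) (T : nat).
Implicit Types (c : {ffun 'I_T -> A}) (t s : 'I_T) (e : A).

Definition upd c t e : {ffun 'I_T -> A} := [ffun s => if s == t then e else c s].

Lemma upd_id c t : upd c t (c t) = c.
Proof. by apply/ffunP => s; rewrite ffunE; case: eqP => // ->. Qed.

Lemma upd_upd c t e e' : upd (upd c t e) t e' = upd c t e'.
Proof. by apply/ffunP => s; rewrite !ffunE; case: eqP. Qed.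

Lemma upd_same c t e : upd c t e t = e.
Proof. by rewrite ffunE eqxx. Qed.

Lemma upd_diff c t s e : s != t -> upd c t e s = c s.
Proof. by rewrite ffunE => /negbTE->. Qed.

(** The pairs [(c, e)] are permuted by the involution that exchanges [e] with the value of [c] at
    [t]; each function is thus produced [#|A|] times. *)
Lemma sum_upd (F : {ffun 'I_T -> A} -> R) t :
  \sum_c \sum_e F (upd c t e) = #|A|%:R * \sum_c F c.
Proof.
rewrite pair_bigA /=.
pose i (p : {ffun 'I_T -> A} * A) := (upd p.1 t p.2, p.1 t).
have iK : involutive i.
  by move=> [c e]; rewrite /i /= upd_upd upd_id upd_same.
rewrite (reindex i) /=; last by exists i => x _; exact: iK.
under eq_bigr => p _ do rewrite upd_upd upd_id.
rewrite -(pair_bigA _ (fun c (_ : A) => F c)) /=.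
under eq_bigr => c _ do rewrite sumr_const.
by rewrite sumrMnl mulr_natl.
Qed.

Variable w : {ffun 'I_T -> A} -> 'I_T -> R.
Hypothesis w_adapted : forall c t s e, (t < s)%N -> w (upd c s e) t = w c t.
Hypothesis w_total : forall c t, \sum_e w (upd c t e) t = 1.

Definition Ew (H : {ffun 'I_T -> A} -> R) := \sum_c (\prod_t w c t) * H c.

(** Histories are total functions: the coordinates from [k] on carry no weight and range freely over
    [A]. This is the origin of the powers of [#|A|] below. *)
Definition Ew_upto (k : nat) (H : {ffun 'I_T -> A} -> R) :=
  \sum_c (\prod_(t < T | (t < k)%N) w c t) * H c.

Lemma Ew_uptoS t H :
  #|A|%:R * Ew_upto t.+1 H
  = Ew_upto t (fun c => \sum_e w (upd c t e) t * H (upd c t e)).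
Proof.
rewrite /Ew_upto -(sum_upd _ t); apply: eq_bigr => c _.
rewrite mulr_sumr; apply: eq_bigr => e _.
rewrite mulrA; congr (_ * _).
rewrite (bigD1 t) ?ltnSn //= mulrC; congr (_ * _).
apply: eq_big => [s|s /andP[st nst]].
  by rewrite ltnS -val_eqE /= ltn_neqAle andbC.
by rewrite w_adapted // ltn_neqAle nst.
Qed.

Lemma Ew_uptoE m k H : (k + m)%N = T ->
  (forall c s e, (k <= s)%N -> H (upd c s e) = H c) ->
  #|A|%:R ^+ m * Ew H = Ew_upto k H.
Proof.
elim: m k => [|m IH] k kT HH.
  rewrite expr0 mul1r; apply: eq_bigr => c _; congr (_ * _).
  by apply: eq_bigl => t; rewrite -[k]addn0 kT ltn_ord.
have kltT : (k < T)%N by rewrite -kT -addSnnS leq_addr.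
rewrite exprS -mulrA (IH k.+1) ?addSnnS//; last first.
  by move=> c s e ks; apply: HH; apply: ltnW.
rewrite (Ew_uptoS (Ordinal kltT)); apply: eq_bigr => c _; congr (_ * _).
rewrite -[RHS]mul1r -(w_total c (Ordinal kltT)) mulr_suml.
by apply: eq_bigr => e _; rewrite HH.
Qed.

(** The tower property, the value at [t] being averaged given the earlier ones. Both sides become
    partial sums, stopped after [t] on the left and before [t] on the right, and one resummation of
    the coordinate [t] matches them. *)
Lemma Ew_step t H :
  (forall c s e, (t < s)%N -> H (upd c s e) = H c) ->
  Ew H = Ew (fun c => \sum_e w (upd c t e) t * H (upd c t e)).
Proof.
move=> HH; set H' := fun c => _.
have [A0|A0] := posnP #|A|.
  by rewrite /Ew !big1 // => c; move: (card0_eq A0 (c t)); rewrite inE.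
have q0 : #|A|%:R != 0 :> R by rewrite pnatr_eq0 -lt0n.
have tT : (t.+1 + (T - t.+1))%N = T by rewrite subnKC.
apply: (mulfI (expf_neq0 (T - t) q0)).
have eT : (T - t = (T - t.+1).+1)%N by rewrite -subnSK.
rewrite (@Ew_uptoE _ t H'); last 2 first.
- by rewrite subnKC // ltnW.
- move=> c s e ts; rewrite /H'; apply: eq_bigr => e' _.
  have [->|st] := eqVneq s t; first by rewrite upd_upd.
  have lts : (t < s)%N by rewrite ltn_neqAle ts andbT eq_sym.
  have swap : upd (upd c s e) t e' = upd (upd c t e') s e.
    apply/ffunP => r; rewrite !ffunE; case: (eqVneq r t) => // ->.
    by rewrite eq_sym (negbTE st).
  by rewrite swap w_adapted // HH.
by rewrite eT exprS -mulrA (Ew_uptoE tT) // Ew_uptoS.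
Qed.

Lemma Ew_le H1 H2 : (forall c t, 0 <= w c t) ->
  (forall c, H1 c <= H2 c) -> Ew H1 <= Ew H2.
Proof.
by move=> w0 H12; apply: ler_sum => c _; apply: ler_wpM2l => //; apply: prodr_ge0.
Qed.

Lemma EwD H1 H2 : Ew (fun c => H1 c + H2 c) = Ew H1 + Ew H2.
Proof. by rewrite -big_split /=; apply: eq_bigr => c _; rewrite mulrDr. Qed.

Lemma EwZ a H : Ew (fun c => a * H c) = a * Ew H.
Proof. by rewrite mulr_sumr; apply: eq_bigr => c _; rewrite mulrCA. Qed.

Lemma Ew_const a : (0 < #|A|)%N -> Ew (fun=> a) = a.
Proof.
move=> A0; have q0 : #|A|%:R != 0 :> R by rewrite pnatr_eq0 -lt0n.
apply: (mulfI (expf_neq0 T q0)); rewrite (@Ew_uptoE T 0) // /Ew_upto.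
under eq_bigr => c _ do rewrite big_pred0 // mul1r.
by rewrite sumr_const card_ffun card_ord -[LHS]mulr_natl natrX.
Qed.

End Sequential_sampling.

Lemma sum_involution (R : realFieldType) (I : finType) (P : pred I) (i : I -> I)
    (F : I -> R) :
  (forall p, P p -> P (i p)) -> (forall p, P p -> i (i p) = p) ->
  \sum_(p | P p) F p = \sum_(p | P p) F (i p).
Proof.
move=> Pi iK; rewrite (reindex_onto i i) //; apply: eq_bigl => p.
apply/andP/idP => [[Pip /eqP ip]|Pp]; first by rewrite -ip; apply: Pi.
by rewrite Pi // iK // eqxx.
Qed.

Lemma sum_pairs (R : nmodType) (I J : finType) (P : pred I) (Q : I -> pred J)
    (F : I * J -> R) :
  \sum_(p | P p.1 && Q p.1 p.2) F p = \sum_(i | P i) \sum_(j | Q i j) F (i, j).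
Proof. by rewrite pair_big_dep; apply: eq_bigr => -[]. Qed.

(** * Exploring the pairing, and the equivalence of greedy with the reader *)

Section Deferred_decisions.
Variables (R : realType) (N T C : nat) (d : degrees N T).
Local Notation PP := (perfect_pairings d).
Implicit Types (f : pairing d) (h k : halfU d) (s : halfV d) (sl : seq (halfV d)).
Implicit Types (Q : {set halfU d}) (S : {set halfU d} * bool).
Implicit Types (x : {ffun 'I_N -> nat}).

Definition swap f h k : pairing d := [ffun y => f (tperm h k y)].

Lemma swapC f h k : swap f h k = swap f k h.
Proof. by rewrite /swap tpermC. Qed.

Lemma swapK f h k : swap (swap f h k) h k = f.
Proof. by apply/ffunP => y; rewrite !ffunE tpermK. Qed.

Lemma swap_PP f h k : f \in PP -> swap f h k \in PP.
Proof.
rewrite !inE => /andP[/injectiveP fi /forallP fs]; apply/andP; split.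
  apply/injectiveP => y z; rewrite !ffunE => /fi; exact: perm_inj.
apply/forallP => v; have /codomP[y ->] := fs v.
by apply/codomP; exists (tperm h k y); rewrite ffunE tpermK.
Qed.

Lemma swapL f h k : swap f h k h = f k.
Proof. by rewrite ffunE tpermL. Qed.

Lemma swapR f h k : swap f h k k = f h.
Proof. by rewrite ffunE tpermR. Qed.

Lemma swapD f h k y : y != h -> y != k -> swap f h k y = f y.
Proof. by move=> yh yk; rewrite ffunE tpermD // eq_sym. Qed.

Definition partner s f : option (halfU d) := [pick h | f h == s].

Lemma partnerE f h : f \in PP -> partner (f h) f = Some h.
Proof.
rewrite inE => /andP[/injectiveP fi _]; rewrite /partner.
by case: pickP => [y /eqP /fi -> //|/(_ h)]; rewrite eqxx.
Qed.

Lemma partner_ex s f : f \in PP -> exists2 h, f h = s & partner s f = Some h.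
Proof.
move=> fP; move: (fP); rewrite inE => /andP[_ /forallP/(_ s)/codomP[h sE]].
by exists h; rewrite sE // partnerE.
Qed.

Lemma PP_inj f h k : f \in PP -> f h = f k -> h = k.
Proof. by rewrite inE => /andP[/injectiveP fi _] /fi. Qed.

Definition claimed Q (i : 'I_N) : nat := #|[set h in Q | tag h == Some i]|.

Definition loads Q : {ffun 'I_N -> nat} := [ffun i => minn C (claimed Q i)].

(* The half-edges of the balancing vertex [None] are never free: reading one of
   them is lost, as the corresponding edge is deleted. *)
Definition free x h : bool := if tag h is Some i then (x i < C)%N else false.

Definition hit Q h := free (loads Q) h.

Definition bump x h : {ffun 'I_N -> nat} := [ffun i => x i + (tag h == Some i)]%N.

Lemma claimed_setU1 Q h i : h \notin Q ->
  claimed (h |: Q) i = (claimed Q i + (tag h == Some i))%N.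
Proof.
move=> hQ; rewrite /claimed; case: eqP => [hi|hi].
  have -> : [set y in h |: Q | tag y == Some i] = h |: [set y in Q | tag y == Some i].
    by apply/setP => y; rewrite !inE; case: eqVneq => //= ->; rewrite hi eqxx.
  by rewrite cardsU1 inE (negbTE hQ) /= addnC.
rewrite addn0; apply: eq_card => y; rewrite !inE.
by case: eqVneq => //= ->; rewrite (negbTE hQ); apply/eqP.
Qed.

Lemma hitE Q h : hit Q h = if tag h is Some i then (claimed Q i < C)%N else false.
Proof. by rewrite /hit /free; case: tag => // i; rewrite ffunE gtn_min ltnn. Qed.

Lemma loads_hit Q h : h \notin Q -> hit Q h -> loads (h |: Q) = bump (loads Q) h.
Proof.
move=> hQ; rewrite hitE => hh; apply/ffunP => i; rewrite !ffunE claimed_setU1 //.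
by move: hh; case: (tag h) => // j jC; case: eqP => [[<-]|_]; lia.
Qed.

Lemma loads_miss Q h : h \notin Q -> ~~ hit Q h -> loads (h |: Q) = loads Q.
Proof.
move=> hQ; rewrite hitE => hh; apply/ffunP => i; rewrite !ffunE claimed_setU1 //.
by move: hh; case: (tag h) => [j|_]; [case: eqP => [[<-]|_]; lia|rewrite addn0].
Qed.

(* The boolean records that the arriving vertex has found a free half-edge, after
   which it stops reading. *)
Definition read f S s :=
  if S.2 then S else
  if partner s f is Some h then (h |: S.1, hit S.1 h) else S.

Lemma foldl_read_true f Q sl : foldl (read f) (Q, true) sl = (Q, true).
Proof. by elim: sl. Qed.

(** The law of one read once the pairing is averaged out, acting on functions of the state. With no
    half-edge unread the sum is empty and the value is 0, so mass is preserved only while half-edges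
    remain. *)
Definition read_op (g : {set halfU d} * bool -> R) S : R :=
  if S.2 then g S else
  (\sum_(h | h \notin S.1) g (h |: S.1, hit S.1 h)) / #|~: S.1|%:R.

(** Returning the former partner of [s] as second component is what makes the map an involution. A
    perfect pairing gives every [s] a partner, so the default [p.2] is never reached there. *)
Definition exchange s (p : pairing d * halfU d) : pairing d * halfU d :=
  let k := odflt p.2 (partner s p.1) in (swap p.1 p.2 k, k).

Lemma exchangeK s p : p.1 \in PP -> exchange s (exchange s p) = p.
Proof.
case: p => f h /= fP; have [k fk pk] := partner_ex s fP.
rewrite /exchange /= pk /=.
have -> : partner s (swap f h k) = Some h.
  by rewrite -fk -(swapL f h k) partnerE // swap_PP.
by rewrite /= swapC swapK.
Qed.

(* Pairing (f, h) with (f composed with the transposition of h and the partner of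
   [s]) shows that the partner of an unread [s] is uniform among unread
   half-edges, as long as the past is invariant under such exchanges. *)
Lemma sum_read s (St : pairing d -> {set halfU d} * bool) g :
  (forall f h k, f \in PP -> h \notin (St f).1 -> k \notin (St f).1 ->
     St (swap f h k) = St f) ->
  (forall f h, f \in PP -> f h = s -> h \notin (St f).1) ->
  \sum_(f in PP) g (read f (St f) s) = \sum_(f in PP) read_op g (St f).
Proof.
move=> blind disj.
rewrite (bigID (fun f => (St f).2)) [RHS](bigID (fun f => (St f).2)) /=.
congr (_ + _).
  by apply: eq_bigr => f /andP[_ b]; rewrite /read /read_op b.
pose F (p : pairing d * halfU d) : R :=
  g (p.2 |: (St p.1).1, hit (St p.1).1 p.2) / #|~: (St p.1).1|%:R.
pose P f := (f \in PP) && ~~ (St f).2.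
pose U f h := h \notin (St f).1.
have -> : \sum_(f | P f) read_op g (St f) = \sum_(f | P f) \sum_(h | U f h) F (f, h).
  by apply: eq_bigr => f /andP[_ nb]; rewrite /read_op (negbTE nb) /F mulr_suml.
rewrite -sum_pairs (@sum_involution _ _ _ (exchange s) F); first last.
- by move=> p /andP[/andP[fP _] _]; exact: exchangeK.
- case=> f h /= /andP[/andP[fP nb] hQ]; have [k fk pk] := partner_ex s fP.
  have kQ := disj _ _ fP fk.
  by rewrite /P /U pk /= swap_PP // blind // nb kQ.
rewrite sum_pairs; apply: eq_bigr => f /andP[fP nb].
have [k fk pk] := partner_ex s fP; have kQ := disj _ _ fP fk.
rewrite /read (negbTE nb) pk.
rewrite (eq_bigr (fun=> g (k |: (St f).1, hit (St f).1 k) / #|~: (St f).1|%:R));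
  last by move=> h hQ; rewrite /exchange pk /F /= blind.
rewrite sumr_const -[RHS]mulr_natr -mulrA.
have -> : #|[pred h | U f h]| = #|~: (St f).1|.
  by apply: eq_card => y; rewrite !inE.
rewrite mulVf ?mulr1 // pnatr_eq0 -lt0n.
by apply/card_gt0P; exists k; rewrite inE.
Qed.

Lemma partner_swap s f h k : f \in PP -> f h != s -> f k != s ->
  partner s (swap f h k) = partner s f.
Proof.
move=> fP hs ks; have [y fy ->] := partner_ex s fP.
have yh : y != h by apply: contraNneq hs => <-; rewrite fy.
have yk : y != k by apply: contraNneq ks => <-; rewrite fy.
by rewrite -fy -(swapD f yh yk) partnerE // swap_PP.
Qed.

(** Plays the part of measurability with respect to the past: the state has looked at no unexposed
    half-edge, so exchanging the partners of two of them cannot change it. *)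
Definition blind (St : pairing d -> {set halfU d} * bool) :=
  forall f h k, f \in PP -> h \notin (St f).1 -> k \notin (St f).1 ->
     St (swap f h k) = St f.

Lemma read_sub f S s : S.1 \subset (read f S s).1.
Proof.
by rewrite /read; case: S => Q [] //=; case: partner => //= h; rewrite subsetUr.
Qed.

Lemma blind_read St s : blind St -> blind (fun f => read f (St f) s).
Proof.
move=> bS f h k fP hn kn.
have hQ : h \notin (St f).1 by apply: contraNN hn; apply/subsetP/read_sub.
have kQ : k \notin (St f).1 by apply: contraNN kn; apply/subsetP/read_sub.
rewrite bS //; move: hn kn; rewrite /read; case: (St f) => Q [] //=.
have [y fy py] := partner_ex s fP; rewrite py /= !inE !negb_or.
move=> /andP[hy _] /andP[ky _]; rewrite partner_swap ?py //.
  by apply: contraNneq hy => fh; apply/eqP/(PP_inj fP); rewrite fh fy.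
by apply: contraNneq ky => fh; apply/eqP/(PP_inj fP); rewrite fh fy.
Qed.

Definition unread (St : pairing d -> {set halfU d} * bool) sl :=
  forall f h, f \in PP -> f h \in sl -> h \notin (St f).1.

Lemma unread_read St s sl : s \notin sl -> unread St (s :: sl) ->
  unread (fun f => read f (St f) s) sl.
Proof.
move=> ssl uS f h fP fh; have := uS f h fP; rewrite inE fh orbT => /(_ isT).
rewrite /read; case: (St f) => Q [] //= hQ.
have [y fy ->] := partner_ex s fP; rewrite /= !inE negb_or hQ andbT.
by apply: contraNneq ssl => hy; rewrite -fy -hy.
Qed.

(** [blind] and [unread] are the two conditions under which the next partner is uniform, and both
    survive a read, so the averaging can be repeated slot by slot. *)
Lemma sum_foldl_read St sl g : uniq sl -> blind St -> unread St sl ->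
  \sum_(f in PP) g (foldl (read f) (St f) sl)
  = \sum_(f in PP) iter (size sl) read_op g (St f).
Proof.
elim: sl St => [|s sl IH] St //= /andP[ssl usl] bS uS.
rewrite (IH (fun f => read f (St f) s)) //.
- by rewrite sum_read // => f h fP fh; apply: uS => //; rewrite fh mem_head.
- exact: blind_read.
- exact: unread_read.
Qed.

Lemma blind_foldl St sl : blind St -> blind (fun f => foldl (read f) (St f) sl).
Proof.
elim: sl St => [|s sl IH] St //= bS.
exact/(IH (fun f => read f (St f) s))/blind_read.
Qed.

Definition candidates f x sl : {set halfU d} := [set h | (f h \in sl) && free x h].

(** The mean of [g] after one arrival of greedy. Candidates are half-edges rather than vertices, so
    parallel edges keep their multiplicity in the uniform choice; [g] may still look at the
    pairing. *)
Definition choice_op sl (g : pairing d -> {ffun 'I_N -> nat} -> R) f x : R :=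
  let B := candidates f x sl in
  if #|B| == 0 then g f x else (\sum_(h in B) g f (bump x h)) / #|B|%:R.

(* Greedy picks a uniform free half-edge among the partners of [sl], a reader takes
   the first one: exchanging partners inside [sl] equates the two laws. *)
Lemma sum_choice sl (P : pred (pairing d)) (Qf : pairing d -> {set halfU d}) g :
  uniq sl ->
  (forall f h k, f \in PP -> f h \in sl -> f k \in sl ->
     [/\ P (swap f h k) = P f, Qf (swap f h k) = Qf f & g (swap f h k) = g f]) ->
  (forall f h, f \in PP -> f h \in sl -> h \notin Qf f) ->
  \sum_(f in PP | P f) choice_op sl g f (loads (Qf f))
  = \sum_(f in PP | P f) g f (loads (foldl (read f) (Qf f, false) sl).1).
Proof.
elim: sl P Qf => [|s sl IH] P Qf /=.
  move=> _ _ _; apply: eq_bigr => f _; rewrite /choice_op.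
  suff -> : candidates f (loads (Qf f)) [::] = set0 by rewrite cards0 eqxx.
  by apply/setP => h; rewrite !inE.
move=> /andP[ssl usl] sym disj.
pose H f := if partner s f is Some h then hit (Qf f) h else false.
rewrite (bigID H) [RHS](bigID H) /=; congr (_ + _); last first.
  (* A miss on [s]: its partner is no candidate and exposing it leaves the loads unchanged, so the
     remaining slots are handled by induction, with the miss added to the predicate [P]. *)
  pose Qf' f := if partner s f is Some h then h |: Qf f else Qf f.
  transitivity (\sum_(f in PP | P f && ~~ H f) choice_op sl g f (loads (Qf' f))).
    apply: eq_big => [f|f /andP[/andP[fP _]]]; first by rewrite andbA.
    rewrite /H /Qf'; have [k fk pk] := partner_ex s fP; rewrite pk => nk.
    have kQ : k \notin Qf f by apply: disj => //; rewrite fk mem_head.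
    rewrite loads_miss // /choice_op.
    suff -> : candidates f (loads (Qf f)) (s :: sl) = candidates f (loads (Qf f)) sl by [].
    apply/setP => h; rewrite !inE; case: eqP => //= fh.
    rewrite -[free _ _]/(hit (Qf f) h).
    by rewrite (PP_inj fP (etrans fh (esym fk))) (negbTE nk) andbF.
  rewrite IH //.
  - apply: eq_big => [f|f /andP[fP /andP[_]]]; first by rewrite andbA.
    rewrite /H /Qf'; have [k fk pk] := partner_ex s fP; rewrite pk => nk.
    by rewrite /read /= pk (negbTE nk).
  - move=> f h k fP fh fk.
    have [|| -> Qe ge] := sym f h k fP; try by rewrite inE ?fh ?fk orbT.
    have pe : partner s (swap f h k) = partner s f.
      by apply: partner_swap => //; apply: contraNneq ssl => <-.
    by rewrite /H /Qf' pe Qe.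
  - move=> f h fP fh; rewrite /Qf'; have [k fk pk] := partner_ex s fP; rewrite pk.
    have hQ : h \notin Qf f by apply: (disj f h fP); rewrite inE fh orbT.
    rewrite !inE negb_or hQ andbT.
    by apply: contraNneq ssl => hk; rewrite -fk -hk.
pose P' f := [&& f \in PP, P f & H f].
pose B f := candidates f (loads (Qf f)) (s :: sl).
pose F (p : pairing d * halfU d) := g p.1 (bump (loads (Qf p.1)) p.2) / #|B p.1|%:R.
have BP f k : P' f -> partner s f = Some k -> f k = s -> k \in B f.
  by move=> /and3P[_ _]; rewrite /H => + pk fk; rewrite pk inE fk mem_head.
have swB f h k : f \in PP -> P f -> h \in B f -> k \in B f ->
    [/\ P (swap f h k), Qf (swap f h k) = Qf f, g (swap f h k) = g f &
        B (swap f h k) = B f].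
  move=> fP Pf; rewrite !inE -![_ || _]/(_ \in s :: sl) => /andP[fh freeh] /andP[fk freek].
  have [-> Qe ge] := sym f h k fP fh fk; split => //.
  rewrite /B Qe; apply/setP => y; rewrite !inE -![_ || _]/(_ \in s :: sl).
  have [->|yh] := eqVneq y h; first by rewrite swapL fh fk.
  have [->|yk] := eqVneq y k; first by rewrite swapR fh fk.
  by rewrite swapD.
(* A hit on [s]: the reader takes the partner of [s], greedy a uniform element of [B f]. Exchanging
   the partners of these two half-edges leaves [B f] unchanged and carries the uniform choice to the
   partner of [s]. *)
transitivity (\sum_(f | P' f) \sum_(h | h \in B f) F (f, h)).
  apply: eq_big => [f|f /andP[/andP[fP Pf] Hf]]; first by rewrite /P' andbA.
  have [k fk pk] := partner_ex s fP.
  have kB : k \in B f by apply: BP pk fk; rewrite /P' fP Pf.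
  rewrite /choice_op -/(B f) ifF ?mulr_suml //.
  by apply/negbTE; rewrite -lt0n; apply/card_gt0P; exists k.
rewrite -sum_pairs (@sum_involution _ _ _ (exchange s) F); first last.
- by move=> p /andP[/and3P[fP _ _] _]; exact: exchangeK.
- case=> f h /= /andP[P'f hB]; have /and3P[fP Pf Hf] := P'f.
  have [k fk pk] := partner_ex s fP.
  have kB : k \in B f by apply: BP pk fk.
  have [Pw Qe ge Be] := swB f h k fP Pf hB kB.
  rewrite pk /= Be kB andbT /P' swap_PP // Pw /= /H.
  have -> : partner s (swap f h k) = Some h.
    by rewrite -fk -(swapL f h k) partnerE // swap_PP.
  by rewrite Qe; move: hB; rewrite inE => /andP[].
rewrite (sum_pairs P' (fun f h => h \in B f)); apply: eq_big => [f|f P'f]; first by rewrite /P' andbA.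
have /and3P[fP Pf Hf] := P'f.
have [k fk pk] := partner_ex s fP; have kB : k \in B f by apply: BP pk fk.
have kQ : k \notin Qf f by apply: disj => //; rewrite fk mem_head.
have hk : hit (Qf f) k by move: Hf; rewrite /H pk.
rewrite /read pk /= hk foldl_read_true /= loads_hit //.
transitivity (\sum_(h | h \in B f) g f (bump (loads (Qf f)) k) / #|B f|%:R).
  apply: eq_bigr => h hB; rewrite /exchange pk /F /=.
  by have [_ -> -> ->] := swB f h k fP Pf hB kB.
rewrite sumr_const -[LHS]mulr_natr -mulrA mulVf ?mulr1 // pnatr_eq0 -lt0n.
by apply/card_gt0P; exists k.
Qed.

Definition slots (t : 'I_T) : seq (halfV d) :=
  [seq Tagged (fun v => 'I_(degV d v)) j | j <- enum 'I_(degV d (Some t))].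

Lemma mem_slots t s : (s \in slots t) = (tag s == Some t).
Proof.
apply/mapP/eqP => [[j _ ->] //|]; case: s => v j /= vt.
by subst v; exists j => //; rewrite mem_enum.
Qed.

Lemma uniq_slots t : uniq (slots t).
Proof.
rewrite map_inj_uniq ?enum_uniq // => i j /eqP.
by rewrite /Tagged -tag_eqE /tag_eq /= eqxx tagged_asE => /eqP.
Qed.

Lemma size_slots t : size (slots t) = d.2 t.
Proof. by rewrite size_map size_enum_ord. Qed.

Fixpoint reads f n : {set halfU d} :=
  if n is m.+1 then
    if insub m is Some t then (foldl (read f) (reads f m, false) (slots t)).1
    else reads f m
  else set0.

Lemma readsS f (t : 'I_T) :
  reads f t.+1 = (foldl (read f) (reads f t, false) (slots t)).1.
Proof. by rewrite /= valK. Qed.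

Definition before n s : bool := if tag s is Some t then (t < n)%N else false.

Lemma before_slots (t : 'I_T) s n : s \in slots t -> before n s = (t < n)%N.
Proof. by rewrite mem_slots /before => /eqP ->. Qed.

Lemma beforeS n s : before n s -> before n.+1 s.
Proof. by rewrite /before; case: tag => // t; apply: leqW. Qed.

Lemma foldl_read_sub f S sl h : f \in PP -> h \in (foldl (read f) S sl).1 ->
  (h \in S.1) || (f h \in sl).
Proof.
move=> fP; elim: sl S => [|s sl IH] S /=; first by move=> ->.
move=> /IH /orP[|fh]; last by rewrite inE fh !orbT.
rewrite /read; case: S => Q [] /=; first by move=> ->.
have [k fk ->] := partner_ex s fP; rewrite /= !inE => /orP[/eqP ->|-> //].
by rewrite fk eqxx orbT.
Qed.

Lemma reads_before f n h : f \in PP -> h \in reads f n -> before n (f h).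
Proof.
move=> fP; elim: n => [|n IH]; first by rewrite inE.
rewrite [reads _ _]/=; case: insubP => [t _ tn|_ /IH /beforeS //].
move=> /(foldl_read_sub fP)/= /orP[/IH/beforeS //|].
by rewrite -tn => /before_slots ->.
Qed.

Lemma blind_reads n : blind (fun f => (reads f n, false)).
Proof.
elim: n => [|n IH] // f h k fP; rewrite [reads _ _]/= [reads (swap _ _ _) _]/=.
case: insubP => [t _ tn|_ hh kk]; last exact: IH.
have := @blind_foldl _ (slots t) IH f h k fP.
by move=> /[apply] /[apply] ->.
Qed.

Lemma unread_reads (n : nat) (t : 'I_T) : (n <= t)%N ->
  unread (fun f => (reads f n, false)) (slots t).
Proof.
move=> nt f h fP fh; apply/negP => /= /(reads_before fP).
by rewrite (before_slots _ fh) ltnNge nt.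
Qed.

(* Transition operator, on exposed sets, of the arrival of a vertex of degree [m]. *)
Definition vertex_op m (g : {set halfU d} -> R) Q : R :=
  iter m read_op (fun S => g S.1) (Q, false).

Lemma vertex_opS m g Q : vertex_op m.+1 g Q =
  (\sum_(h | h \notin Q) if hit Q h then g (h |: Q) else vertex_op m g (h |: Q))
  / #|~: Q|%:R.
Proof.
rewrite /vertex_op iterS {1}/read_op /=; congr (_ / _); apply: eq_bigr => h hQ.
by case: hit => //; elim: m => [|m IH] //=; rewrite {1}/read_op.
Qed.

Lemma sum_reads (t : 'I_T) (g : {set halfU d} -> R) :
  \sum_(f in PP) g (reads f t.+1) = \sum_(f in PP) vertex_op (d.2 t) g (reads f t).
Proof.
under eq_bigr do rewrite readsS.
rewrite (@sum_foldl_read (fun f => (reads f t, false)) (slots t) (fun S => g S.1)).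
- by rewrite size_slots.
- exact: uniq_slots.
- exact: blind_reads.
- exact: unread_reads.
Qed.

Local Notation step f := (@greedy_step N T d R C f).

Definition load_of (c : choices d) n : {ffun 'I_N -> nat} :=
  [ffun i => load (matching_after c n) (Some i)].

Lemma matching_after_upd (c : choices d) (t : 'I_T) n (e : option (edge d)) :
  (n <= t)%N -> matching_after (upd c t e) n = matching_after c n.
Proof.
move=> nt; apply/setP => y; rewrite !inE.
apply/existsP/existsP => -[r /andP[rn cr]]; exists r; rewrite rn /=; move: cr;
  by rewrite upd_diff //; apply: contraTneq rn => ->; rewrite -leqNgt.
Qed.

Lemma step_adapted f (c : choices d) (t s : 'I_T) e : (t < s)%N ->
  step f (upd c s e) t = step f c t.
Proof.
move=> ts; rewrite /greedy_step matching_after_upd 1?ltnW //.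
by rewrite upd_diff //; apply: contraTneq ts => ->; rewrite ltnn.
Qed.

Lemma step_total f (c : choices d) t : \sum_e step f (upd c t e) t = 1.
Proof.
rewrite /greedy_step.
under eq_bigr => e _ do rewrite matching_after_upd // upd_same.
set B := available C f _ t.
rewrite (bigD1 None) //= (reindex_omap Some id) /=; last by case.
under eq_bigl => e do rewrite eqxx.
rewrite -mulr_suml -natr_sum.
have -> : (\sum_e (e \in B) = #|B|)%N.
  by rewrite -sum1_card [RHS]big_mkcond; apply: eq_bigr => e _; case: (_ \in _).
have [->|B0] := eqVneq #|B| 0%N; first by rewrite mul0r addr0.
by rewrite add0r divff // pnatr_eq0.
Qed.

Lemma step_ge0 f (c : choices d) t : 0 <= step f c t.
Proof. by rewrite /greedy_step; case: (c t) => [e|]; rewrite ?divr_ge0. Qed.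

(** Choices of weight zero are arbitrary and may record pairs that are no edges; a nonzero product
    forces each recorded pair to have been available at its arrival. *)
Lemma mem_matching_after f (c : choices d) n e :
  \prod_t step f c t != 0 -> e \in matching_after c n ->
  [/\ before n e.2, tag e.1 != None & f e.1 = e.2].
Proof.
move=> /prodf_neq0/= st; rewrite inE => /existsP[t /andP[tn /eqP ct]].
have := st t isT; rewrite /greedy_step ct mulf_eq0 negb_or => /andP[].
rewrite pnatr_eq0 eqb0 negbK !inE => /andP[/and3P[/eqP fe t1 _] /andP[/eqP t2 _]] _.
by rewrite /before t2.
Qed.

Lemma card_matching_after f (c : choices d) n :
  \prod_t step f c t != 0 ->
  #|matching_after c n| = (\sum_i load_of c n i)%N.
Proof.
move=> st; rewrite -sum1_card (partition_big (fun e : edge d => tag e.1) predT) //=.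
rewrite (bigD1 None) //= big_pred0 => [|e]; last first.
  by apply/negP => /andP[/(mem_matching_after st)[_ /negbTE -> _]].
rewrite add0n (reindex_omap Some id) /=; last by case.
apply: eq_big => [i|i _]; first by rewrite eqxx.
by rewrite ffunE /load -sum1_card; apply: eq_bigl => e; rewrite inE.
Qed.

Lemma load_of_upd f (c : choices d) (t : 'I_T) h : \prod_t step f c t != 0 ->
  tag (f h) = Some t ->
  load_of (upd c t (Some (h, f h))) t.+1 = bump (load_of c t) h.
Proof.
move=> st fh; apply/ffunP => i; rewrite !ffunE /load.
have -> : matching_after (upd c t (Some (h, f h))) t.+1 = (h, f h) |: matching_after c t.
  rewrite -(matching_after_upd c (Some (h, f h)) (leqnn t)).
  apply/setP => e; rewrite !inE; apply/existsP/orP => [[r /andP[]]|[/eqP ->|]].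
  - rewrite ltnS leq_eqVlt => /orP[/eqP/val_inj -> |rt cr].
      by rewrite upd_same => /eqP[->]; left.
    by right; apply/existsP; exists r; rewrite rt.
  - by exists t; rewrite upd_same ltnSn /=.
  - by case/existsP => r /andP[rt cr]; exists r; rewrite cr ltnW.
have hM : (h, f h) \notin matching_after c t.
  apply/negP => /(mem_matching_after st) [+ _ _].
  by rewrite /before fh ltnn.
case: eqP => [hi|hi].
  have -> : [set e in (h, f h) |: matching_after c t | tag e.1 == Some i]
      = (h, f h) |: [set e in matching_after c t | tag e.1 == Some i].
    by apply/setP => e; rewrite !inE; case: eqVneq => //= ->; rewrite hi eqxx.
  by rewrite cardsU1 inE (negbTE hM) /= addnC.
rewrite addn0; apply: eq_card => e; rewrite in_set [in RHS]in_set in_setU1.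
by case: eqVneq => //= ->; rewrite (negbTE hM) /=; apply/eqP.
Qed.

Lemma load_of_updNone (c : choices d) (t : 'I_T) :
  load_of (upd c t None) t.+1 = load_of c t.
Proof.
apply/ffunP => i; rewrite !ffunE; congr load.
rewrite -(matching_after_upd c None (leqnn t)).
apply/setP => e; rewrite !inE; apply/existsP/existsP => -[r /andP[]].
  rewrite ltnS leq_eqVlt => /orP[/eqP/val_inj ->|rt cr]; first by rewrite upd_same.
  by exists r; rewrite rt.
by move=> rt cr; exists r; rewrite cr ltnW.
Qed.

Lemma available_candidates f (c : choices d) (t : 'I_T) :
  available C f (matching_after c t) t
  = [set (h, f h) | h in candidates f (load_of c t) (slots t)].
Proof.
apply/setP => -[h s]; rewrite !inE /=; apply/idP/imsetP.
  move=> /and3P[/and3P[/eqP fh p _] ts lC]; exists h; last by rewrite fh.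
  rewrite !inE mem_slots fh ts /free; move: p lC.
  by case: (tag h) => // i _; rewrite ffunE.
move=> [k]; rewrite !inE mem_slots /free => /andP[tk].
case ek: (tag k) => [i|] //; rewrite ffunE => lC [-> ->].
by rewrite eqxx ek (eqP tk) lC eqxx.
Qed.

(** Given the earlier choices, the edges available at [t] correspond one to one to the candidates,
    so averaging over the choice at [t] is applying [choice_op]. *)
Lemma Ew_load f (t : 'I_T) (g : pairing d -> {ffun 'I_N -> nat} -> R) :
  Ew (step f) (fun c => g f (load_of c t.+1))
  = Ew (step f) (fun c => choice_op (slots t) g f (load_of c t)).
Proof.
rewrite (Ew_step (step_adapted f) (step_total f) (t := t)); last first.
  by move=> c s e ts; rewrite /load_of; congr (g f _); apply/ffunP => i;
    rewrite !ffunE matching_after_upd.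
apply: eq_bigr => c _; have [->|st] := eqVneq (\prod_t step f c t) 0.
  by rewrite !mul0r.
congr (_ * _); rewrite (bigD1 None) //= (reindex_omap Some id) /=; last by case.
under [X in _ + X]eq_bigl => e do rewrite eqxx.
under eq_bigr => e _.
  rewrite /greedy_step upd_same matching_after_upd // mulrAC -mulrA.
  over.
rewrite /greedy_step upd_same matching_after_upd // load_of_updNone.
set B := available C f _ t; rewrite /choice_op.
have BE : B = [set (h, f h) | h in candidates f (load_of c t) (slots t)].
  exact: available_candidates.
have BC : #|B| = #|candidates f (load_of c t) (slots t)|.
  by rewrite BE card_imset // => h k [].
rewrite -BC; have [B0|B0] := eqVneq #|B| 0%N.
  rewrite mul1r big1 ?addr0 // => e _.
  by rewrite (card0_eq B0) mul0r.
rewrite mul0r add0r mulr_suml.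
transitivity (\sum_(e in B) g f (load_of (upd c t (Some e)) t.+1) / #|B|%:R).
  rewrite [RHS]big_mkcond; apply: eq_bigr => e _.
  by case: ifP => _; rewrite ?mul0r // mul1r.
rewrite BE big_imset /=; last by move=> h k _ _ [].
apply: eq_bigr => h; rewrite inE mem_slots => /andP[/eqP fh _].
by rewrite load_of_upd.
Qed.

(** The test function must be allowed to depend on the pairing, because [choice_op] does. The
    induction survives since the candidates at the last arrival concern its own slots only, which
    exchanges among earlier slots leave alone. *)
Lemma sum_load n (g : pairing d -> {ffun 'I_N -> nat} -> R) : (n <= T)%N ->
  (forall f h k, f \in PP -> before n (f h) -> before n (f k) ->
     g (swap f h k) = g f) ->
  \sum_(f in PP) Ew (step f) (fun c => g f (load_of c n))
  = \sum_(f in PP) g f (loads (reads f n)).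
Proof.
elim: n g => [|n IH] g nT sym.
  apply: eq_bigr => f fP; rewrite -[RHS](Ew_const (step_adapted f) (step_total f)).
    apply: eq_bigr => c _; congr (_ * g f _); apply/ffunP => i; rewrite !ffunE /load.
    rewrite /claimed !eq_card0 ?minn0 // => y; rewrite !inE //.
    by apply/andP => -[/existsP[]].
  by rewrite card_option.
pose t := Ordinal nT.
rewrite (eq_bigr (fun f => Ew (step f)
    (fun c => choice_op (slots t) g f (load_of c t)))); last first.
  by move=> f _; exact: (Ew_load f t g).
rewrite (IH (choice_op (slots t) g)) 1?ltnW //.
  rewrite (eq_bigl (fun f => (f \in PP) && predT f)) => [|f]; last by rewrite andbT.
  rewrite (@sum_choice _ predT (fun f => reads f t)) ?uniq_slots //.
  - by apply: eq_big => [f|f _]; rewrite ?andbT // -[n]/(nat_of_ord t) readsS.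
  - move=> f h k fP fh fk; split => //.
      have uh := unread_reads (leqnn t) fP fh.
      have uk := unread_reads (leqnn t) fP fk.
      by case: (blind_reads (n := t) fP uh uk).
    by apply: sym => //; rewrite (before_slots _ fh, before_slots _ fk) /=.
  - by move=> f h fP fh; apply: (unread_reads (leqnn t) fP fh).
move=> f h k fP fh fk; apply/funext => x; rewrite /choice_op.
have -> : candidates (swap f h k) x (slots t) = candidates f x (slots t).
  have nb s : before n s -> (s \in slots t) = false.
    by move=> bs; apply/negP => st; move: bs; rewrite (before_slots _ st) ltnn.
  apply/setP => y; rewrite !inE; congr (_ && _).
  have [->|yh] := eqVneq y h; first by rewrite swapL !nb.
  have [->|yk] := eqVneq y k; first by rewrite swapR !nb.
  by rewrite swapD.
by rewrite sym // beforeS.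
Qed.

Lemma sum_greedy n (phi : nat -> R) : (n <= T)%N ->
  \sum_(f in PP) \sum_(c : choices d)
     (\prod_t step f c t) * phi #|matching_after c n|
  = \sum_(f in PP) phi (\sum_i loads (reads f n) i)%N.
Proof.
move=> nT; rewrite -(@sum_load n (fun _ x => phi (\sum_i x i)%N)) //.
apply: eq_bigr => f _; apply: eq_bigr => c _.
have [->|st] := eqVneq (\prod_t step f c t) 0; first by rewrite !mul0r.
by rewrite (card_matching_after _ st).
Qed.

End Deferred_decisions.

Lemma matching_after_mono N T (d : degrees N T) (c : choices d) j k : (j <= k)%N ->
  (#|matching_after c j| <= #|matching_after c k|)%N.
Proof.
move=> jk; apply/subset_leq_card/subsetP => e; rewrite !inE => /existsP[t /andP[tj ct]].
by apply/existsP; exists t; rewrite ct (leq_trans tj jk).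
Qed.

Lemma card_matching_after_le N T (d : degrees N T) (c : choices d) j m :
  (#|matching_after c (j + m)| <= #|matching_after c j| + m)%N.
Proof.
elim: m => [|m IH]; first by rewrite !addn0.
rewrite !addnS; apply: leq_trans (_ : #|matching_after c (j + m)| + 1 <= _)%N; last first.
  by rewrite addn1 ltnS.
pose X : {set edge d} := if insub (j + m)%N is Some t then [set e | c t == Some e] else set0.
have cX : (#|X| <= 1)%N.
  rewrite /X; case: insubP => [t _ _|_]; last by rewrite cards0.
  case: (c t) => [e|].
    by rewrite (_ : [set _ | _] = [set e]) ?cards1 //; apply/setP => x; rewrite !inE eq_sym.
  by rewrite (_ : [set _ | _] = set0) ?cards0 //; apply/setP => x; rewrite !inE.
apply: (leq_trans _ (leq_add (leqnn _) cX)); apply: leq_trans (leq_card_setU _ _).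
apply/subset_leq_card/subsetP => e; rewrite !inE => /existsP[t /andP[]].
rewrite ltnS leq_eqVlt => /orP[/eqP tE ct|tlt ct].
  by rewrite /X -tE valK inE ct orbT.
by apply/orP; left; apply/existsP; exists t; rewrite tlt.
Qed.

(** * Concentration along the exposed half-edges *)

Section Read_chain.
Variables (R : realType) (N T C : nat) (d : degrees N T).
Local Notation PP := (perfect_pairings d).
Local Notation vertex_op := (@vertex_op R N T C d).
Local Notation hit := (@hit N T C d).
Implicit Types (Q : {set halfU d}) (h : halfU d) (g : {set halfU d} -> R).

Definition left_over Q : nat := #|~: Q|.

Lemma left_overE Q : (#|Q| + left_over Q)%N = #|{: halfU d}|.
Proof. exact: cardsC. Qed.

Lemma left_overU1 Q h : h \notin Q -> left_over (h |: Q) = (left_over Q).-1.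
Proof.
move=> hQ; have := left_overE Q; have := left_overE (h |: Q).
by rewrite cardsU1 hQ; lia.
Qed.

Lemma vertex_opE m g Q : vertex_op m.+1 g Q =
  (\sum_(h | h \notin Q) if hit Q h then g (h |: Q) else vertex_op m g (h |: Q))
  / (left_over Q)%:R.
Proof. exact: vertex_opS. Qed.

Lemma vertex_op_le m g1 g2 Q :
  (forall Q', Q \subset Q' -> (#|Q'| <= #|Q| + m)%N -> g1 Q' <= g2 Q') ->
  vertex_op m g1 Q <= vertex_op m g2 Q.
Proof.
elim: m Q => [|m IH] Q g12; first by apply: g12; rewrite ?addn0.
rewrite !vertex_opE ler_wpM2r ?invr_ge0 //; apply: ler_sum => h hQ.
have sub : Q \subset h |: Q by rewrite subsetUr.
case: ifP => _; first by apply: g12; rewrite ?cardsU1 ?hQ //; lia.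
apply: IH => Q' sQ cQ; apply: g12; first exact: subset_trans sub sQ.
by move: cQ; rewrite cardsU1 hQ; lia.
Qed.

Lemma vertex_opD m g1 g2 Q :
  vertex_op m (fun Q' => g1 Q' + g2 Q') Q = vertex_op m g1 Q + vertex_op m g2 Q.
Proof.
elim: m Q => [|m IH] Q //; rewrite !vertex_opE -mulrDl -big_split /=.
by congr (_ / _); apply: eq_bigr => h _; case: ifP.
Qed.

Lemma vertex_opZ m a g Q :
  vertex_op m (fun Q' => a * g Q') Q = a * vertex_op m g Q.
Proof.
elim: m Q => [|m IH] Q //; rewrite !vertex_opE mulrA mulr_sumr.
by congr (_ / _); apply: eq_bigr => h _; case: ifP.
Qed.

Lemma sum_unread_const Q (a : R) : \sum_(h | h \notin Q) a = (left_over Q)%:R * a.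
Proof.
rewrite sumr_const -[LHS]mulr_natl; congr (_%:R * _).
by apply: eq_card => h; rewrite !inE.
Qed.

Lemma vertex_op_const m a Q : (m <= left_over Q)%N -> vertex_op m (fun=> a) Q = a.
Proof.
elim: m Q => [|m IH] Q // mL; rewrite vertex_opE.
rewrite (eq_bigr (fun=> a)) => [|h hQ]; last first.
  by case: ifP => _ //; rewrite IH // left_overU1 //; lia.
by rewrite sum_unread_const mulrAC divff ?mul1r // pnatr_eq0; lia.
Qed.

(** Optional stopping for second moments: the cross term of the square averages to zero by the
    martingale identity, a read costs at most [kappa], and stopping at a hit only saves reads. *)
Lemma vertex_op_sq (Y : {set halfU d} -> R) (kappa : R) (L0 : nat) :
  (forall Q, (L0 < left_over Q)%N ->
     \sum_(h | h \notin Q) Y (h |: Q) = (left_over Q)%:R * Y Q) ->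
  (forall Q h, (L0 < left_over Q)%N -> h \notin Q ->
     (Y (h |: Q) - Y Q) ^+ 2 <= kappa) ->
  forall c m Q, (L0 + m <= left_over Q)%N ->
  vertex_op m (fun Q' => (Y Q' - c) ^+ 2) Q <= (Y Q - c) ^+ 2 + m%:R * kappa.
Proof.
move=> mart incr c; elim=> [|m IH] Q Lm; first by rewrite mul0r addr0.
have L0Q : (L0 < left_over Q)%N by lia.
have Lgt0 : 0 < (left_over Q)%:R :> R by rewrite ltr0n; lia.
rewrite vertex_opE ler_pdivrMr //.
have [h0 h0Q] : exists h, h \notin Q.
  have /card_gt0P[h] : (0 < left_over Q)%N by lia.
  by rewrite inE; exists h.
have kge0 : 0 <= kappa by apply: le_trans (incr _ _ L0Q h0Q); apply: sqr_ge0.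
pose F h := (Y Q - c) ^+ 2 + 2 * (Y Q - c) * (Y (h |: Q) - Y Q)
  + kappa + m%:R * kappa.
apply: (@le_trans _ _ (\sum_(h | h \notin Q) F h)).
  apply: ler_sum => h hQ; have := incr _ _ L0Q hQ => le1.
  have le2 : (Y (h |: Q) - c) ^+ 2 <= (Y Q - c) ^+ 2
      + 2 * (Y Q - c) * (Y (h |: Q) - Y Q) + kappa.
    suff -> : (Y (h |: Q) - c) ^+ 2 = (Y Q - c) ^+ 2
      + 2 * (Y Q - c) * (Y (h |: Q) - Y Q) + (Y (h |: Q) - Y Q) ^+ 2.
      by rewrite lerD2l.
    by ring.
  have mk : 0 <= m%:R * kappa by rewrite mulr_ge0.
  case: ifP => _; first by rewrite /F; lra.
  apply: (le_trans (IH (h |: Q) _)); first by rewrite left_overU1 //; lia.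
  by rewrite /F lerD2r.
rewrite /F !big_split /= !sum_unread_const -mulr_sumr big_split /=.
rewrite mart // sum_unread_const mulrN subrr mulr0 addr0 -natr1.
by rewrite le_eqVlt; apply/orP; left; apply/eqP; ring.
Qed.

Definition expect g n : R := (\sum_(f in PP) g (reads C f n)) / #|PP|%:R.

Definition spent n : nat := (\sum_(t < T | (t < n)%N) d.2 t)%N.

Lemma card_foldl_read (f : pairing d) (S : {set halfU d} * bool) sl :
  (#|(foldl (read C f) S sl).1| <= #|S.1| + size sl)%N.
Proof.
elim: sl S => [|s sl IH] S /=; first by rewrite addn0.
apply: (leq_trans (IH _)); rewrite addnS -addSn leq_add2r /read.
case: S => Q [] //=; case: partner => [h|] //=; rewrite cardsU1.
by rewrite -add1n leq_add2r leq_b1.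
Qed.

Lemma spentS (t : 'I_T) : spent t.+1 = (spent t + d.2 t)%N.
Proof.
rewrite /spent (bigD1 t) ?ltnSn //= addnC; congr (_ + _)%N.
by apply: eq_bigl => s; rewrite ltnS -val_eqE /= ltn_neqAle andbC.
Qed.

Lemma card_reads (f : pairing d) n : (n <= T)%N -> (#|reads C f n| <= spent n)%N.
Proof.
elim: n => [|n IH] nT; first by rewrite cards0.
pose t := Ordinal nT; rewrite -[n]/(nat_of_ord t) readsS spentS.
apply: (leq_trans (card_foldl_read _ _ _)); rewrite size_slots leq_add2r.
exact/IH/ltnW.
Qed.

Lemma left_over_reads (f : pairing d) n L0 : (n <= T)%N ->
  (L0 + spent n <= #|{: halfU d}|)%N -> (L0 <= left_over (reads C f n))%N.
Proof.
by move=> nT; have := card_reads f nT; rewrite -(left_overE (reads C f n)); lia.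
Qed.

Lemma expectS g (t : 'I_T) : expect g t.+1 = expect (vertex_op (d.2 t) g) t.
Proof. by rewrite /expect sum_reads. Qed.

Lemma expect_le g1 g2 n : (forall f, f \in PP -> g1 (reads C f n) <= g2 (reads C f n)) ->
  expect g1 n <= expect g2 n.
Proof. by move=> g12; rewrite ler_wpM2r ?invr_ge0 // ler_sum. Qed.

Lemma expectD g1 g2 n : expect (fun Q => g1 Q + g2 Q) n = expect g1 n + expect g2 n.
Proof. by rewrite /expect big_split mulrDl. Qed.

Lemma expectZ a g n : expect (fun Q => a * g Q) n = a * expect g n.
Proof. by rewrite /expect -mulr_sumr mulrA. Qed.

Lemma expect_sum (I : finType) (P : pred I) (g : I -> {set halfU d} -> R) n :
  expect (fun Q => \sum_(i | P i) g i Q) n = \sum_(i | P i) expect (g i) n.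
Proof. by rewrite /expect exchange_big mulr_suml. Qed.

(** An inequality for nonnegative constants also covers an empty set of pairings, where the quotient
    is 0; the existence of a perfect pairing is thus not an issue. *)
Lemma expect_cst_le a n : 0 <= a -> expect (fun=> a) n <= a.
Proof.
move=> a0; rewrite /expect sumr_const -[X in X / _]mulr_natl mulrAC.
have [->|P0] := eqVneq #|PP| 0%N; first by rewrite mul0r mul0r.
by rewrite divff ?mul1r // pnatr_eq0.
Qed.

Lemma expect_ge0 g n : (forall Q, 0 <= g Q) -> 0 <= expect g n.
Proof. by move=> g0; rewrite divr_ge0 // sumr_ge0. Qed.

(** The arrivals before [n] make at most [spent d n] reads, each costing [kappa]; the reserve of
    [L0] half-edges keeps all of them in the range where [Y] is a martingale. *)
Lemma expect_sq (Y : {set halfU d} -> R) (kappa : R) (L0 n : nat) :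
  (n <= T)%N -> (L0 + spent n <= #|{: halfU d}|)%N -> 0 <= kappa ->
  (forall Q, (L0 < left_over Q)%N ->
     \sum_(h | h \notin Q) Y (h |: Q) = (left_over Q)%:R * Y Q) ->
  (forall Q h, (L0 < left_over Q)%N -> h \notin Q ->
     (Y (h |: Q) - Y Q) ^+ 2 <= kappa) ->
  expect (fun Q => (Y Q - Y set0) ^+ 2) n <= (spent n)%:R * kappa.
Proof.
move=> nT spn k0 mart incr; elim: n nT spn => [|n IH] nT spn.
  rewrite /expect (eq_bigr (fun=> 0)) => [|f _]; last by rewrite subrr expr0n.
  by rewrite big1 // mul0r mulr_ge0.
pose t := Ordinal nT; have tT : (t <= T)%N by exact: ltnW.
rewrite -[n]/(nat_of_ord t) expectS; move: spn; rewrite -[n]/(nat_of_ord t) spentS => spn.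
have spt : (L0 + spent t <= #|{: halfU d}|)%N by lia.
apply: (@le_trans _ _ (expect (fun Q => (Y Q - Y set0) ^+ 2 + (d.2 t)%:R * kappa) t)).
  apply: expect_le => f fP; apply: (vertex_op_sq mart incr).
  by apply: left_over_reads => //; lia.
rewrite expectD natrD mulrDl lerD ?IH //.
by apply: expect_cst_le; rewrite mulr_ge0.
Qed.

Definition unclaimed Q (i : 'I_N) : nat := #|[set h | (h \notin Q) && (tag h == Some i)]|.

Lemma unclaimedU1 Q h i : h \notin Q ->
  unclaimed (h |: Q) i = (unclaimed Q i - (tag h == Some i))%N.
Proof.
move=> hQ; rewrite /unclaimed; case: eqP => [hi|hi].
  have -> : [set y | (y \notin h |: Q) && (tag y == Some i)]
      = [set y | (y \notin Q) && (tag y == Some i)] :\ h.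
    by apply/setP => y; rewrite !inE negb_or; case: (y == h).
  by rewrite cardsDS ?cards1 // sub1set inE hQ hi eqxx.
rewrite subn0; apply: eq_card => y; rewrite !inE negb_or.
by case: eqVneq => //= ->; rewrite hQ; apply/esym/eqP.
Qed.

Lemma card_tag i : #|[set h : halfU d | tag h == Some i]| = d.1 i.
Proof.
have -> : [set h : halfU d | tag h == Some i]
    = [set Tagged (fun u => 'I_(degU d u)) j | j : 'I_(degU d (Some i))].
  apply/setP => -[u j]; rewrite inE /=; apply/eqP/imsetP => [ui|[k _]].
    by subst u; exists j.
  by move=> /(congr1 tag).
rewrite card_imset ?cardsT ?card_ord // => j k /eqP.
by rewrite -tag_eqE /tag_eq /= eqxx tagged_asE => /eqP.
Qed.

Lemma claimedE Q i : (claimed Q i + unclaimed Q i)%N = d.1 i.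
Proof.
rewrite -card_tag /claimed /unclaimed.
rewrite -(cardsID Q [set h | tag h == Some i]); congr (_ + _)%N;
  by apply: eq_card => h; rewrite !inE // andbC.
Qed.

Lemma unclaimed_le Q i : (unclaimed Q i <= d.1 i)%N.
Proof. by rewrite -(claimedE Q i) leq_addl. Qed.

Lemma unclaimed0 i : unclaimed set0 i = d.1 i.
Proof. by rewrite /unclaimed -card_tag; apply: eq_card => h; rewrite !inE. Qed.

Variable P : pred 'I_N.

Definition bin_sum j Q : nat := (\sum_(i | P i) 'C(unclaimed Q i, j))%N.

(** Counted vertex by vertex: if [i] has a unread half-edges, a of the reads turn C(a, j) into C(a -
    1, j) and the others leave it, and a C(a - 1, j) = (a - j) C(a, j). The additive form avoids
    truncated subtraction. *)
Lemma sum_bin_sum j Q :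
  (\sum_(h | h \notin Q) bin_sum j (h |: Q) + j * bin_sum j Q
   = left_over Q * bin_sum j Q)%N.
Proof.
rewrite /bin_sum exchange_big /= !big_distrr -big_split /=; apply: eq_bigr => i _.
set a := unclaimed Q i.
rewrite (bigID (fun h : halfU d => tag h == Some i)) /=.
rewrite (eq_bigr (fun=> 'C(a.-1, j))) => [|h /andP[hQ hi]]; last first.
  by rewrite unclaimedU1 // hi subn1.
rewrite [X in (_ + X + _)%N](eq_bigr (fun=> 'C(a, j))) => [|h /andP[hQ hi]]; last first.
  by rewrite unclaimedU1 // (negbTE hi) subn0.
rewrite !sum_nat_const.
have -> : #|[pred h : halfU d | (h \notin Q) && (tag h == Some i)]| = a.
  by apply: eq_card => h; rewrite !inE.
set b := #|_|.
have LE : left_over Q = (a + b)%N.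
  rewrite /left_over -(cardsID [set h : halfU d | tag h == Some i] (~: Q)).
  by congr (_ + _)%N; apply: eq_card => h; rewrite !inE // andbC.
rewrite LE mulnDl -addnA [(b * _ + _)%N]addnC addnA; congr (_ + _)%N.
have [aj|ja] := ltnP a j; last by rewrite mul_bin_down -mulnDl subnK.
by rewrite !bin_small ?muln0 //; lia.
Qed.

(* A read removes a uniform unread half-edge, which multiplies the mean of
   [bin_sum j] by (L - j) / L when L half-edges are left over; dividing by the
   falling factorial of L makes it a martingale. *)
Definition bin_mart j Q : R := (bin_sum j Q)%:R / (left_over Q ^_ j)%:R.

Lemma bin_martE j Q : (j < left_over Q)%N ->
  \sum_(h | h \notin Q) bin_mart j (h |: Q) = (left_over Q)%:R * bin_mart j Q.
Proof.
move=> jL; set L := left_over Q.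
have -> : \sum_(h | h \notin Q) bin_mart j (h |: Q)
    = (\sum_(h | h \notin Q) bin_sum j (h |: Q))%:R / (L.-1 ^_ j)%:R.
  rewrite natr_sum mulr_suml; apply: eq_bigr => h hQ.
  by rewrite /bin_mart left_overU1.
have f1 : (L.-1 ^_ j)%:R != 0 :> R by rewrite pnatr_eq0 -lt0n ffact_gt0; lia.
have f2 : (L ^_ j)%:R != 0 :> R by rewrite pnatr_eq0 -lt0n ffact_gt0; lia.
have e1 := sum_bin_sum j Q; have e2 := ffactnS L j; have e3 := ffactnSr L j.
have /(congr1 (fun n => n%:R : R)) := e1; rewrite natrD !natrM => {}e1.
have : (L%:R * (L.-1 ^_ j)%:R = (L ^_ j)%:R * (L%:R - j%:R) :> R).
  by rewrite -natrB -?natrM; [congr (_%:R); lia|lia].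
move=> {}e2; rewrite /bin_mart -/L.
apply: (mulIf f1); rewrite mulfVK //; apply: (mulIf f2).
have -> : L%:R * ((bin_sum j Q)%:R / (L ^_ j)%:R) * (L.-1 ^_ j)%:R * (L ^_ j)%:R
   = (bin_sum j Q)%:R * (L%:R * (L.-1 ^_ j)%:R) :> R by field.
rewrite e2 mulrCA -/L in e1 *; rewrite mulrC; congr (_ * _).
by rewrite mulrBr [X in _ = X - _]mulrC [X in _ = _ - X]mulrC -e1 addrK.
Qed.

End Read_chain.

(** * Binomial means and falling factorials *)

Section Binomial_mean.
Variable R : realFieldType.
Implicit Types (r : R) (alpha : nat -> R) (D : nat).

Definition bin_mean D r alpha : R :=
  \sum_(b < D.+1) 'C(D, b)%:R * r ^+ b * (1 - r) ^+ (D - b) * alpha b.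

Lemma bin_mean0 r alpha : bin_mean 0 r alpha = alpha 0.
Proof. by rewrite /bin_mean big_ord1 /= bin0 !expr0 !mul1r. Qed.

Lemma bin_meanS D r alpha : bin_mean D.+1 r alpha =
  r * bin_mean D r (fun b => alpha b.+1) + (1 - r) * bin_mean D r alpha.
Proof.
rewrite /bin_mean big_ord_recl.
under eq_bigr => b _ do
  rewrite lift0 binS subSS exprS natrD mulrDl mulrDl mulrDl.
rewrite big_split /= addrA addrC; congr (_ + _).
  by rewrite mulr_sumr; apply: eq_bigr => b _; ring.
rewrite [X in _ + X]big_ord_recr /= (bin_small (ltnSn D)) !mul0r addr0.
rewrite [in RHS]big_ord_recl mulrDr mulr_sumr; congr (_ + _).
  by rewrite !bin0 !subn0 expr0 exprS; ring.
apply: eq_bigr => b _; rewrite lift0.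
have -> : (D - b = (D - b.+1).+1)%N by rewrite subnSK.
by rewrite !exprS; ring.
Qed.

Lemma eq_bin_mean D r alpha beta :
  (forall b, (b <= D)%N -> alpha b = beta b) -> bin_mean D r alpha = bin_mean D r beta.
Proof. by move=> ab; apply: eq_bigr => b _; rewrite ab // -ltnS. Qed.

Lemma bin_mean_sum (I : finType) D r (c : I -> R) (alpha : I -> nat -> R) :
  bin_mean D r (fun b => \sum_i c i * alpha i b) = \sum_i c i * bin_mean D r (alpha i).
Proof.
rewrite /bin_mean (eq_bigr (fun b : 'I_D.+1 => \sum_i
  c i * ('C(D, b)%:R * r ^+ b * (1 - r) ^+ (D - b) * alpha i b))) => [|b _].
  by rewrite exchange_big; apply: eq_bigr => i _; rewrite mulr_sumr.
by rewrite mulr_sumr; apply: eq_bigr => i _; ring.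
Qed.

(** Factorial moments of the binomial law. The case [j = 0] also serves below as the statement that
    the binomial weights sum to 1. *)
Lemma bin_mean_bin D r j : bin_mean D r (fun b => 'C(b, j)%:R) = 'C(D, j)%:R * r ^+ j.
Proof.
elim: D j => [|D IH] j.
  by rewrite bin_mean0; case: j => [|j]; rewrite ?bin0 ?expr0 ?mulr1 // bin0n mul0r.
rewrite bin_meanS; case: j => [|j].
  have -> : bin_mean D r (fun b => 'C(b.+1, 0)%:R) = bin_mean D r (fun b => 'C(b, 0)%:R).
    by apply: eq_bin_mean => b _; rewrite !bin0.
  by rewrite !IH !bin0; ring.
rewrite IH binS natrD exprS.
have -> : bin_mean D r (fun b => 'C(b.+1, j.+1)%:R)
    = 'C(D, j.+1)%:R * r ^+ j.+1 + 'C(D, j)%:R * r ^+ j.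
  rewrite -!IH /bin_mean -big_split /=; apply: eq_bigr => b _.
  by rewrite binS natrD mulrDr.
by rewrite exprS; ring.
Qed.

Lemma bin_mean_ge0 D r alpha : 0 <= r <= 1 ->
  (forall b, (b <= D)%N -> 0 <= alpha b) -> 0 <= bin_mean D r alpha.
Proof.
move=> /andP[r0 r1] a0; apply: sumr_ge0 => b _; have := a0 b; rewrite -ltnS ltn_ord.
by move=> /(_ isT) ab; rewrite !mulr_ge0 // exprn_ge0 // subr_ge0.
Qed.

Lemma bin_mean_le D r alpha a : 0 <= r <= 1 ->
  (forall b, (b <= D)%N -> alpha b <= a) -> bin_mean D r alpha <= a.
Proof.
move=> r01 ba; rewrite -subr_ge0.
have <- : bin_mean D r (fun b => a - alpha b) = a - bin_mean D r alpha.
  have aE : a = a * bin_mean D r (fun b => 'C(b, 0)%:R).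
    by rewrite bin_mean_bin bin0 expr0 !mulr1.
  rewrite [X in _ = X - _]aE /bin_mean mulr_sumr -sumrB; apply: eq_bigr => b _.
  by rewrite bin0 mulr1 mulrBr [_ * a]mulrC.
by apply: bin_mean_ge0 => // b bD; rewrite subr_ge0 ba.
Qed.

(** The coefficient of index D + 1 corrects the value at D + 1 without disturbing the smaller
    arguments, where that binomial vanishes. *)
Lemma newton_expansion D alpha : exists c : nat -> R, forall a, (a <= D)%N ->
  alpha a = \sum_(j < D.+1) c j * 'C(a, j)%:R.
Proof.
elim: D => [|D [c cE]].
  exists alpha => a; rewrite leqn0 => /eqP ->; by rewrite big_ord1 bin0 mulr1.
pose e := alpha D.+1 - \sum_(j < D.+1) c j * 'C(D.+1, j)%:R.
exists (fun j => if j == D.+1 then e else c j) => a aD.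
rewrite big_ord_recr /= eqxx.
rewrite (eq_bigr (fun j : 'I_D.+1 => c j * 'C(a, j)%:R)) => [|j _]; last first.
  by rewrite ifF //; apply/negbTE; rewrite neq_ltn ltn_ord.
move: aD; rewrite leq_eqVlt => /orP[/eqP ->|aD].
  by rewrite binn mulr1 /e addrC subrK.
by rewrite bin_small // mulr0 addr0 cE.
Qed.

Lemma ffact_mono (L M j : nat) : (L <= M)%N -> (L ^_ j <= M ^_ j)%N.
Proof. by move=> LM; rewrite !ffact_prod leq_prod // => i _; rewrite leq_sub2r. Qed.

Lemma ffact_le_expn (M j : nat) : (M ^_ j <= M ^ j)%N.
Proof.
rewrite ffact_prod -[X in (_ ^ X)%N](card_ord j) -prod_nat_const.
by apply: leq_prod => i _; rewrite leq_subr.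
Qed.

Lemma expn_le_ffact (L j : nat) : ((L - j) ^ j <= L ^_ j)%N.
Proof.
rewrite ffact_prod -[X in (_ ^ X)%N](card_ord j) -prod_nat_const.
by apply: leq_prod => i _; rewrite leq_sub2l // ltnW.
Qed.

(** Sampling without and with replacement: the factors (L - j) / (M - j) and L / M differ by at most
    2 j / M, and since all quantities lie in [0, 1] the errors of the successive factors add up. *)
Lemma ffact_ratio (L M j : nat) : (L <= M)%N -> (2 * j <= M)%N -> (j <= L)%N ->
  `|(L ^_ j)%:R / (M ^_ j)%:R - (L%:R / M%:R) ^+ j| <= 2 * j%:R ^+ 2 / M%:R :> R.
Proof.
move=> LM; elim: j => [|j IH] jM jL.
  by rewrite !ffactn0 expr0 divr1 subrr normr0 expr0n /= mulr0 mul0r.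
have jM' : (2 * j <= M)%N by apply: leq_trans jM; rewrite leq_mul2l leqnSn.
have IH' := IH jM' (ltnW jL).
have M0 : 0 < M%:R :> R by rewrite ltr0n; lia.
have Mj : 0 < M%:R - j%:R :> R by rewrite subr_gt0 ltr_nat; lia.
set x := (L ^_ j)%:R / (M ^_ j)%:R in IH' *; set y := _ ^+ j in IH'.
have -> : (L ^_ j.+1)%:R / (M ^_ j.+1)%:R = x * ((L%:R - j%:R) / (M%:R - j%:R)) :> R.
  rewrite !ffactnSr !natrM !natrB; [|lia|lia]; rewrite /x.
  have F0 : (M ^_ j)%:R != 0 :> R by rewrite pnatr_eq0 -lt0n ffact_gt0; lia.
  by field; rewrite F0 (gt_eqF Mj).
rewrite exprS -/y.
have Lr : L%:R <= M%:R :> R by rewrite ler_nat.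
have jr : j%:R <= L%:R :> R by rewrite ler_nat; lia.
have j2 : 2 * j%:R + 2 <= M%:R :> R.
  by rewrite -natrM -natrD ler_nat; lia.
have j0 : 0 <= j%:R :> R by [].
have y01 : `|L%:R / M%:R : R| <= 1.
  by rewrite ger0_norm ?divr_ge0 // ler_pdivrMr // mul1r.
have x01 : `|x| <= 1.
  rewrite ger0_norm ?divr_ge0 // ler_pdivrMr; last by rewrite ltr0n ffact_gt0; lia.
  by rewrite mul1r ler_nat ffact_mono.
have dlt : `|(L%:R - j%:R) / (M%:R - j%:R) - L%:R / M%:R| <= 2 * j%:R / M%:R :> R.
  have -> : (L%:R - j%:R) / (M%:R - j%:R) - L%:R / M%:R
      = - (j%:R * (M%:R - L%:R) / ((M%:R - j%:R) * M%:R)) :> R.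
    by field; rewrite (gt_eqF Mj) (gt_eqF M0).
  rewrite normrN ger0_norm; last first.
    by rewrite divr_ge0 ?mulr_ge0 ?subr_ge0 // ltW // -subr_gt0.
  rewrite invfM mulrA ler_pM2r ?invr_gt0 // ler_pdivrMr //.
  have : 0 <= j%:R * (M%:R - 2 * j%:R) :> R by rewrite mulr_ge0 //; lra.
  have : 0 <= j%:R * L%:R :> R by rewrite mulr_ge0.
  nra.
have -> : x * ((L%:R - j%:R) / (M%:R - j%:R)) - L%:R / M%:R * y =
   x * ((L%:R - j%:R) / (M%:R - j%:R) - L%:R / M%:R) + (x - y) * (L%:R / M%:R) by ring.
apply: le_trans (ler_normD _ _) _.
rewrite (normrM x) [in X in _ + X]normrM.
apply: (@le_trans _ _ (2 * j%:R / M%:R + 2 * j%:R ^+ 2 / M%:R)).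
  apply: lerD; first by rewrite -[leRHS]mul1r ler_pM.
  by rewrite -[leRHS]mulr1 ler_pM.
rewrite -mulrDl ler_pM2r ?invr_gt0 // -natr1; nra.
Qed.

End Binomial_mean.

Lemma bin_le_exp2 n m : ('C(n, m) <= 2 ^ n)%N.
Proof.
elim: n m => [|n IH] [|m]; rewrite ?bin0 ?expn_gt0 //.
by rewrite binS expnS mul2n -addnn leq_add.
Qed.

Lemma sqr_sum_le (R : realFieldType) (n : nat) (x : 'I_n -> R) :
  (\sum_i x i) ^+ 2 <= n%:R * \sum_i x i ^+ 2.
Proof.
elim: n x => [|n IH] x; first by rewrite !big_ord0 expr0n /= mul0r.
rewrite !big_ord_recl; set a := x ord0; have := IH (fun i => x (lift ord0 i)).
set s := \sum_(i < n) _; set q := \sum_(i < n) _ => sq.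
have [n0|n0] := posnP n.
  have s0 : s = 0 by rewrite /s; subst n; rewrite big_ord0.
  have q0 : q = 0 by rewrite /q; subst n; rewrite big_ord0.
  by rewrite s0 q0 n0 !addr0 mul1r.
have n0' : 0 < n%:R :> R by rewrite ltr0n.
have h : 0 <= (n%:R * a - s) ^+ 2 by exact: sqr_ge0.
rewrite -(ler_pM2l n0') -natr1; set m := n%:R in n0' sq h *.
have : 0 <= (m + 1) * (m * q - s ^+ 2) by rewrite mulr_ge0 ?subr_ge0 //; lra.
nra.
Qed.

Lemma sqrD_le (R : realFieldType) (x y : R) : (x + y) ^+ 2 <= 2 * x ^+ 2 + 2 * y ^+ 2.
Proof. by have := sqr_ge0 (x - y); nra. Qed.

(** * Concentration within one degree class *)

Section Class_concentration.
Variables (R : realType) (N T C : nat) (d : degrees N T) (P : pred 'I_N).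
Implicit Types (Q : {set halfU d}) (h : halfU d).
Local Notation M := #|{: halfU d}|.
Variable D : nat.
Hypothesis P_D : forall i, P i -> d.1 i = D.

Lemma bin_sum_le j Q : (bin_sum P j Q <= N * 2 ^ D)%N.
Proof.
rewrite /bin_sum (@leq_trans (\sum_(i < N | P i) 2 ^ D)) //.
  apply: leq_sum => i Pi; rewrite (leq_trans (bin_le_exp2 _ _)) //.
  by rewrite leq_exp2l // -(P_D Pi) unclaimed_le.
by rewrite sum_nat_const leq_mul2r (leq_trans (max_card _)) ?orbT // card_ord.
Qed.

Lemma bin_sumU1 j Q h : h \notin Q ->
  (bin_sum P j (h |: Q) <= bin_sum P j Q <= bin_sum P j (h |: Q) + 2 ^ D)%N.
Proof.
move=> hQ; apply/andP; split.
  by apply: leq_sum => i _; rewrite unclaimedU1 // leq_bin2l // leq_subr.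
apply: (@leq_trans (\sum_(i | P i) ('C(unclaimed (h |: Q) i, j) + (tag h == Some i) * 2 ^ D))).
  apply: leq_sum => i Pi; rewrite unclaimedU1 //; case: eqP => _.
    rewrite mul1n (leq_trans _ (leq_addl _ _)) // (leq_trans (bin_le_exp2 _ _)) //.
    by rewrite leq_exp2l // -(P_D Pi) unclaimed_le.
  by rewrite subn0 mul0n addn0.
rewrite big_split leq_add2l /= -big_distrl /= -[leqRHS]mul1n leq_mul2r.
apply/orP; right; case: (tag h) => [i|]; last by rewrite big1.
rewrite (@leq_trans (\sum_i0 (Some i == Some i0))) //.
  by rewrite [leqLHS]big_mkcond leq_sum // => k _; case: (P k).
rewrite (bigD1 i) //= eqxx big1 // => k ki; apply/eqP; rewrite eqb0.
by apply: contraNneq ki => -[->].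
Qed.

(** A read has two effects. It lowers the numerator by at most 2^D, since one vertex loses a
    half-edge; and it changes the denominator by a relative amount of order j / L, felt by a
    numerator of at most N 2^D, whence the term with D N / L0. *)
Lemma bin_mart_incr j L0 Q h : (j <= D)%N -> (j < L0)%N -> (L0 < left_over Q)%N ->
  h \notin Q ->
  `|bin_mart R P j (h |: Q) - bin_mart R P j Q|
  <= 2 ^+ D * (1 + D%:R * N%:R / L0%:R) / (L0 ^_ j)%:R.
Proof.
move=> jD jL0 L0Q hQ; rewrite /bin_mart left_overU1 //.
have [nat1 nat2 nat3] : [/\ (0 < L0)%N, (j < left_over Q)%N &
  (j <= (left_over Q).-1)%N] by split; lia.
have nat4 : (L0 <= (left_over Q).-1)%N by lia.
have /andP[] := bin_sumU1 j hQ; have := bin_sum_le j Q.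
rewrite -!(ler_nat R) natrM natrD natrX.
have := ffactnS (left_over Q) j; have := ffactnSr (left_over Q) j.
set L := left_over Q in L0Q *; set S := (bin_sum P j Q)%:R; set S' := (bin_sum _ _ _)%:R.
move=> -> /(congr1 (fun n => n%:R : R)); rewrite !natrM natrB; last exact: ltnW.
move=> eL SN SS1 SS2.
have jr : j%:R <= D%:R :> R by rewrite ler_nat.
have j0 : 0 <= j%:R :> R by [].
have L0r : 0 < L0%:R :> R by rewrite ltr0n.
have Lr : L0%:R < L%:R :> R by rewrite ltr_nat.
have F0 : 0 < (L ^_ j)%:R :> R by rewrite ltr0n ffact_gt0 ltnW.
have F'0 : 0 < (L.-1 ^_ j)%:R :> R by rewrite ltr0n ffact_gt0.
have G0 : 0 < (L0 ^_ j)%:R :> R by rewrite ltr0n ffact_gt0 ltnW.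
have GF : (L0 ^_ j)%:R <= (L.-1 ^_ j)%:R :> R by rewrite ler_nat ffact_mono.
have jL : j%:R < L%:R :> R by rewrite ltr_nat.
have -> : S' / (L.-1 ^_ j)%:R - S / (L ^_ j)%:R
   = (j%:R * S - L%:R * (S - S')) / (L%:R * (L.-1 ^_ j)%:R) :> R.
  have -> : (L.-1 ^_ j)%:R = (L ^_ j)%:R * (L%:R - j%:R) / L%:R :> R.
    by rewrite eL mulrAC divff ?mul1r // gt_eqF //; lra.
  field; rewrite (gt_eqF F0) subr_eq0 (gt_eqF jL) andbT /=.
  by rewrite gt_eqF //; lra.
set E := 2 ^+ D in SN SS2 *; have E0 : 0 < E by rewrite exprn_gt0.
have N0 : 0 <= N%:R :> R by [].
have S0 : 0 <= S by [].
rewrite normrM normfV (gtr0_norm (x := L%:R * _)); last by rewrite mulr_gt0 //; lra.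
have num : `|j%:R * S - L%:R * (S - S')| <= L%:R * (E * (1 + D%:R * N%:R / L0%:R)).
  have h1 : 0 <= j%:R * S by rewrite mulr_ge0.
  have h2 : 0 <= L%:R * (S - S') by rewrite mulr_ge0 ?subr_ge0.
  have h3 : L%:R * (S - S') <= L%:R * E by rewrite ler_wpM2l //; lra.
  have h4 : j%:R * S <= L%:R * (E * (D%:R * N%:R / L0%:R)).
    apply: (@le_trans _ _ (D%:R * (N%:R * E))); first by rewrite ler_pM.
    have -> : L%:R * (E * (D%:R * N%:R / L0%:R)) = (L%:R / L0%:R) * (D%:R * (N%:R * E)).
      by field; rewrite (gt_eqF L0r).
    rewrite -[leLHS]mul1r ler_wpM2r ?mulr_ge0 ?(ltW E0) //.
    by rewrite ler_pdivlMr // mul1r ltW.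
  have h5 : 0 <= L%:R * (E * (D%:R * N%:R / L0%:R)) by exact: le_trans h4.
  have h6 : 0 <= L%:R * E by exact: le_trans h3.
  have -> : L%:R * (E * (1 + D%:R * N%:R / L0%:R))
    = L%:R * E + L%:R * (E * (D%:R * N%:R / L0%:R)) by ring.
  rewrite ler_norml; apply/andP; split; lra.
rewrite ler_pdivrMr; last by rewrite mulr_gt0 //; lra.
apply: (le_trans num); set W := E * _.
have W0 : 0 <= W by rewrite mulr_ge0 ?(ltW E0) // addr_ge0 // divr_ge0 ?mulr_ge0 ?(ltW L0r).
have -> : W / (L0 ^_ j)%:R * (L%:R * (L.-1 ^_ j)%:R)
   = (L%:R * W) * ((L.-1 ^_ j)%:R / (L0 ^_ j)%:R) by field; rewrite (gt_eqF G0).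
rewrite -[leLHS]mulr1 ler_wpM2l ?(mulr_ge0 (ler0n _ _) W0) //.
by rewrite ler_pdivlMr // mul1r.
Qed.

Variables (delta K : R) (n : nat).
Hypotheses (delta_gt0 : 0 < delta) (K_ge0 : 0 <= K).
Hypotheses (n_T : (n <= T)%N) (N_M : N%:R <= K * M%:R).
Hypothesis M_large : 2 * D%:R + 2 <= delta * M%:R.
Hypothesis n_spent : delta * M%:R + (spent d n)%:R <= M%:R.

(** The first square bounds the martingale fluctuation, (2 / delta)^D being the price of replacing
    the falling factorial of the reserve by that of all half-edges; the second bounds the passage
    from falling factorials to powers. *)
Definition mart_const : R :=
  2 * ((2 / delta) ^+ D * (2 ^+ D * (1 + D%:R * K / delta))) ^+ 2
  + 2 * (K * 2 ^+ D * (2 * D%:R ^+ 2)) ^+ 2.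

Lemma bin_sum_concentration j : (j <= D)%N ->
  expect C (fun Q => ((bin_sum P j Q)%:R
     - #|P|%:R * ('C(D, j)%:R * ((left_over Q)%:R / M%:R) ^+ j)) ^+ 2) n
  <= mart_const * M%:R.
Proof.
move=> jD; have D0 : 0 <= D%:R :> R by [].
have spM : (spent d n <= M)%N.
  rewrite -(ler_nat R); apply: le_trans n_spent; rewrite lerDr.
  by rewrite (le_trans _ M_large) // addr_ge0 // mulr_ge0.
pose L0 := (M - spent d n)%N.
have L0r : delta * M%:R <= L0%:R by rewrite natrB // lerBrDr.
have L0D : (2 * D + 2 <= L0)%N.
  by rewrite -(ler_nat R) natrD natrM; apply: le_trans L0r.
have L0M : (L0 <= M)%N by rewrite leq_subr.
have [nat1 nat2 nat3] : [/\ (0 < L0)%N, (j < L0)%N & (L0 <= 2 * (L0 - j))%N].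
  by clearbody L0; clear -L0D jD; split; lia.
have [nat4 nat5] : (2 * j <= M)%N /\ (j <= M)%N.
  by clearbody L0; clear -L0D jD L0M; split; lia.
have L0_gt0 : 0 < L0%:R :> R by rewrite ltr0n.
have M1 : 1 <= M%:R :> R by rewrite (ler_nat R 1) (leq_trans nat1).
have M0 : 0 < M%:R :> R by lra.
have delta1 : delta <= 1.
  have : L0%:R <= M%:R :> R by rewrite ler_nat.
  by move=> /(le_trans L0r); rewrite -[leRHS]mul1r ler_pM2r.
set W := 2 ^+ D * (1 + D%:R * K / delta).
have W0 : 0 <= W.
  apply: mulr_ge0; first by rewrite exprn_ge0.
  by apply: addr_ge0; [exact: ler01|apply: divr_ge0; [exact: mulr_ge0|exact: ltW]].
set F := (L0 ^_ j)%:R : R.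
have F0 : 0 < F by rewrite ltr0n ffact_gt0 ltnW.
have EY : expect C (fun Q => (bin_mart R P j Q - bin_mart R P j (set0 : {set halfU d})) ^+ 2) n
    <= M%:R * (W / F) ^+ 2.
  apply: (@le_trans _ _ ((spent d n)%:R * (W / F) ^+ 2)); last first.
    by rewrite ler_wpM2r ?sqr_ge0 // ler_nat.
  apply: (@expect_sq R N T C d (bin_mart R P j) ((W / F) ^+ 2) L0 n n_T).
  - by rewrite /L0 subnK.
  - by rewrite sqr_ge0.
  - by move=> Q L0Q; apply: bin_martE; apply: ltn_trans L0Q.
  - move=> Q h L0Q hQ; rewrite -[leLHS]real_normK ?num_real // ler_sqr ?nnegrE ?divr_ge0 ?(ltW F0) //.
    apply: (le_trans (bin_mart_incr jD nat2 L0Q hQ)).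
    rewrite ler_pM2r ?invr_gt0 // ler_wpM2l ?exprn_ge0 // lerD2l -!mulrA ler_wpM2l //.
    rewrite ler_pdivrMr // (le_trans N_M) // -mulrA ler_wpM2l //.
    by rewrite mulrC ler_pdivlMr // mulrC.
have Y0E : bin_mart R P j (set0 : {set halfU d}) = #|P|%:R * 'C(D, j)%:R / (M ^_ j)%:R.
  rewrite /bin_mart /left_over setC0 cardsT -natrM; congr (_%:R / _).
  rewrite /bin_sum (eq_bigr (fun=> 'C(D, j))) => [|i Pi].
    by rewrite sum_nat_const.
  by rewrite unclaimed0 P_D.
set B := 2 * (K * 2 ^+ D * (2 * D%:R ^+ 2)) ^+ 2.
have B0 : 0 <= B by rewrite mulr_ge0 // sqr_ge0.
have FM : 0 < (M ^_ j)%:R :> R by rewrite ltr0n ffact_gt0.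
apply: (@le_trans _ _ (expect C (fun Q => 2 * ((M ^_ j)%:R ^+ 2 *
    (bin_mart R P j Q - bin_mart R P j (set0 : {set halfU d})) ^+ 2) + B) n)).
  apply: expect_le => f fP; set Q := reads C f n.
  have LQ : (L0 <= left_over Q)%N by apply: left_over_reads => //; rewrite /L0 subnK.
  have QM : (left_over Q <= M)%N by rewrite max_card.
  have jLQ : (j <= left_over Q)%N by apply: leq_trans LQ; exact: ltnW.
  have FQ : 0 < (left_over Q ^_ j)%:R :> R by rewrite ltr0n ffact_gt0.
  have FQM : (left_over Q ^_ j)%:R <= (M ^_ j)%:R :> R by rewrite ler_nat ffact_mono.
  (* Multiplied back by the falling factorial, the martingale gives a fluctuation term; its initial
     value gives the prediction of sampling without replacement, compared with the power in the
     second term. *)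
  have -> : (bin_sum P j Q)%:R - #|P|%:R * ('C(D, j)%:R * ((left_over Q)%:R / M%:R) ^+ j)
    = (left_over Q ^_ j)%:R * (bin_mart R P j Q - bin_mart R P j (set0 : {set halfU d}))
    + #|P|%:R * 'C(D, j)%:R * ((left_over Q ^_ j)%:R / (M ^_ j)%:R
        - ((left_over Q)%:R / M%:R) ^+ j).
    by rewrite Y0E /bin_mart; field; rewrite (gt_eqF FM) (gt_eqF FQ).
  apply: (le_trans (sqrD_le _ _)); apply: lerD.
    rewrite ler_pM2l // exprMn ler_wpM2r ?sqr_ge0 // ler_sqr ?nnegrE ?(ltW FQ) ?(ltW FM) //.
  rewrite /B ler_pM2l // -[leLHS]real_normK ?num_real // ler_sqr ?nnegrE //; last first.
    by rewrite !mulr_ge0 // exprn_ge0.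
  rewrite normrM ger0_norm ?mulr_ge0 //.
  have rat := @ffact_ratio R (left_over Q) M j QM nat4 jLQ.
  apply: (@le_trans _ _ ((K * M%:R) * 2 ^+ D * (2 * D%:R ^+ 2 / M%:R))); last first.
    by rewrite le_eqVlt; apply/orP; left; apply/eqP; field; rewrite (gt_eqF M0).
  apply: ler_pM; rewrite ?mulr_ge0 //.
    apply: ler_pM => //; last by rewrite -natrX ler_nat bin_le_exp2.
    by apply: le_trans N_M; rewrite ler_nat (leq_trans (max_card _)) // card_ord.
  apply: (le_trans rat); rewrite ler_pM2r ?invr_gt0 // ler_pM2l //.
  by rewrite ler_sqr ?nnegrE // ler_nat.
have -> : mart_const * M%:R = 2 * ((2 / delta) ^+ D * W) ^+ 2 * M%:R + B * M%:R.
  by rewrite /mart_const mulrDl.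
rewrite expectD expectZ expectZ; apply: lerD; last first.
  by apply: (le_trans (@expect_cst_le R N T C d B n B0)); rewrite -[leLHS]mulr1 ler_wpM2l.
clearbody W B; have d20 : 0 <= 2 / delta by rewrite divr_ge0 // ltW.
rewrite -mulrA ler_pM2l // mulrC -ler_pdivlMr ?exprn_gt0 //.
apply: (le_trans EY); rewrite [leRHS]mulrAC mulrC ler_pM2r // -expr_div_n.
rewrite ler_sqr ?nnegrE ?divr_ge0 ?mulr_ge0 ?exprn_ge0 ?(ltW F0) ?(ltW delta_gt0) //.
rewrite [leRHS]mulrAC [leRHS]mulrC ler_wpM2l // -[F^-1]mul1r ler_pdivrMr //.
rewrite mulrAC ler_pdivlMr // mul1r.
(* By [M_large] each factor of the falling factorial of [L0] is at least [L0 / 2], and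
   [L0 >= delta * M] then compares it with a power of [M]. *)
have lo : (L0%:R / 2) ^+ j <= F.
  have : ((L0 - j) ^ j)%:R <= F by rewrite ler_nat expn_le_ffact.
  apply: le_trans; rewrite natrX; apply: lerXn2r; rewrite ?nnegrE ?divr_ge0 //.
  by rewrite ler_pdivrMr // -natrM ler_nat mulnC.
apply: (@le_trans _ _ (M%:R ^+ j)); first by rewrite -natrX ler_nat ffact_le_expn.
apply: (@le_trans _ _ ((2 / delta) ^+ j * (L0%:R / 2) ^+ j)).
  rewrite -exprMn; apply: lerXn2r; rewrite ?nnegrE ?mulr_ge0 ?invr_ge0 ?(ltW delta_gt0) //.
  have -> : 2 / delta * (L0%:R / 2) = L0%:R / delta by field; rewrite (gt_eqF delta_gt0).
  by rewrite ler_pdivlMr // mulrC.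
apply: ler_pM => //; rewrite ?exprn_ge0 ?divr_ge0 ?(ltW delta_gt0) //.
apply: ler_weXn2l => //; rewrite ler_pdivlMr // mul1r; lra.
Qed.

End Class_concentration.

Lemma sqr_le_norm (R : realDomainType) (x b : R) : `|x| <= b -> x ^+ 2 <= b ^+ 2.
Proof.
move=> xb; rewrite -[leLHS]real_normK ?num_real // ler_sqr ?nnegrE //.
exact: le_trans xb.
Qed.

(* By Newton's expansion any function of the number of unread half-edges of a
   vertex of degree [D] is a combination of binomials, hence of martingales. *)
Lemma class_concentration (R : realType) (D : nat) (alpha : nat -> R) (delta K : R) :
  0 < delta -> 0 <= K ->
  exists2 K1 : R, 0 <= K1 &
  forall (N T C : nat) (d : degrees N T) (P : pred 'I_N) (n : nat),
  let M := #|{: halfU d}|%:R in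
  (forall i, P i -> d.1 i = D) -> (n <= T)%N -> N%:R <= K * M ->
  2 * D%:R + 2 <= delta * M -> delta * M + (spent d n)%:R <= M ->
  expect C (fun Q : {set halfU d} => (\sum_(i | P i) alpha (unclaimed Q i)
     - #|P|%:R * bin_mean D ((left_over Q)%:R / M) alpha) ^+ 2) n <= K1 * M.
Proof.
move=> delta0 K0; have [c cE] := newton_expansion D alpha.
have mc0 : 0 <= mart_const D delta K by rewrite addr_ge0 // mulr_ge0 // sqr_ge0.
exists (D.+1%:R * \sum_(j < D.+1) c j ^+ 2 * mart_const D delta K).
  by rewrite mulr_ge0 // sumr_ge0 // => j _; rewrite mulr_ge0 // sqr_ge0.
move=> N T C d P n M PD nT NM large spn.
pose E j (Q : {set halfU d}) : R := (bin_sum P j Q)%:R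
     - #|P|%:R * ('C(D, j)%:R * ((left_over Q)%:R / M) ^+ j).
apply: (@le_trans _ _ (expect C (fun Q : {set halfU d} => D.+1%:R *
    \sum_(j < D.+1) c j ^+ 2 * E j Q ^+ 2) n)).
  apply: expect_le => f _; set Q := reads C f n.
  have -> : \sum_(i | P i) alpha (unclaimed Q i)
     - #|P|%:R * bin_mean D ((left_over Q)%:R / M) alpha = \sum_(j < D.+1) c j * E j Q.
    rewrite (eq_bin_mean _ cE).
    rewrite (@bin_mean_sum _ _ D _ (fun j : 'I_D.+1 => c j) (fun j b => 'C(b, j)%:R)).
    rewrite mulr_sumr (eq_bigr (fun i => \sum_(j < D.+1) c j * 'C(unclaimed Q i, j)%:R)).
      rewrite exchange_big /= -sumrB; apply: eq_bigr => j _.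
      rewrite bin_mean_bin /E /bin_sum natr_sum [RHS]mulrBr mulr_sumr.
      by congr (_ - _); rewrite mulrCA.
    by move=> i Pi; rewrite cE // -(PD i Pi) unclaimed_le.
  apply: (le_trans (sqr_sum_le _)); rewrite ler_wpM2l //.
  by apply: ler_sum => j _; rewrite exprMn.
rewrite expectZ -mulrA ler_wpM2l // expect_sum mulr_suml; apply: ler_sum => j _.
rewrite expectZ -[leRHS]mulrA ler_wpM2l ?sqr_ge0 //.
have jD : (j <= D)%N by rewrite -ltnS.
exact: (bin_sum_concentration C PD delta0 K0 nT NM large spn jD).
Qed.

(** * Statistics summed over all degrees *)

Section Law_of_large_numbers.
Variables (R : realType) (alpha : nat -> nat -> R) (D0 : nat) (delta K : R).
Hypothesis alpha_bound : forall D a, (a <= D)%N -> 0 <= alpha D a <= D%:R.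
Hypotheses (delta_gt0 : 0 < delta) (K_ge0 : 0 <= K).

Definition statistic N T (d : degrees N T) (Q : {set halfU d}) : R :=
  \sum_i alpha (d.1 i) (unclaimed Q i).

Definition degree_count N T (d : degrees N T) (D : nat) : nat :=
  #|[pred i | d.1 i == D]|.

(** Frequencies are weighted by [D] because [alpha D] is bounded by [D]. Degrees from [D0] on are
    only bounded in total, since finitely many classes are controlled by concentration. *)
Definition degree_error N T (d : degrees N T) (pi : nat -> R) : R :=
  (\sum_(i | (D0 <= d.1 i)%N) (d.1 i)%:R) / N%:R
  + \sum_(D < D0) D%:R * `|(degree_count d D)%:R / N%:R - pi D|.

Lemma sum_by_degree N T (d : degrees N T) (F : 'I_N -> R) :
  \sum_i F i = \sum_(D < D0) \sum_(i | d.1 i == D) F i + \sum_(i | (D0 <= d.1 i)%N) F i.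
Proof.
rewrite (bigID (fun i => (D0 <= d.1 i)%N)) addrC; congr (_ + _).
under [RHS]eq_bigr do rewrite big_mkcond.
rewrite exchange_big big_mkcond; apply: eq_bigr => i _ /=; rewrite -ltnNge.
case: ltnP => [iD|Di].
  rewrite (bigD1 (Ordinal iD)) //= eqxx big1 ?addr0 // => D nD.
  by case: eqP => // e; move: nD; rewrite -val_eqE /= e eqxx.
by rewrite big1 // => D _; case: eqP => // e; move: Di; rewrite e leqNgt ltn_ord.
Qed.

(** [K2] precedes the graph and the sizes: it depends on [D0], [delta] and [K] through the constants
    of the finitely many classes. [tau] is the error of cutting the limiting average [Phi] at
    [D0]. *)
Lemma statistic_lln : exists2 K2 : R, 0 <= K2 &
  forall (N T C : nat) (d : degrees N T) (n : nat) (pi : nat -> R) (Phi : R -> R) (tau : R),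
  let M := #|{: halfU d}|%:R in
  (forall rho, 0 <= rho <= 1 ->
    `|Phi rho - \sum_(D < D0) pi D * bin_mean D (1 - rho) (alpha D)| <= tau) ->
  (0 < N)%N -> (n <= T)%N -> N%:R <= K * M ->
  2 * D0%:R + 2 <= delta * M -> delta * M + (spent d n)%:R <= M ->
  expect C (fun Q : {set halfU d} => (statistic Q / N%:R - Phi (#|Q|%:R / M)) ^+ 2) n
  <= K2 * M / N%:R ^+ 2 + 2 * (degree_error d pi + tau) ^+ 2.
Proof.
have /choice[K1 K1P] : forall D : 'I_D0, exists K1 : R, 0 <= K1 /\
  forall (N T C : nat) (d : degrees N T) (P : pred 'I_N) (n : nat),
  let M := #|{: halfU d}|%:R in
  (forall i, P i -> d.1 i = D) -> (n <= T)%N -> N%:R <= K * M ->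
  2 * D%:R + 2 <= delta * M -> delta * M + (spent d n)%:R <= M ->
  expect C (fun Q : {set halfU d} => (\sum_(i | P i) alpha D (unclaimed Q i)
     - #|P|%:R * bin_mean D ((left_over Q)%:R / M) (alpha D)) ^+ 2) n <= K1 * M.
  by move=> D; have [K1 K10 H] := class_concentration D (alpha D) delta_gt0 K_ge0; exists K1.
exists (2 * (D0%:R * \sum_(D < D0) K1 D)).
  by rewrite !mulr_ge0 // sumr_ge0 // => D _; case: (K1P D).
move=> N T C d n pi Phi tau M PhiE N0 nT NM large spn.
have N0r : 0 < N%:R :> R by rewrite ltr0n.
have M0 : 0 < M.
  rewrite -(pmulr_rgt0 _ delta_gt0); apply: lt_le_trans large.
  by apply: ltr_wpDl => //; rewrite mulr_ge0.
pose X D (Q : {set halfU d}) : R := \sum_(i | d.1 i == D) alpha D (unclaimed Q i)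
   - (degree_count d D)%:R * bin_mean D ((left_over Q)%:R / M) (alpha D).
pose B := degree_error d pi + tau.
have ratio (f : pairing d) : let Q := reads C f n in
    (left_over Q)%:R / M = 1 - #|Q|%:R / M /\ 0 <= (left_over Q)%:R / M <= 1.
  move=> Q; split.
    have MQ : M = #|Q|%:R + (left_over Q)%:R by rewrite -natrD left_overE.
    apply: (mulIf (lt0r_neq0 M0)); rewrite mulrBl mul1r !mulfVK ?lt0r_neq0 //.
    by rewrite MQ [X in _ = X - _]addrC addrK.
  by rewrite divr_ge0 // ler_pdivrMr // mul1r ler_nat max_card.
apply: (@le_trans _ _ (expect C (fun Q : {set halfU d} =>
    2 * (D0%:R * \sum_(D < D0) (N%:R ^+ 2)^-1 * X D Q ^+ 2) + 2 * B ^+ 2) n)).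
  apply: expect_le => f _; set Q := reads C f n.
  have [rE r01] := ratio f; rewrite -/Q in rE r01.
  have rho01 : 0 <= #|Q|%:R / M <= 1 by lra.
  have rhoE : 1 - #|Q|%:R / M = (left_over Q)%:R / M by rewrite rE.
  set rho := #|Q|%:R / M in rho01 rhoE *.
  have mean_bound (D : 'I_D0) : 0 <= bin_mean D ((left_over Q)%:R / M) (alpha D) <= D%:R.
    apply/andP; split; first by apply: bin_mean_ge0 => // b /alpha_bound/andP[].
    by apply: bin_mean_le => // b /alpha_bound/andP[].
  pose tail : R := \sum_(i | (D0 <= d.1 i)%N) alpha (d.1 i) (unclaimed Q i).
  (* Four errors: fluctuation inside each class, large degrees, empirical frequencies against [pi],
     and the cut of [Phi]. Only the first is random given the degrees; the others form [B]. *)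
  have -> : statistic Q / N%:R - Phi rho = \sum_(D < D0) N%:R^-1 * X D Q
    + (tail / N%:R + \sum_(D < D0) ((degree_count d D)%:R / N%:R - pi D)
         * bin_mean D ((left_over Q)%:R / M) (alpha D)
       - (Phi rho - \sum_(D < D0) pi D * bin_mean D (1 - rho) (alpha D))).
    have -> : statistic Q = \sum_(D < D0) \sum_(i | d.1 i == D) alpha D (unclaimed Q i) + tail.
      rewrite /statistic (sum_by_degree d); congr (_ + _); apply: eq_bigr => D _.
      by apply: eq_bigr => i /eqP ->.
    have : (\sum_(D < D0) \sum_(i | d.1 i == D) alpha D (unclaimed Q i)) / N%:R
      = \sum_(D < D0) N%:R^-1 * X D Q
        + \sum_(D < D0) ((degree_count d D)%:R / N%:R - pi D)
           * bin_mean D ((left_over Q)%:R / M) (alpha D)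
        + \sum_(D < D0) pi D * bin_mean D ((left_over Q)%:R / M) (alpha D).
      rewrite mulr_suml -!big_split /=; apply: eq_bigr => D _.
      by rewrite /X; field; rewrite gt_eqF.
    by rewrite rhoE => sE; rewrite mulrDl sE; ring.
  apply: (le_trans (sqrD_le _ _)); apply: lerD.
    rewrite ler_pM2l // (le_trans (sqr_sum_le _)) // ler_wpM2l //.
    by apply: ler_sum => D _; rewrite exprMn exprVn.
  rewrite ler_pM2l //; apply: sqr_le_norm.
  rewrite /B /degree_error.
  have tail_ge0 : 0 <= tail / N%:R.
    rewrite divr_ge0 // sumr_ge0 // => i _.
    by have /andP[] := alpha_bound (unclaimed_le Q i).
  apply: (le_trans (ler_normB _ _)); apply: lerD; last exact: PhiE.
  apply: (le_trans (ler_normD _ _)); apply: lerD.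
    rewrite ger0_norm // ler_pM2r ?invr_gt0 //; apply: ler_sum => i _.
    by have /andP[] := alpha_bound (unclaimed_le Q i).
  apply: (le_trans (ler_norm_sum _ _ _)); apply: ler_sum => D _.
  have /andP[m0 mD] := mean_bound D.
  by rewrite normrM mulrC (ger0_norm m0) ler_wpM2r.
have B0 : 0 <= 2 * B ^+ 2 by rewrite mulr_ge0 // sqr_ge0.
rewrite expectD; apply: lerD; last exact: (@expect_cst_le R N T C d _ n B0).
rewrite expectZ expectZ.
rewrite (@expect_sum R N T C d _ _ (fun (D : 'I_D0) Q => (N%:R ^+ 2)^-1 * X D Q ^+ 2)).
  rewrite -!mulrA ler_pM2l // ler_wpM2l // mulr_suml; apply: ler_sum => D _.
  rewrite expectZ mulrA [leRHS]mulrC ler_wpM2l ?invr_ge0 ?sqr_ge0 //.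
  have [_ H] := K1P D; apply: H => //.
    by move=> i /eqP.
  by apply: le_trans large; rewrite lerD2r ler_pM2l // ler_nat; exact: ltnW.
Qed.

End Law_of_large_numbers.

Lemma discrete_gronwall (R : realType) (x w v : nat -> R) (k : nat) :
  x 0%N <= 0 -> (forall t, 0 <= w t) -> (forall t, 0 <= v t) ->
  (forall t, (t < k)%N -> x t.+1 <= (1 + w t) * x t + v t) ->
  x k <= expR (\sum_(t < k) w t) * \sum_(t < k) v t.
Proof.
move=> x0 w0 v0; elim: k => [|k IH] step; first by rewrite !big_ord0 mulr0.
have {}IH := IH (fun t tk => step t (ltnW tk)).
apply: (le_trans (step k (ltnSn k))); rewrite !big_ord_recr /= expRD mulrDr.
apply: lerD; last first.
  rewrite -[leLHS]mul1r ler_wpM2r // -expRD -[leLHS]expR0 ler_expR.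
  by rewrite addr_ge0 // sumr_ge0.
apply: (@le_trans _ _ ((1 + w k) * (expR (\sum_(t < k) w t) * \sum_(t < k) v t))).
  by rewrite ler_wpM2l // addr_ge0.
rewrite [leRHS]mulrAC -mulrA mulrC mulrA ler_wpM2l ?mulr_ge0 ?expR_ge0 ?sumr_ge0 //.
exact: expR_ge1Dx.
Qed.

(** * Mean number of reads of one vertex *)

Section Mean_reads.
Variable R : realFieldType.
Implicit Types (p A : R).

(* (1 - (1 - p)^m) / p, without the division: the mean number of reads of a vertex
   of degree [m] when each read hits with probability [p]. *)
Fixpoint mean_reads (m : nat) p : R :=
  if m is k.+1 then 1 + (1 - p) * mean_reads k p else 0.

(* The exact mean when [A] of the [L] half-edges left over are free: a miss keeps
   [A] and decreases [L]. *)
Fixpoint mean_reads_left (m : nat) A (L : nat) : R :=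
  if m is k.+1 then 1 + (1 - A / L%:R) * mean_reads_left k A L.-1 else 0.

Lemma mean_reads_bound m p : 0 <= p <= 1 -> 0 <= mean_reads m p <= m%:R.
Proof.
move=> p01; elim: m => [|m /andP[IH1 IH2]] /=; first by rewrite lexx.
have : 0 <= (1 - p) * mean_reads m p <= mean_reads m p.
  by apply/andP; split; nra.
by rewrite -natr1; lra.
Qed.

Lemma mean_reads_lip m p q : 0 <= p <= 1 -> 0 <= q <= 1 ->
  `|mean_reads m p - mean_reads m q| <= m%:R ^+ 2 * `|p - q|.
Proof.
move=> p01 q01; elim: m => [|m IH] /=; first by rewrite subrr normr0 mulr_ge0 ?sqr_ge0.
have -> : 1 + (1 - p) * mean_reads m p - (1 + (1 - q) * mean_reads m q)
   = (1 - q) * (mean_reads m p - mean_reads m q) - (p - q) * mean_reads m p by ring.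
have /andP[m1 m2] := mean_reads_bound m p01.
apply: (le_trans (ler_normB _ _)); rewrite !normrM (ger0_norm m1).
rewrite (ger0_norm (x := 1 - q)); last lra.
have a0 := normr_ge0 (p - q); set a := `|p - q| in IH a0 *.
have b0 := normr_ge0 (mean_reads m p - mean_reads m q); set b := `|_| in IH b0 *.
have m0 : 0 <= m%:R :> R by [].
rewrite -natr1; nra.
Qed.

(** A miss moves the hit probability from A / L to A / (L - 1), a shift of at most 1 / L0. The
    Lipschitz constant m^2 turns the shift into an error in the mean, and at most m reads add such
    errors. *)
Lemma mean_reads_left_approx m (L0 A L : nat) : (0 < L0)%N -> (m + L0 <= L)%N ->
  (A <= L)%N ->
  `|mean_reads_left m A%:R L - mean_reads m (A%:R / L%:R)| <= m%:R ^+ 3 / L0%:R.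
Proof.
move=> L00; elim: m L => [|m IH] L mL AL.
  by rewrite /= subrr normr0 divr_ge0 // exprn_ge0.
have L0r : 0 < L0%:R :> R by rewrite ltr0n.
have Lp : (0 < L)%N by lia.
have Lr : 0 < L%:R :> R by rewrite ltr0n.
rewrite [mean_reads_left _ _ _]/= [mean_reads _ _]/=; set q := A%:R / L%:R.
have q01 : 0 <= q <= 1.
  by rewrite divr_ge0 //= ler_pdivrMr // mul1r ler_nat.
have -> : 1 + (1 - q) * mean_reads_left m A%:R L.-1 - (1 + (1 - q) * mean_reads m q)
  = (1 - q) * (mean_reads_left m A%:R L.-1 - mean_reads m q) by ring.
(* If every half-edge left is free the first read hits; otherwise A <= L - 1, as the recursive call
   requires. *)
have [AE|nAL] := eqVneq A L.
  have -> : q = 1 by rewrite /q AE divff // gt_eqF.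
  by rewrite subrr mul0r normr0 divr_ge0 // exprn_ge0.
have AL1 : (A <= L.-1)%N by lia.
have L1p : (0 < L.-1)%N by lia.
have L1r : 0 < L.-1%:R :> R by rewrite ltr0n.
have L0L : L0%:R <= L%:R :> R by rewrite ler_nat; clear -mL; lia.
have mL1 : (m + L0 <= L.-1)%N by clear -mL; lia.
have {IH} := IH L.-1 mL1 AL1; set q' := A%:R / L.-1%:R.
have q'01 : 0 <= q' <= 1 by rewrite divr_ge0 //= ler_pdivrMr // mul1r ler_nat.
have dq : `|q' - q| <= L0%:R^-1.
  have -> : q' - q = A%:R / L.-1%:R / L%:R.
    rewrite /q' /q -[in RHS](addrK 1 A%:R).
    have -> : L%:R = L.-1%:R + 1 :> R by rewrite natr1 prednK.
    by field; rewrite natr1 prednK // !gt_eqF.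
  rewrite ger0_norm ?divr_ge0 // -[leRHS]mul1r ler_pM ?divr_ge0 ?invr_ge0 //.
    by rewrite ler_pdivrMr // mul1r ler_nat.
  by rewrite lef_pV2 ?posrE.
have lip := mean_reads_lip m q'01 q01.
set x := mean_reads_left m _ _; set y := mean_reads m q' in lip *.
set z := mean_reads m q in lip *; move=> xy.
have xz : `|x - z| <= m%:R ^+ 3 / L0%:R + m%:R ^+ 2 / L0%:R.
  have -> : x - z = (x - y) + (y - z) by ring.
  apply: (le_trans (ler_normD _ _)); apply: lerD => //.
  by apply: (le_trans lip); rewrite ler_wpM2l ?sqr_ge0.
rewrite normrM; apply: (@le_trans _ _ `|x - z|).
  by rewrite -[leRHS]mul1r ler_wpM2r // ger0_norm; lra.
apply: (le_trans xz); rewrite -mulrDl ler_pM2r ?invr_gt0 // -natr1.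
have m0 : 0 <= m%:R :> R by [].
nra.
Qed.

End Mean_reads.

(** * The number of exposed half-edges, given the degrees *)

Section Read_count.
Variables (R : realType) (N T C : nat) (d : degrees N T).
Local Notation PP := (perfect_pairings d).
Local Notation vertex_op := (@vertex_op R N T C d).
Local Notation hit := (@hit N T C d).
Implicit Types (Q : {set halfU d}) (h : halfU d) (g : {set halfU d} -> R).

Definition open_count Q : nat := #|[set h | (h \notin Q) && hit Q h]|.

Lemma open_count_miss Q h : h \notin Q -> ~~ hit Q h ->
  open_count (h |: Q) = open_count Q.
Proof.
move=> hQ nh; have hitU y : hit (h |: Q) y = hit Q y.
  by congr free; apply: loads_miss.
apply: eq_card => y; rewrite !inE negb_or hitU.
by case: eqVneq => //= ->; rewrite hQ (negbTE nh).
Qed.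

Lemma open_count_le Q : (open_count Q <= left_over Q)%N.
Proof.
by apply: subset_leq_card; apply/subsetP => h; rewrite !inE => /andP[].
Qed.

Lemma vertex_op_card m Q : (m <= left_over Q)%N ->
  vertex_op m (fun Q' => #|Q'|%:R) Q
  = #|Q|%:R + mean_reads_left m (open_count Q)%:R (left_over Q).
Proof.
elim: m Q => [|m IH] Q mL; first by rewrite /= addr0.
have Lp : (0 < left_over Q)%N by apply: leq_trans mL.
have Lr : 0 < (left_over Q)%:R :> R by rewrite ltr0n.
rewrite vertex_opE [mean_reads_left _ _ _]/=; set E := mean_reads_left _ _ _.
rewrite (eq_bigr (fun h => #|Q|%:R + 1 + (~~ hit Q h)%:R * E)) => [|h hQ]; last first.
  case: ifPn => [_|nh]; first by rewrite cardsU1 hQ natrD mul0r addr0 addrC.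
  rewrite IH left_overU1 //; last by lia.
  by rewrite open_count_miss // cardsU1 hQ mul1r natrD [1 + _]addrC.
rewrite big_split /= sum_unread_const -mulr_suml.
have -> : \sum_(h | h \notin Q) (~~ hit Q h)%:R = (left_over Q)%:R - (open_count Q)%:R :> R.
  apply/eqP; rewrite eq_sym subr_eq -!natr_sum -natrD; apply/eqP; congr (_%:R).
  rewrite /left_over -(cardsID [set h | hit Q h] (~: Q)) addnC; congr (_ + _)%N.
    rewrite -sum1_card [RHS]big_mkcond [LHS]big_mkcond; apply: eq_bigr => h _.
    by rewrite !inE; case: (h \in Q); case: (hit Q h).
  by apply: eq_card => h; rewrite !inE.
by field; rewrite gt_eqF.
Qed.

(** One arrival in the second-moment recursion, for the distance of [#|Q|] to a reference value
    moved by its mean-field increment. The weights are such that the squared distance grows by a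
    factor 1 + O(1 / n), which can be iterated over order n arrivals. *)
Lemma vertex_op_deviation (p : R -> R) (lip n c : R) (L0 m : nat) Q :
  (forall x, 0 <= p x <= 1) -> (forall x y, `|p x - p y| <= lip * `|x - y|) ->
  0 <= lip -> 0 < n -> (0 < L0)%N -> (m + L0 <= left_over Q)%N ->
  vertex_op m (fun Q' => (#|Q'|%:R - (c + mean_reads m (p (c / n)))) ^+ 2) Q
  <= (1 + (2 + 2 * lip) / n * m%:R ^+ 3) * (#|Q|%:R - c) ^+ 2
     + (m%:R ^+ 3 * (n / L0%:R ^+ 2 + 1)
       + m%:R ^+ 3 * n * ((open_count Q)%:R / (left_over Q)%:R - p (#|Q|%:R / n)) ^+ 2).
Proof.
move=> p01 plip lip0 n0 L00 mL.
have L0r : 0 < L0%:R :> R by rewrite ltr0n.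
set q := mean_reads m _; set D := #|Q|%:R - c.
have /andP[q0 qm] : 0 <= q <= m%:R by apply: mean_reads_bound.
have mLQ : (m <= left_over Q)%N by apply: leq_trans mL; rewrite leq_addr.
pose del : R := mean_reads_left m (open_count Q)%:R (left_over Q).
have m0 : 0 <= m%:R :> R by [].
have step1 : vertex_op m (fun Q' => (#|Q'|%:R - (c + q)) ^+ 2) Q
    <= D ^+ 2 + m%:R ^+ 2 + 2 * D * (del - q).
  (* The number of reads and [q] both lie between 0 and [m], so their squared difference is at most
     [m ^ 2]. The rest is affine in the number of exposed half-edges, whose mean is known
     exactly. *)
  apply: (@le_trans _ _ (vertex_op m (fun Q' =>
      (D ^+ 2 + m%:R ^+ 2 - 2 * D * (#|Q|%:R + q)) + 2 * D * #|Q'|%:R) Q)).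
    apply: vertex_op_le => Q' /subset_leq_card; rewrite -(ler_nat R) => s1.
    rewrite -(ler_nat R) natrD => s2.
    set y := #|Q'|%:R in s1 s2 *.
    have : (y - #|Q|%:R - q) ^+ 2 <= m%:R ^+ 2 by apply: sqr_le_norm; rewrite ler_norml; apply/andP; split; lra.
    by rewrite /D; nra.
  rewrite vertex_opD vertex_op_const // vertex_opZ vertex_op_card // -/del.
  by rewrite le_eqVlt; apply/orP; left; apply/eqP; ring.
apply: (le_trans step1).
set e := (open_count Q)%:R / (left_over Q)%:R - p (#|Q|%:R / n).
have OL := open_count_le Q.
have LQr : 0 < (left_over Q)%:R :> R.
  by rewrite ltr0n (leq_trans _ mL) // (leq_trans L00) // leq_addl.
have o01 : 0 <= ((open_count Q)%:R / (left_over Q)%:R : R) <= 1.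
  by rewrite divr_ge0 //= ler_pdivrMr // mul1r ler_nat.
have dq : `|del - q| <= m%:R ^+ 3 / L0%:R + m%:R ^+ 2 * (`|e| + lip * (`|D| / n)).
  have -> : del - q = (del - mean_reads m ((open_count Q)%:R / (left_over Q)%:R))
     + (mean_reads m ((open_count Q)%:R / (left_over Q)%:R) - q) by ring.
  apply: (le_trans (ler_normD _ _)); apply: lerD; first exact: mean_reads_left_approx.
  apply: (le_trans (mean_reads_lip m o01 (p01 _))); rewrite ler_wpM2l ?sqr_ge0 //.
  have -> : (open_count Q)%:R / (left_over Q)%:R - p (c / n)
    = e + (p (#|Q|%:R / n) - p (c / n)) by rewrite /e; ring.
  apply: (le_trans (ler_normD _ _)); rewrite lerD2l; apply: (le_trans (plip _ _)).
  by rewrite ler_wpM2l // -mulrBl normrM normfV (gtr0_norm n0).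
have m23 : m%:R ^+ 2 <= m%:R ^+ 3 :> R by rewrite -!natrX ler_nat; case: (m) => // k; rewrite leq_pexp2l.
have m3 : 0 <= m%:R ^+ 3 :> R by rewrite exprn_ge0.
have cross : 2 * D * (del - q) <= 2 * (`|D| *
    (m%:R ^+ 3 / L0%:R + m%:R ^+ 2 * (`|e| + lip * (`|D| / n)))).
  rewrite -mulrA ler_pM2l //; apply: (le_trans (ler_norm _)); rewrite normrM.
  by rewrite ler_wpM2l.
have D2 : D ^+ 2 = `|D| ^+ 2 by rewrite real_normK ?num_real.
have e2 : e ^+ 2 = `|e| ^+ 2 by rewrite real_normK ?num_real.
have a0 := normr_ge0 D; have b0 := normr_ge0 e.
rewrite D2 e2; rewrite -D2; move: cross m23 m3.
rewrite D2; move: a0 b0; clear -n0 lip0 L0r.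
set a := `|D|; set b := `|e|; set u := m%:R ^+ 3; set v := m%:R ^+ 2.
move=> a0 b0 cross uv u0; apply: (le_trans (lerD (lexx _) cross)).
have v0 : 0 <= v by rewrite sqr_ge0.
have n' : n != 0 by rewrite gt_eqF.
(* Young's inequality, weighted so that the squared distance always comes divided by [n]; likewise
   for the two other products. *)
have am1 : 2 * (a * (u / L0%:R)) <= u * (a ^+ 2 / n + n / L0%:R ^+ 2).
  have : 0 <= u * n^-1 * (a - n / L0%:R) ^+ 2.
    by rewrite mulr_ge0 ?sqr_ge0 // mulr_ge0 // invr_ge0 ltW.
  move=> h; rewrite -subr_ge0; apply: (le_trans h); rewrite le_eqVlt; apply/orP; left; apply/eqP.
  by field; rewrite n' gt_eqF.
have am2 : 2 * (a * (v * b)) <= u * (a ^+ 2 / n + n * b ^+ 2).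
  apply: (@le_trans _ _ (v * (a ^+ 2 / n + n * b ^+ 2))).
    have : 0 <= v * n^-1 * (a - n * b) ^+ 2.
      by rewrite mulr_ge0 ?sqr_ge0 // mulr_ge0 // invr_ge0 ltW.
    move=> h; rewrite -subr_ge0; apply: (le_trans h); rewrite le_eqVlt; apply/orP; left; apply/eqP.
    by field.
  by rewrite ler_wpM2r // addr_ge0 ?divr_ge0 ?mulr_ge0 ?sqr_ge0 // ltW.
have am3 : 2 * (a * (v * (lip * (a / n)))) <= u * (2 * lip * a ^+ 2 / n).
  apply: (@le_trans _ _ (v * (2 * lip * a ^+ 2 / n))).
    by rewrite le_eqVlt; apply/orP; left; apply/eqP; field.
  by rewrite ler_wpM2r // divr_ge0 ?mulr_ge0 ?sqr_ge0 // ltW.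
apply: (@le_trans _ _ (a ^+ 2 + u + (u * (a ^+ 2 / n + n / L0%:R ^+ 2)
  + u * (a ^+ 2 / n + n * b ^+ 2) + u * (2 * lip * a ^+ 2 / n)))).
  by rewrite !mulrDr; lra.
rewrite le_eqVlt; apply/orP; left; apply/eqP.
by field; rewrite n' gt_eqF.
Qed.

(** The reference path [g] follows the recursion driven by the actual degrees; [eta] bounds the mean
    square error made when the true proportion of free half-edges is replaced by [p]. *)
Lemma reads_deviation (p : R -> R) (lip n : R) (g : nat -> R) (L0 k : nat) (eta : R) :
  (forall x, 0 <= p x <= 1) -> (forall x y, `|p x - p y| <= lip * `|x - y|) ->
  0 <= lip -> 0 < n -> 0 <= eta -> (0 < L0)%N -> (k <= T)%N ->
  (L0 + spent d k <= #|{: halfU d}|)%N ->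
  g 0%N = 0 ->
  (forall t : 'I_T, n * g t.+1 = n * g t + mean_reads (d.2 t) (p (g t))) ->
  (forall t, (t < k)%N -> expect C (fun Q : {set halfU d} =>
     ((open_count Q)%:R / (left_over Q)%:R - p (#|Q|%:R / n)) ^+ 2) t <= eta) ->
  expect C (fun Q : {set halfU d} => (#|Q|%:R - n * g k) ^+ 2) k
  <= expR ((2 + 2 * lip) / n * \sum_(t < T) (d.2 t)%:R ^+ 3)
     * (\sum_(t < T) (d.2 t)%:R ^+ 3 * (n / L0%:R ^+ 2 + 1 + n * eta)).
Proof.
move=> p01 plip lip0 n0 eta0 L00 kT spk g0 gS err.
pose deg3 t : R := if insub t is Some s then (d.2 (s : 'I_T))%:R ^+ 3 else 0.
have deg3E (t : 'I_T) : deg3 t = (d.2 t)%:R ^+ 3 by rewrite /deg3 valK.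
have deg3_0 t : 0 <= deg3 t by rewrite /deg3; case: insub => // s; rewrite exprn_ge0.
pose w t := (2 + 2 * lip) / n * deg3 t.
pose v t := deg3 t * (n / L0%:R ^+ 2 + 1 + n * eta).
have c0 : 0 <= (2 + 2 * lip) / n by rewrite divr_ge0 ?addr_ge0 ?mulr_ge0 // ltW.
have n0' := ltW n0.
have c1 : 0 <= n / L0%:R ^+ 2 + 1 + n * eta.
  by rewrite addr_ge0 ?mulr_ge0 // addr_ge0 // divr_ge0 // sqr_ge0.
have := @discrete_gronwall R (fun t => expect C (fun Q : {set halfU d} =>
   (#|Q|%:R - n * g t) ^+ 2) t) w v k.
have sumk : forall F : nat -> R, (forall t, 0 <= F t) ->
    \sum_(t < k) F t <= \sum_(t < T) F t.
  move=> F F0; rewrite (big_ord_widen _ _ kT) [leLHS]big_mkcond.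
  by apply: ler_sum => t _; case: ifP.
move=> /(_ _ _ _ _)/le_trans; apply.
- rewrite /expect (eq_bigr (fun=> 0)) ?big1 ?mul0r // => f _.
  by rewrite cards0 g0 mulr0 subrr expr0n.
- by move=> t; rewrite mulr_ge0.
- by move=> t; rewrite mulr_ge0.
- move=> t tk; have tT : (t < T)%N by apply: leq_trans kT.
  pose s := Ordinal tT; have sE : nat_of_ord s = t by [].
  have spS : (spent d t.+1 <= spent d k)%N.
    rewrite /spent [leqLHS]big_mkcond [leqRHS]big_mkcond; apply: leq_sum => r _.
    by case: (ltnP r t.+1) => // rt; rewrite (leq_trans rt tk).
  rewrite -sE expectS sE.
  have cE : n * g t.+1 = n * g t + mean_reads (d.2 s) (p (n * g t / n)).
    have -> : n * g t / n = g t by rewrite mulrAC divff ?mul1r // gt_eqF.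
    by rewrite -sE gS.
  apply: (@le_trans _ _ (expect C (fun Q : {set halfU d} =>
     (1 + w t) * (#|Q|%:R - n * g t) ^+ 2 + (deg3 t * (n / L0%:R ^+ 2 + 1)
     + deg3 t * n * ((open_count Q)%:R / (left_over Q)%:R - p (#|Q|%:R / n)) ^+ 2)) t)).
    apply: expect_le => f fP; rewrite cE /w -sE deg3E.
    apply: vertex_op_deviation => //; apply: left_over_reads; first exact: ltnW.
    have -> : (d.2 s + L0 + spent d s = L0 + spent d s.+1)%N by rewrite spentS; clear; lia.
    by rewrite (leq_trans _ spk) // leq_add2l.
  rewrite expectD expectZ lerD2l expectD /v.
  have -> : deg3 t * (n / L0%:R ^+ 2 + 1 + n * eta)
    = deg3 t * (n / L0%:R ^+ 2 + 1) + deg3 t * n * eta by ring.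
  apply: lerD.
    apply: (@expect_cst_le R N T C d); rewrite mulr_ge0 // addr_ge0 // divr_ge0 ?sqr_ge0 //.
  by rewrite expectZ ler_wpM2l ?err // mulr_ge0.
apply: ler_pM; rewrite ?expR_ge0 ?sumr_ge0 //.
- by move=> t _; rewrite mulr_ge0.
- rewrite ler_expR mulr_sumr; apply: (le_trans (sumk w _)) => [t|]; first by rewrite mulr_ge0.
  by apply: ler_sum => t _; rewrite /w deg3E.
- apply: (le_trans (sumk v _)) => [t|]; first by rewrite mulr_ge0.
  by apply: ler_sum => t _; rewrite /v deg3E.
Qed.

End Read_count.

Section Statistics.
Variables (R : realType) (C : nat).

Definition open_half_edges (D a : nat) : R := if (D - a < C)%N then a%:R else 0.

Definition capped_load (D a : nat) : R := (minn C (D - a))%:R.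

Lemma open_half_edges_bound D a : (a <= D)%N -> 0 <= open_half_edges D a <= D%:R.
Proof.
by rewrite /open_half_edges -(ler_nat R) => aD; case: ifP => _; rewrite ?lexx ?ler0n.
Qed.

Lemma capped_load_bound D a : (a <= D)%N -> 0 <= capped_load D a <= D%:R.
Proof.
by move=> aD; rewrite /capped_load ler0n ler_nat geq_min leq_subr orbT.
Qed.

Variables (N T : nat) (d : degrees N T).
Implicit Types Q : {set halfU d}.

Lemma claimed_sub Q i : claimed Q i = (d.1 i - unclaimed Q i)%N.
Proof. by rewrite -(claimedE Q i) addnK. Qed.

Lemma open_countE Q : (open_count C Q)%:R = statistic open_half_edges Q.
Proof.
rewrite /statistic /open_count -sum1_card.
rewrite (partition_big (fun h : halfU d => tag h) predT) //=.
rewrite (bigD1 None) //= big_pred0 => [|h]; last first.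
  by rewrite inE hitE; case: (tag h) => [i|]; rewrite ?andbF.
rewrite add0n (reindex_omap Some id) /=; last by case.
rewrite natr_sum; apply: eq_big => [i|i _]; first by rewrite eqxx.
rewrite /open_half_edges -claimed_sub /unclaimed -sum1_card.
case: ifP => cl; last first.
  rewrite big_pred0 // => h; rewrite inE hitE.
  by case: eqP => [->|]; rewrite ?andbF // cl andbF.
congr (_%:R); apply: eq_bigl => h; rewrite !inE hitE.
by case: eqP => [->|]; rewrite ?andbF // cl !andbT.
Qed.

Lemma sum_loadsE Q : (\sum_i loads C Q i)%:R = statistic capped_load Q.
Proof.
by rewrite natr_sum; apply: eq_bigr => i _; rewrite ffunE claimed_sub.
Qed.

End Statistics.

Lemma spent_mono N T (d : degrees N T) (m n : nat) : (m <= n)%N -> (spent d m <= spent d n)%N.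
Proof.
move=> mn; rewrite /spent [leqLHS]big_mkcond [leqRHS]big_mkcond; apply: leq_sum => r _.
by case: (ltnP r m) => // rm; rewrite (leq_trans rm mn).
Qed.

(** * The limit given typical degrees *)

Section Quenched_limit.
Variables (R : realType) (C : nat) (pi : nat -> R) (mu lip delta K3 : R).
Variables (p Phi : R -> R).
Hypotheses (mu_gt0 : 0 < mu) (lip_ge0 : 0 <= lip) (delta_gt0 : 0 < delta).
Hypothesis p01 : forall x, 0 <= p x <= 1.
Hypothesis p_lip : forall x y, `|p x - p y| <= lip * `|x - y|.
Hypothesis Phi_lip : forall x y, `|Phi x - Phi y| <= lip * `|x - y|.

Definition approximates (f : R -> R) (alpha : nat -> nat -> R) (D0 : nat) (tau : R) :=
  forall rho, 0 <= rho <= 1 ->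
    `|f rho - \sum_(D < D0) pi D * bin_mean D (1 - rho) (alpha D)| <= tau.

(** Mean square error on the hit probability, in units of [theta ^ 2]: 3 for a split into three
    terms, (1 + 2 * 2 ^ 2) from [statistic_lln] rescaled by N / L, [2 ^ 2] from n / M against 1, and
    [lip ^ 2] from |Q| / M against |Q| / n. *)
Definition quenched_const1 : R :=
  3 * ((2 / mu / delta) ^+ 2 * (1 + 2 * 2 ^+ 2) + 2 ^+ 2 + lip ^+ 2).

(** The first term is the law of large numbers for the loads. The second moves the argument of [Phi]
    from |Q| / M to |Q| / n and then to the reference path, the latter at the price of the Gronwall
    bound. *)
Definition quenched_const : R :=
  2 * (1 + 2 * 2 ^+ 2) + 2 * lip ^+ 2 * (2 + 2 *
    (expR ((2 + 2 * lip) * K3 / mu) * (K3 / mu) * (1 + 1 + quenched_const1))).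

(** All errors are brought to multiples of [theta ^ 2] with a constant independent of [theta] and
    [D0]; these only affect the threshold [N0]. *)
Lemma quenched_matching theta D0 : 0 < theta <= 1 / 2 ->
  approximates (fun rho => mu * (1 - rho) * p rho) (open_half_edges R C) D0 theta ->
  approximates Phi (capped_load R C) D0 theta ->
  exists N0 : nat, forall (N T : nat) (d : degrees N T) (k : nat) (g : nat -> R),
  let n := mu * N%:R in let M := #|{: halfU d}|%:R in
  (N0 <= N)%N -> (k <= T)%N -> `|M / n - 1| <= theta ->
  degree_error D0 d pi <= theta ->
  \sum_(t < T) (d.2 t)%:R ^+ 3 <= K3 * N%:R ->
  delta * M + (spent d k)%:R <= M ->
  g 0%N = 0 ->
  (forall t : 'I_T, n * g t.+1 = n * g t + mean_reads (d.2 t) (p (g t))) ->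
  expect C (fun Q : {set halfU d} => ((\sum_i loads C Q i)%:R / N%:R - Phi (g k)) ^+ 2) k
  <= quenched_const * theta ^+ 2.
Proof.
move=> /andP[theta0 theta2] app1 app2.
pose K := 2 / mu; have K0 : 0 <= K by rewrite divr_ge0 // ltW.
have [Ka Ka0 llna] := @statistic_lln R (open_half_edges R C) D0 delta K
  (@open_half_edges_bound R C) delta_gt0 K0.
have [Kb Kb0 llnb] := @statistic_lln R (capped_load R C) D0 delta K
  (@capped_load_bound R C) delta_gt0 K0.
(* Lower bounds on N: [X1] makes the class fluctuations at most [theta ^ 2], [X2] leaves enough
   unread half-edges for the degrees below [D0], [X3] makes 1 / L0 at most [theta], and [X4] makes 1
   / n at most [theta ^ 2]. *)
pose X1 := 2 * mu * (Ka + Kb) / theta ^+ 2.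
pose X2 := (2 * D0%:R + 2) * 2 / (delta * mu).
pose X3 := 2 / (delta * mu * theta).
pose X4 := 1 / (mu * theta ^+ 2).
have [X1_0 X2_0 X3_0 X4_0] : [/\ 0 <= X1, 0 <= X2, 0 <= X3 & 0 <= X4].
  have [mu0 de0 th0] := And3 (ltW mu_gt0) (ltW delta_gt0) (ltW theta0).
  by split; apply: divr_ge0; rewrite ?(addr_ge0, mulr_ge0, exprn_ge0).
exists (Num.truncn (X1 + X2 + X3 + X4)).+1.
move=> N T d k g n M N0N kT Mn derr deg3 spk g0 gS.
have XN : X1 + X2 + X3 + X4 <= N%:R.
  by apply/ltW/(lt_le_trans (truncnS_gt _)); rewrite ler_nat.
have [XN3 XN4] : X3 <= N%:R /\ X4 <= N%:R by split; lra.
have N0 : (0 < N)%N by apply: leq_trans N0N.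
have N0r : 0 < N%:R :> R by rewrite ltr0n.
have n0 : 0 < n by rewrite mulr_gt0.
have [Mlo Mhi] : n / 2 <= M /\ M <= 2 * n.
  move: Mn; rewrite ler_norml => /andP[h1 h2].
  have : 1 / 2 <= M / n <= 3 / 2 by apply/andP; split; lra.
  by rewrite ler_pdivlMr // ler_pdivrMr // => /andP[? ?]; split; lra.
have M0 : 0 < M by lra.
have NM : N%:R <= K * M.
  have -> : N%:R = 2 / mu * (n / 2) by rewrite /n; field; rewrite gt_eqF.
  by rewrite ler_wpM2l.
have large : 2 * D0%:R + 2 <= delta * M.
  apply: (@le_trans _ _ (delta * (n / 2))); last by rewrite ler_pM2l.
  have -> : 2 * D0%:R + 2 = delta * (mu * X2 / 2) by rewrite /X2; field; rewrite !gt_eqF.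
  by rewrite ler_pM2l // ler_pM2r ?invr_gt0 // /n ler_pM2l //; lra.
have small (K2 : R) : 0 <= K2 <= Ka + Kb -> K2 * M / N%:R ^+ 2 <= theta ^+ 2.
  move=> /andP[K20 K2ab].
  apply: (@le_trans _ _ (2 * mu * (Ka + Kb) / N%:R)).
    have -> : 2 * mu * (Ka + Kb) / N%:R = (Ka + Kb) * (2 * n) / N%:R ^+ 2.
      by rewrite /n; field; rewrite gt_eqF.
    by rewrite ler_wpM2r ?invr_ge0 ?sqr_ge0 // ler_pM // ltW.
  rewrite ler_pdivrMr // -ler_pdivrMl ?exprn_gt0 // mulrC.
  by apply: le_trans XN; rewrite /X1 -!addrA lerDl !addr_ge0.
have derr0 : 0 <= degree_error D0 d pi.
  apply: addr_ge0; first by rewrite divr_ge0 // sumr_ge0.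
  by apply: sumr_ge0 => D _; rewrite mulr_ge0.
have derr2 : 2 * (degree_error D0 d pi + theta) ^+ 2 <= 2 * 2 ^+ 2 * theta ^+ 2.
  rewrite -mulrA ler_pM2l // -exprMn; apply: sqr_le_norm.
  by rewrite ger0_norm; [lra|rewrite addr_ge0 // ltW].
have spt t : (t <= k)%N -> delta * M + (spent d t)%:R <= M.
  by move=> tk; apply: le_trans spk; rewrite lerD2l ler_nat spent_mono.
have bnd (K2 : R) : 0 <= K2 <= Ka + Kb ->
    K2 * M / N%:R ^+ 2 + 2 * (degree_error D0 d pi + theta) ^+ 2
    <= (1 + 2 * 2 ^+ 2) * theta ^+ 2.
  by move=> /small sm; rewrite [leRHS]mulrDl mul1r lerD.
have [Ka_ab Kb_ab] : 0 <= Ka <= Ka + Kb /\ 0 <= Kb <= Ka + Kb by split; lra.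
have llna' t (tk : (t <= k)%N) := le_trans
  (llna N T C d t pi _ theta app1 N0 (leq_trans tk kT) NM large (spt t tk)) (bnd _ Ka_ab).
have llnb' := le_trans
  (llnb N T C d k pi _ theta app2 N0 kT NM large spk) (bnd _ Kb_ab).
have spM : (spent d k <= #|{: halfU d}|)%N.
  by rewrite -(ler_nat R); apply: le_trans spk; rewrite lerDr mulr_ge0 // ltW.
pose L0 := (#|{: halfU d}| - spent d k)%N.
have L0r : delta * M <= L0%:R by rewrite natrB // lerBrDr.
have L0_gt0 : 0 < L0%:R :> R by apply: lt_le_trans L0r; rewrite mulr_gt0.
have L00 : (0 < L0)%N by rewrite -(ltr0n R).
have rhoQ (Q : {set halfU d}) : `|#|Q|%:R / M - #|Q|%:R / n| <= theta.
  have -> : #|Q|%:R / M - #|Q|%:R / n = (#|Q|%:R / M) * (1 - M / n).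
    by field; rewrite !gt_eqF.
  rewrite normrM -[leRHS]mul1r ler_pM //; last by rewrite distrC.
  rewrite ger0_norm; last by rewrite divr_ge0.
  by rewrite ler_pdivrMr // mul1r ler_nat max_card.
have eta0 : 0 <= quenched_const1 * theta ^+ 2.
  by rewrite /quenched_const1 !(sqr_ge0, addr_ge0, mulr_ge0).
have err t : (t < k)%N -> expect C (fun Q : {set halfU d} =>
     ((open_count C Q)%:R / (left_over Q)%:R - p (#|Q|%:R / n)) ^+ 2) t
   <= quenched_const1 * theta ^+ 2.
  move=> tk; have tT := leq_trans (ltnW tk) kT.
  apply: (@le_trans _ _ (expect C (fun Q : {set halfU d} =>
      3 * ((K / delta) ^+ 2 * (statistic (open_half_edges R C) Q / N%:R
        - mu * (1 - #|Q|%:R / M) * p (#|Q|%:R / M)) ^+ 2)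
      + 3 * ((2 ^+ 2 + lip ^+ 2) * theta ^+ 2)) t)).
    apply: expect_le => f _; set Q := reads C f t.
    have L0Q : (L0 <= left_over Q)%N.
      apply: left_over_reads => //.
      by rewrite -[leqRHS](subnK spM) leq_add2l spent_mono // ltnW.
    have LQ : delta * M <= (left_over Q)%:R by apply: le_trans L0r _; rewrite ler_nat.
    have LQ0 : 0 < (left_over Q)%:R :> R by apply: lt_le_trans LQ; rewrite mulr_gt0.
    have MQ : M = #|Q|%:R + (left_over Q)%:R by rewrite -natrD left_overE.
    have rE : 1 - #|Q|%:R / M = (left_over Q)%:R / M.
      apply: (mulIf (lt0r_neq0 M0)); rewrite mulrBl mul1r !mulfVK ?lt0r_neq0 //.
      by rewrite {1}MQ [X in X - _]addrC addrK.
    rewrite open_countE rE; set X := statistic _ Q; set rho := #|Q|%:R / M.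
    set L := (left_over Q)%:R in LQ LQ0 *; set e1 := X / N%:R - _.
    (* Three errors: the statistic of open half-edges against its limit, the true number of
       half-edges against n, and the argument of [p]. *)
    have -> : X / L - p (#|Q|%:R / n) = N%:R / L * e1 + ((n / M - 1) * p rho
        + (p rho - p (#|Q|%:R / n))).
      by rewrite /e1 /n; field; rewrite !gt_eqF.
    have sq3 (x y z : R) : (x + (y + z)) ^+ 2 <= 3 * x ^+ 2 + 3 * (y ^+ 2 + z ^+ 2).
      have := sqr_ge0 (x - y); have := sqr_ge0 (x - z); have := sqr_ge0 (y - z); nra.
    apply: (le_trans (sq3 _ _ _)); apply: lerD; rewrite ler_pM2l //.
      rewrite exprMn ler_wpM2r ?sqr_ge0 //; apply: sqr_le_norm.
      rewrite ger0_norm ?divr_ge0 // ?(ltW LQ0) // ler_pdivrMr //.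
      have -> : K / delta * L = K * (L / delta) by rewrite mulrAC mulrA.
      apply: (le_trans NM); rewrite ler_wpM2l // ler_pdivlMr // mulrC //.
    have /andP[p0 p1] := p01 rho; rewrite [leRHS]mulrDl; apply: lerD.
      rewrite -exprMn; apply: sqr_le_norm; rewrite normrM (ger0_norm p0).
      rewrite -[leRHS]mulr1 ler_pM //.
      have -> : n / M - 1 = (1 - M / n) * (n / M) by field; rewrite !gt_eqF.
      rewrite normrM distrC (ger0_norm (x := n / M)) ?divr_ge0 ?(ltW n0) ?(ltW M0) //.
      rewrite mulrC ler_pM ?divr_ge0 ?(ltW n0) ?(ltW M0) //.
      by rewrite ler_pdivrMr //; lra.
    rewrite -exprMn; apply: sqr_le_norm; apply: (le_trans (p_lip _ _)).
    by rewrite ler_wpM2l // rhoQ.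
  rewrite expectD.
  have -> : quenched_const1 * theta ^+ 2 = 3 * ((K / delta) ^+ 2 * ((1 + 2 * 2 ^+ 2) * theta ^+ 2))
     + 3 * ((2 ^+ 2 + lip ^+ 2) * theta ^+ 2) by rewrite /quenched_const1 /K; ring.
  apply: lerD.
    by rewrite expectZ expectZ ler_wpM2l // ler_wpM2l ?sqr_ge0 ?llna' // ltnW.
  by apply: (@expect_cst_le R N T C d); rewrite !(sqr_ge0, addr_ge0, mulr_ge0).
have L0k : (L0 + spent d k <= #|{: halfU d}|)%N by rewrite subnK.
have dev := @reads_deviation R N T C d p lip n g L0 k _ p01 p_lip lip_ge0 n0 eta0 L00 kT
  L0k g0 gS err.
have n_inv : n^-1 <= theta ^+ 2.
  move: XN4; rewrite /X4 ler_pdivrMr ?mulr_gt0 ?exprn_gt0 // => h.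
  rewrite -[n^-1]mul1r ler_pdivrMr //; apply: (le_trans h).
  by rewrite le_eqVlt; apply/orP; left; apply/eqP; rewrite /n; ring.
have L0_inv : (L0%:R ^+ 2)^-1 <= theta ^+ 2 :> R.
  move: XN3; rewrite /X3 ler_pdivrMr ?mulr_gt0 // => h.
  have h1 : 1 <= L0%:R * theta.
    apply: (@le_trans _ _ (delta * (n / 2) * theta)); first by rewrite /n; lra.
    by rewrite ler_pM2r // (le_trans _ L0r) // ler_pM2l.
  rewrite -[leLHS]mul1r ler_pdivrMr ?exprn_gt0 // -exprMn mulrC -[leLHS](expr1n _ 2).
  by apply: sqr_le_norm; rewrite normr1.
set c2 := expR ((2 + 2 * lip) * K3 / mu) * (K3 / mu) * (1 + 1 + quenched_const1).
have dev2 : expect C (fun Q : {set halfU d} => (#|Q|%:R - n * g k) ^+ 2) k / n ^+ 2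
   <= c2 * theta ^+ 2.
  have sum3 : 0 <= \sum_(t < T) (d.2 t)%:R ^+ 3 :> R.
    by apply: sumr_ge0 => t _; rewrite exprn_ge0.
  have NE : K3 * N%:R = K3 / mu * n by rewrite /n; field; rewrite gt_eqF.
  rewrite ler_pdivrMr ?exprn_gt0 //; apply: (le_trans dev); rewrite -mulr_suml.
  set B := n / L0%:R ^+ 2 + 1 + _.
  have n0' := ltW n0.
  have B0 : 0 <= B.
    rewrite /B addr_ge0 // ?addr_ge0 // ?divr_ge0 ?sqr_ge0 //.
    exact: (mulr_ge0 n0' eta0).
  have BB : B <= n * ((1 + 1 + quenched_const1) * theta ^+ 2).
    have -> : B = n * ((L0%:R ^+ 2)^-1 + n^-1 + quenched_const1 * theta ^+ 2).
      by rewrite /B; field; rewrite !gt_eqF.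
    by rewrite ler_wpM2l ?(ltW n0) // !mulrDl !mul1r lerD2r lerD.
  have e3 : expR ((2 + 2 * lip) / n * \sum_(t < T) (d.2 t)%:R ^+ 3)
      <= expR ((2 + 2 * lip) * K3 / mu).
    rewrite ler_expR mulrAC ler_pdivrMr // -!mulrA ler_wpM2l ?addr_ge0 ?mulr_ge0 //.
    by rewrite (le_trans deg3) // NE mulrA.
  have -> : c2 * theta ^+ 2 * n ^+ 2 = expR ((2 + 2 * lip) * K3 / mu) *
     ((K3 * N%:R) * (n * ((1 + 1 + quenched_const1) * theta ^+ 2))).
    by rewrite NE /c2; ring.
  by apply: ler_pM; rewrite ?expR_ge0 ?mulr_ge0 // ler_pM.
have Phi_split (f : pairing d) : let Q := reads C f k in
  ((\sum_i loads C Q i)%:R / N%:R - Phi (g k)) ^+ 2 <=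
  2 * (statistic (capped_load R C) Q / N%:R - Phi (#|Q|%:R / M)) ^+ 2
  + (2 * lip ^+ 2 * (2 * (n ^+ 2)^-1) * (#|Q|%:R - n * g k) ^+ 2
  + 2 * lip ^+ 2 * (2 * theta ^+ 2)).
  move=> Q; rewrite sum_loadsE; set X := statistic _ Q; set rho := #|Q|%:R / M.
  have -> : X / N%:R - Phi (g k) = (X / N%:R - Phi rho) + (Phi rho - Phi (g k)) by ring.
  apply: (le_trans (sqrD_le _ _)); rewrite lerD2l.
  have -> : 2 * lip ^+ 2 * (2 * (n ^+ 2)^-1) * (#|Q|%:R - n * g k) ^+ 2
     + 2 * lip ^+ 2 * (2 * theta ^+ 2)
    = 2 * (lip ^+ 2 * (2 * theta ^+ 2 + 2 * (#|Q|%:R / n - g k) ^+ 2)).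
    by field; rewrite gt_eqF.
  rewrite ler_pM2l //; apply: (@le_trans _ _ (lip ^+ 2 * (rho - g k) ^+ 2)).
    have -> : lip ^+ 2 * (rho - g k) ^+ 2 = (lip * `|rho - g k|) ^+ 2.
      by rewrite exprMn real_normK ?num_real.
    exact/sqr_le_norm/Phi_lip.
  rewrite ler_wpM2l ?sqr_ge0 //.
  have -> : rho - g k = (rho - #|Q|%:R / n) + (#|Q|%:R / n - g k) by ring.
  apply: (le_trans (sqrD_le _ _)); rewrite lerD2r ler_pM2l //.
  by apply: sqr_le_norm; apply: rhoQ.
apply: (@le_trans _ _ (expect C (fun Q : {set halfU d} =>
  2 * (statistic (capped_load R C) Q / N%:R - Phi (#|Q|%:R / M)) ^+ 2
  + (2 * lip ^+ 2 * (2 * (n ^+ 2)^-1) * (#|Q|%:R - n * g k) ^+ 2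
  + 2 * lip ^+ 2 * (2 * theta ^+ 2))) k)).
  by apply: expect_le => f _; apply: Phi_split.
rewrite expectD expectD.
have -> : quenched_const * theta ^+ 2 = 2 * ((1 + 2 * 2 ^+ 2) * theta ^+ 2)
  + (2 * lip ^+ 2 * 2 * (c2 * theta ^+ 2) + 2 * lip ^+ 2 * (2 * theta ^+ 2)).
  by rewrite /quenched_const -/c2; ring.
apply: lerD; first by rewrite expectZ ler_pM2l.
apply: lerD; last first.
  by apply: (@expect_cst_le R N T C d); rewrite !(sqr_ge0, addr_ge0, mulr_ge0).
rewrite expectZ; set E := expect _ _ _ in dev2 *.
have -> : 2 * lip ^+ 2 * (2 / n ^+ 2) * E = 2 * lip ^+ 2 * 2 * (E / n ^+ 2) by ring.
by rewrite ler_wpM2l // !(sqr_ge0, mulr_ge0).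
Qed.

End Quenched_limit.

(** * Independent degrees *)

Section Iid_sampling.
Variables (R : realType) (A : finType) (T : nat) (w : A -> R).
Hypothesis w_ge0 : forall a, 0 <= w a.
Hypothesis w_sum : \sum_a w a = 1.
Implicit Types (c : {ffun 'I_T -> A}) (H : {ffun 'I_T -> A} -> R).

Definition iid_mean H : R := Ew (fun c t => w (c t)) H.

Lemma iid_adapted c (t s : 'I_T) e : (t < s)%N -> w (upd c s e t) = w (c t).
Proof. by move=> ts; rewrite upd_diff //; apply: contraTneq ts => ->; rewrite ltnn. Qed.

Lemma iid_total c (t : 'I_T) : \sum_e w (upd c t e t) = 1.
Proof. by under eq_bigr do rewrite upd_same. Qed.

Lemma iid_card : (0 < #|A|)%N.
Proof.
have [A0|//] := posnP #|A|; move: w_sum; rewrite big_pred0 => [/esym/eqP|a].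
  by rewrite oner_eq0.
by have := card0_eq A0 a; rewrite inE.
Qed.

Lemma iid_step (t : 'I_T) H :
  (forall c (s : 'I_T) e, (t < s)%N -> H (upd c s e) = H c) ->
  iid_mean H = iid_mean (fun c => \sum_e w e * H (upd c t e)).
Proof.
move=> HH; rewrite /iid_mean (Ew_step iid_adapted iid_total HH).
by apply: eq_bigr => c _; congr (_ * _); apply: eq_bigr => e _; rewrite upd_same.
Qed.

Lemma iid_le H1 H2 : (forall c, H1 c <= H2 c) -> iid_mean H1 <= iid_mean H2.
Proof. by move=> H12; apply: Ew_le => // c t. Qed.

Lemma iid_D H1 H2 : iid_mean (fun c => H1 c + H2 c) = iid_mean H1 + iid_mean H2.
Proof. exact: EwD. Qed.

Lemma iid_Z a H : iid_mean (fun c => a * H c) = a * iid_mean H.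
Proof. exact: EwZ. Qed.

Lemma iid_const a : iid_mean (fun=> a) = a.
Proof. exact: (Ew_const iid_adapted iid_total a iid_card). Qed.

Lemma iid_sum (I : finType) (P : pred I) (F : I -> {ffun 'I_T -> A} -> R) :
  iid_mean (fun c => \sum_(i | P i) F i c) = \sum_(i | P i) iid_mean (F i).
Proof.
by rewrite /iid_mean /Ew exchange_big; apply: eq_bigr => c _; rewrite mulr_sumr.
Qed.

Lemma iid_coord (psi : A -> R) (t : 'I_T) :
  iid_mean (fun c => psi (c t)) = \sum_a w a * psi a.
Proof.
rewrite (@iid_step t) => [|c s e ts]; last first.
  by rewrite upd_diff //; apply: contraTneq ts => ->; rewrite ltnn.
rewrite -[RHS]iid_const; apply: eq_bigr => c _; congr (_ * _).
by apply: eq_bigr => e _; rewrite upd_same.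
Qed.

Definition psum (psi : A -> R) (k : nat) c : R := \sum_(t < T | (t < k)%N) psi (c t).

Lemma psumS psi (t : 'I_T) c : psum psi t.+1 c = psum psi t c + psi (c t).
Proof.
rewrite /psum (bigD1 t) ?ltnSn //= addrC; congr (_ + _).
by apply: eq_bigl => s; rewrite ltnS -val_eqE /= ltn_neqAle andbC.
Qed.

Lemma psum_upd psi (k : nat) c (s : 'I_T) e : (k <= s)%N -> psum psi k (upd c s e) = psum psi k c.
Proof.
move=> ks; apply: eq_bigr => t tk; rewrite upd_diff //.
by apply: contraTneq tk => ->; rewrite -leqNgt.
Qed.

Lemma iid_psum psi k : (k <= T)%N ->
  iid_mean (psum psi k) = k%:R * \sum_a w a * psi a.
Proof.
elim: k => [|k IH] kT.
  rewrite mul0r -[RHS](iid_const 0); apply: eq_bigr => c _; congr (_ * _).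
  by rewrite /psum big_pred0.
pose t := Ordinal kT.
transitivity (iid_mean (fun c => psum psi k c + psi (c t))).
  by apply: eq_bigr => c _; congr (_ * _); rewrite -[k]/(nat_of_ord t) psumS.
by rewrite iid_D IH 1?ltnW // iid_coord -natr1 mulrDl mul1r.
Qed.

(** No centring is assumed because truncation biases the mean: the linear term is the variance part
    and the quadratic one the squared bias. *)
Lemma iid_psum_sq psi k : (k <= T)%N ->
  iid_mean (fun c => psum psi k c ^+ 2)
  <= k%:R * (\sum_a w a * psi a ^+ 2) + k%:R ^+ 2 * (\sum_a w a * psi a) ^+ 2.
Proof.
set v := \sum_a w a * psi a ^+ 2; set m := \sum_a w a * psi a.
elim: k => [|k IH] kT.
  rewrite mul0r expr0n mul0r addr0 -[leRHS](iid_const 0); apply: iid_le => c.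
  by rewrite /psum big_pred0 // expr0n.
pose t := Ordinal kT.
have -> : iid_mean (fun c => psum psi k.+1 c ^+ 2)
   = iid_mean (fun c => psum psi k c ^+ 2 + (2 * m * psum psi k c + v)).
  rewrite (@iid_step t) => [|c s e ts]; last by rewrite psum_upd.
  apply: eq_bigr => c _; congr (_ * _).
  rewrite (eq_bigr (fun e => w e * psum psi k c ^+ 2
     + (2 * psum psi k c * (w e * psi e) + w e * psi e ^+ 2))) => [|e _].
    rewrite big_split big_split /= -mulr_suml w_sum mul1r -mulr_sumr -/m -/v; ring.
  rewrite -[k]/(nat_of_ord t) psumS psum_upd // upd_same; ring.
rewrite iid_D iid_D iid_Z iid_const iid_psum 1?ltnW // -/m.
have := IH (ltnW kT); rewrite -natr1 => {}IH.
have := sqr_ge0 m; nra.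
Qed.

End Iid_sampling.

(** * Averaging the reference path over the degrees *)

Section Annealed_recursion.
Variables (R : realType) (B T : nat) (w : 'I_B -> R).
Hypothesis w_ge0 : forall a, 0 <= w a.
Hypothesis w_sum : \sum_a w a = 1.
Variables (n : R) (p : R -> R) (q : R -> R) (gamma : nat -> R) (Lq rho kappa c0 m2 : R).
Hypothesis n_gt0 : 0 < n.
Hypothesis p01 : forall x, 0 <= p x <= 1.

(* Approximation of #|Q| / n given the degrees [c]: only the reads are averaged. *)
Fixpoint mean_path (c : {ffun 'I_T -> 'I_B}) (t : nat) : R :=
  if t is s.+1 then
    mean_path c s + (if insub s is Some i then mean_reads (c i) (p (mean_path c s)) else 0) / n
  else 0.

Lemma mean_pathS c (t : 'I_T) :
  mean_path c t.+1 = mean_path c t + mean_reads (c t) (p (mean_path c t)) / n.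
Proof. by rewrite /= valK. Qed.

Lemma mean_path_upd c (k : nat) (s : 'I_T) e : (k <= s)%N ->
  mean_path (upd c s e) k = mean_path c k.
Proof.
elim: k => [|k IH] // ks /=; rewrite IH 1?ltnW //; case: insubP => // i _ ik.
by rewrite upd_diff //; apply: contraTneq ks => <-; rewrite ik ltnn.
Qed.

Hypothesis q_approx : forall x, `|\sum_a w a * mean_reads a (p x) - q x| <= rho.
Hypothesis q_lip : forall x y, `|q x - q y| <= Lq * `|x - y|.
Hypothesis gamma0 : gamma 0%N = 0.
Hypothesis gamma_step : forall t, (t < T)%N ->
  `|n * (gamma t.+1 - gamma t) - q (gamma t)| <= kappa.
Hypothesis q_bound : forall x, `|q x| <= c0.
Hypothesis second_moment : \sum_a w a * (a : nat)%:R ^+ 2 <= m2.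
Hypothesis Lq_ge0 : 0 <= Lq.

Lemma mean_path_deviation k : (k <= T)%N ->
  iid_mean w (fun c => (mean_path c k - gamma k) ^+ 2)
  <= expR (T%:R * ((2 * Lq + 1) / n))
     * (T%:R * ((rho + kappa) ^+ 2 / n + (2 * m2 + 2 * (c0 + kappa) ^+ 2) / n ^+ 2)).
Proof.
move=> kT.
have c00 : 0 <= c0 by apply: le_trans (q_bound 0).
have m20 : 0 <= m2.
  by apply: le_trans second_moment; apply: sumr_ge0 => a _; rewrite mulr_ge0 // exprn_ge0.
pose W : R := (2 * Lq + 1) / n.
pose V : R := (rho + kappa) ^+ 2 / n + (2 * m2 + 2 * (c0 + kappa) ^+ 2) / n ^+ 2.
have W0 : 0 <= W by rewrite divr_ge0 ?addr_ge0 ?mulr_ge0 // ltW.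
have V0 : 0 <= V.
  rewrite addr_ge0 // divr_ge0 ?sqr_ge0 ?(ltW n_gt0) //.
  by rewrite addr_ge0 // mulr_ge0 // sqr_ge0.
have := @discrete_gronwall R (fun t => iid_mean w (fun c => (mean_path c t - gamma t) ^+ 2))
  (fun=> W) (fun=> V) k.
move=> /(_ _ _ _ _)/le_trans; apply => //.
- rewrite -(iid_const T w_sum 0); apply: iid_le => // c.
  by rewrite /= gamma0 subrr expr0n.
- move=> t tk; have tT : (t < T)%N by apply: leq_trans kT.
  pose s := Ordinal tT.
  rewrite (@iid_step _ _ _ _ w_sum s) => [|c r e sr]; last by rewrite mean_path_upd.
  rewrite -(iid_const T w_sum V) -iid_Z -iid_D; apply: iid_le => // c.
  set x := mean_path c t; set z := x - gamma t.
  pose D := n * (gamma t.+1 - gamma t).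
  have -> : \sum_e w e * (mean_path (upd c s e) t.+1 - gamma t.+1) ^+ 2
     = \sum_e (w e * (z ^+ 2 - 2 * z * D / n) + (2 * z / n * (w e * mean_reads e (p x))
        + w e * (mean_reads e (p x) - D) ^+ 2 / n ^+ 2)).
    apply: eq_bigr => e _; rewrite -[t]/(nat_of_ord s) mean_pathS mean_path_upd // upd_same.
    by rewrite /z /D -/x; field; rewrite gt_eqF.
  rewrite big_split big_split /= -!mulr_suml w_sum mul1r -mulr_sumr.
  set E := \sum_e w e * mean_reads e (p x).
  have dE : `|E - D| <= rho + (Lq * `|z| + kappa).
    have -> : E - D = (E - q x) + ((q x - q (gamma t)) + (q (gamma t) - D)) by ring.
    apply: (le_trans (ler_normD _ _)); apply: lerD; first exact: q_approx.
    apply: (le_trans (ler_normD _ _)); apply: lerD; first exact: q_lip.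
    by rewrite distrC; apply: gamma_step.
  have D2 : D ^+ 2 <= (c0 + kappa) ^+ 2.
    apply: sqr_le_norm; have -> : D = q (gamma t) + (D - q (gamma t)) by ring.
    apply: (le_trans (ler_normD _ _)); apply: lerD; [exact: q_bound|exact: gamma_step].
  have var : \sum_e w e * (mean_reads e (p x) - D) ^+ 2 <= 2 * m2 + 2 * (c0 + kappa) ^+ 2.
    apply: (@le_trans _ _ (\sum_e (2 * (w e * (e : nat)%:R ^+ 2) + w e * (2 * (c0 + kappa) ^+ 2)))).
      apply: ler_sum => e _; set Y := 2 * (c0 + kappa) ^+ 2.
      have -> : 2 * (w e * (e : nat)%:R ^+ 2) + w e * Y = w e * (2 * (e : nat)%:R ^+ 2 + Y) by ring.
      rewrite ler_wpM2l // /Y.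
      have := sqrD_le (mean_reads e (p x)) (- D); rewrite sqrrN => /le_trans; apply.
      apply: lerD; rewrite ler_pM2l //.
      have /andP[r0 r1] := mean_reads_bound e (p01 x).
      by apply: sqr_le_norm; rewrite ger0_norm.
    by rewrite big_split /= -mulr_sumr -mulr_suml w_sum mul1r lerD2r ler_pM2l.
  have cross : 2 * z * (E - D) <= (2 * Lq + 1) * z ^+ 2 + (rho + kappa) ^+ 2.
    have zz : z ^+ 2 = `|z| ^+ 2 by rewrite real_normK ?num_real.
    apply: (@le_trans _ _ (2 * (`|z| * (rho + (Lq * `|z| + kappa))))).
      rewrite -mulrA ler_pM2l //; apply: (le_trans (ler_norm _)); rewrite normrM.
      by rewrite ler_wpM2l.
    rewrite zz; have := normr_ge0 z; have := sqr_ge0 (`|z| - (rho + kappa)).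
    by set a := `|z|; nra.
  have ninv : 0 < n^-1 by rewrite invr_gt0.
  apply: (@le_trans _ _ (z ^+ 2 + ((2 * Lq + 1) * z ^+ 2 + (rho + kappa) ^+ 2) / n
     + (2 * m2 + 2 * (c0 + kappa) ^+ 2) / n ^+ 2)).
    have -> : z ^+ 2 - 2 * z * D / n + (2 * z / n * E
       + (\sum_e w e * (mean_reads e (p x) - D) ^+ 2) / n ^+ 2)
     = z ^+ 2 + (2 * z * (E - D)) / n + (\sum_e w e * (mean_reads e (p x) - D) ^+ 2) / n ^+ 2.
      by ring.
    apply: lerD; last by rewrite ler_pM2r // invr_gt0 exprn_gt0.
    by rewrite lerD2l ler_pM2r.
  by rewrite /W /V le_eqVlt; apply/orP; left; apply/eqP; ring.
have kT' : k%:R <= T%:R :> R by rewrite ler_nat.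
have cst (x : R) : 0 <= x -> \sum_(t < k) x <= T%:R * x.
  by move=> x0; rewrite sumr_const card_ord -[leLHS]mulr_natl ler_wpM2r.
by apply: ler_pM; rewrite ?expR_ge0 ?sumr_ge0 ?ler_expR ?cst.
Qed.

End Annealed_recursion.

From mathcomp Require Import all_classical all_reals all_analysis.
Import numFieldNormedType.Exports.
Local Open Scope classical_set_scope.
Local Open Scope ring_scope.

(** * Generating functions of sub-Gaussian laws *)

Section Distribution_on_nat.
Variables (R : realType) (pi : probability nat R).

Lemma mass_ge0 k : 0 <= mass pi k.
Proof. by rewrite fine_ge0. Qed.

Lemma massE k : ((mass pi k)%:E = pi [set k])%E.
Proof. by rewrite /mass fineK // fin_num_measure. Qed.

Lemma integral_nat (f : nat -> R) : (forall k, 0 <= f k) ->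
  (\int[pi]_x (f x)%:E = \sum_(k <oo) (mass pi k * f k)%:E)%E.
Proof.
move=> f0; have UT : [set: nat] = \bigcup_k [set k].
  by apply/seteqP; split => // k _; exists k.
rewrite UT ge0_integral_bigcup //=.
- apply: eq_eseriesr => k _; rewrite mulrC EFinM massE -integral_cst //.
  by apply: eq_integral => x; rewrite inE => ->.
- by move=> x _; rewrite lee_fin.
- by apply/trivIsetP => i j _ _ ij; apply/seteqP; split => // x [-> /= ji];
    rewrite ji eqxx in ij.
Qed.

Lemma sums_of_integral (f : nat -> R) (l : R) : (forall k, 0 <= f k) ->
  (\int[pi]_x (f x)%:E = l%:E)%E ->
  series (fun k => mass pi k * f k) @ \oo --> l.
Proof.
move=> f0; rewrite integral_nat // => sE.
have u0 k : 0 <= mass pi k * f k by rewrite mulr_ge0 ?mass_ge0.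
have cv : cvgn (series (fun k => mass pi k * f k)).
  by apply: nnseries_is_cvg => //; rewrite sE ltry.
suff -> : l = limn (series (fun k => mass pi k * f k)) by [].
apply: EFin_inj; rewrite -sE -EFin_lim //; congr (limn _).
by apply/funext => n /=; rewrite sumEFin.
Qed.

Lemma sums_mass : series (mass pi) @ \oo --> (1 : R).
Proof.
have -> : mass pi = (fun k => mass pi k * 1) by apply/funext => k; rewrite mulr1.
apply: sums_of_integral => //.
transitivity (1 * pi [set: nat])%E; first exact: (@integral_cst _ _ _ pi setT measurableT).
by have -> : pi [set: nat] = 1%E; [exact: probability_setT|rewrite mule1].
Qed.

Hypothesis subg : sub_gaussian pi.

(** The sub-Gaussian bound is used at the logarithm of r + 1, the shift making the base positive
    even for r = 0. Here [mean pi] is just a number pulled out as a factor; that the expectation is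
    finite follows later from this lemma. *)
Lemma exp_moment (r : R) : 0 <= r -> cvgn (series (fun k => mass pi k * r ^+ k)).
Proof.
move=> r0; pose r' := r + 1; have r'0 : 0 < r' by rewrite ltr_wpDl.
have [lambda el] := expR_total r'0.
suff cv : cvgn (series (fun k => mass pi k * r' ^+ k)).
  apply: (series_le_cvg _ _ _ cv) => k; rewrite ?mulr_ge0 ?mass_ge0 ?exprn_ge0 ?(ltW r'0) //.
  rewrite ler_wpM2l ?mass_ge0 // lerXn2r ?nnegrE ?(ltW r'0) // /r' lerDl //.
have [sigma /(_ lambda)] := subg; rewrite /mmt_gen_fun unlock => fin.
pose f k := expR ((k%:R - mean pi) * lambda).
have f0 k : 0 <= f k by exact: expR_ge0.
have sf : cvgn (series (fun k => mass pi k * f k)).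
  apply: nnseries_is_cvg => [k|]; first by rewrite mulr_ge0 ?mass_ge0.
  rewrite -integral_nat //; apply: le_lt_trans (ltry _); exact: fin.
have -> : (fun k => mass pi k * r' ^+ k)
    = expR (mean pi * lambda) *: (fun k => mass pi k * f k).
  apply/funext => k; rewrite /f /= -[RHS]/(_ * _) mulrBl expRB mulrA [_ * (_ / _)]mulrC.
  rewrite -el expRM_natl; field; exact: lt0r_neq0 (expR_gt0 _).
exact: is_cvg_seriesZ.
Qed.

Lemma exp_dominated_cvg (psi : nat -> R) (c r : R) :
  0 <= c -> 0 <= r -> (forall k, `|psi k| <= c * r ^+ k) ->
  cvgn (series (fun k => mass pi k * psi k)).
Proof.
move=> c0 r0 dom; apply: normed_cvg.
apply: (@series_le_cvg _ _ (fun k => c * (mass pi k * r ^+ k))) => [k|k|k|].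
- exact: normr_ge0.
- by rewrite !mulr_ge0 ?mass_ge0 ?exprn_ge0.
- by rewrite /= normrM ger0_norm ?mass_ge0 // mulrCA ler_wpM2l ?mass_ge0.
- have -> : (fun k => c * (mass pi k * r ^+ k)) = c *: (fun k => mass pi k * r ^+ k) by [].
  exact/is_cvg_seriesZ/exp_moment.
Qed.

Lemma natr_le_exp2 k : k%:R <= 2 ^+ k :> R.
Proof. by rewrite -natrX ler_nat ltnW // ltn_expl. Qed.

Lemma poly_moment (j : nat) : cvgn (series (fun k => mass pi k * k%:R ^+ j)).
Proof.
apply: (@exp_dominated_cvg _ 1 (2 ^+ j)) => // k.
by rewrite mul1r ger0_norm ?exprn_ge0 // exprAC lerXn2r ?nnegrE ?exprn_ge0 // natr_le_exp2.
Qed.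

Lemma sums_mean : series (fun k => mass pi k * k%:R) @ \oo --> mean pi.
Proof.
apply: sums_of_integral => //; rewrite /mean unlock fineK //.
have cv := @poly_moment 1.
rewrite integral_nat // ge0_fin_numE; last first.
  by apply: nneseries_ge0 => k _ _; rewrite lee_fin mulr_ge0 ?mass_ge0.
have -> : (\sum_(k <oo) (mass pi k * k%:R)%:E)%E
    = (limn (series (fun k => mass pi k * k%:R ^+ 1)))%:E.
  rewrite -EFin_lim //; congr (limn _); apply/funext => n /=.
  by rewrite sumEFin; congr EFin; apply: eq_bigr => k _; rewrite expr1.
exact: ltry.
Qed.

End Distribution_on_nat.

(** * Everywhere convergent series with nonnegative coefficients *)

Section Entire_series.
Variable R : realType.

Definition entire (c : nat -> R) : Prop :=
  (forall k, 0 <= c k) /\ forall r : R, 0 <= r -> cvgn (series (fun k => c k * r ^+ k)).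

Lemma entire_pseries c (x : R) : entire c -> cvgn (pseries c x).
Proof.
move=> [c0 ec]; have xx : `|x| < `|(`|x| + 1)| by rewrite [ltRHS]ger0_norm ?addr_ge0 // ltrDl.
by apply: is_cvg_pseries_inside xx; apply: ec; rewrite addr_ge0.
Qed.

(** The factor k + 1 is absorbed by 2^(k + 1): the differentiated series at r is dominated by the
    original one at 2 (r + 1). *)
Lemma entire_diffs c : entire c -> entire (pseries_diffs c).
Proof.
move=> [c0 ec]; have d0 k : 0 <= pseries_diffs c k by rewrite mulr_ge0.
split => // r r0; pose s := r + 1; have s1 : 1 <= s by rewrite lerDr.
have s0 : 0 <= s by exact: le_trans s1.
have cv : cvgn (series (fun k => c k.+1 * (2 * s) ^+ k.+1)).
  have /cvg_ex[/= l cl] : cvgn (series (fun k => c k * (2 * s) ^+ k)).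
    by apply: ec; rewrite mulr_ge0.
  apply/cvg_ex; exists (l - c 0%N).
  have -> : series (fun k => c k.+1 * (2 * s) ^+ k.+1)
    = (fun n => series (fun k => c k * (2 * s) ^+ k) n.+1 - c 0%N).
    apply/funext => n; rewrite /series /= big_nat_recl // expr0 mulr1.
    by rewrite addrC addKr.
  by apply: cvgB; [move: cl; rewrite -cvg_shiftS|exact: cvg_cst].
apply: series_le_cvg cv => k; rewrite ?mulr_ge0 ?exprn_ge0 ?mulr_ge0 //.
rewrite /pseries_diffs mulrAC mulrC ler_wpM2l // exprMn.
apply: ler_pM; rewrite ?exprn_ge0 //.
  by rewrite -natrX ler_nat ltnW // ltn_expl.
apply: (@le_trans _ _ (s ^+ k)); first by rewrite lerXn2r ?nnegrE // lerDl.
by rewrite ler_weXn2l.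
Qed.

Lemma entire_iter c j : entire c -> entire (iter j (@pseries_diffs R) c).
Proof. by move=> ec; elim: j => //= j; apply: entire_diffs. Qed.

Lemma iter_diffsE c j i :
  iter j (@pseries_diffs R) c i = ((i + j) ^_ j)%:R * c (i + j)%N.
Proof.
elim: j i => [|j IH] i; first by rewrite addn0 ffactn0 mul1r.
rewrite iterS /pseries_diffs IH mulrA -natrM addSnnS; congr (_%:R * _).
by rewrite ffactnSr addnS subSn ?leq_addl // addnK mulnC.
Qed.

Lemma pseries_is_derive c (x : R) : entire c ->
  is_derive x 1 (fun x => limn (pseries c x)) (limn (pseries (pseries_diffs c) x)).
Proof.
move=> ec; apply: (@pseries_snd_diffs _ c (`|x| + 1)).
- exact: entire_pseries.
- exact/entire_pseries/entire_diffs.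
- exact/entire_pseries/entire_diffs/entire_diffs.
- by rewrite [ltRHS]ger0_norm ?addr_ge0 // ltrDl.
Qed.

Variable c : nat -> R.
Hypothesis ec : entire c.

Definition gen_derive (j : nat) (x : R) : R := limn (pseries (iter j (@pseries_diffs R) c) x).

Lemma gen_derive_is_derive (j : nat) (x : R) : is_derive x (1 : R) (gen_derive j) (gen_derive j.+1 x).
Proof. exact/pseries_is_derive/entire_iter. Qed.

Lemma derive1n_gen j : derive1n j (gen_derive 0) = gen_derive j.
Proof.
elim: j => [|j IH] //; rewrite derive1nS IH; apply/funext => x.
by rewrite derive1E; have [_ ->] := gen_derive_is_derive j x.
Qed.

Lemma gen_derive_continuous j : continuous (gen_derive j).
Proof.
move=> x; apply/differentiable_continuous/derivable1_diffP.
by have [] := gen_derive_is_derive j x.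
Qed.

(** Indexing by the degree [m] lets derivatives of different orders be added term by term; the
    falling factorial kills the terms [m < j], where the exponent is truncated. *)
Lemma gen_derive_sums j x :
  series (fun m => c m * (m ^_ j)%:R * x ^+ (m - j)) @ \oo --> gen_derive j x.
Proof.
set F := fun m => _; rewrite -(cvg_shiftn j).
have -> : [sequence series F (n + j)%N]_n = pseries (iter j (@pseries_diffs R) c) x.
  apply/funext => n; rewrite /= /pseries /series /=.
  rewrite (@big_cat_nat _ _ _ j) ?leq_addl //= big_nat_cond big1 => [|m /andP[/andP[_ mj] _]].
    rewrite add0r -{1}[j]add0n big_addn addnK; apply: eq_bigr => m _.
    by rewrite /F iter_diffsE addnK [c _ * _]mulrC.
  by rewrite /F ffact_small // mulr0 mul0r.
exact/entire_pseries/entire_iter.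
Qed.

End Entire_series.

Section Sums.
Variable R : realType.
Implicit Types (f g : nat -> R) (l a b tau : R).

Lemma sumsD f g a b : series f @ \oo --> a -> series g @ \oo --> b ->
  series (fun k => f k + g k) @ \oo --> a + b.
Proof. by move=> fa gb; rewrite (seriesD f g); apply: cvgD. Qed.

Lemma sumsZ f a l : series f @ \oo --> l -> series (fun k => a * f k) @ \oo --> a * l.
Proof.
move=> fl; rewrite (_ : (fun k => a * f k) = a *: f) // seriesZ.
exact: (@cvgZr _ _ _ _ _ a _ _ fl).
Qed.

Lemma sums_lin (n : nat) (a : 'I_n -> R) (f : 'I_n -> nat -> R) (l : 'I_n -> R) :
  (forall i, series (f i) @ \oo --> l i) ->
  series (fun m => \sum_i a i * f i m) @ \oo --> \sum_i a i * l i.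
Proof.
elim: n a f l => [|n IH] a f l fl.
  rewrite big_ord0 (_ : (fun _ => _) = (fun=> 0)); last by apply/funext => m; rewrite big_ord0.
  rewrite (_ : series _ = fun=> 0); first exact: cvg_cst.
  by apply/funext => k; rewrite /series /= big1.
rewrite big_ord_recl (_ : (fun _ => _) = (fun m => a ord0 * f ord0 m
  + \sum_(i < n) a (lift ord0 i) * f (lift ord0 i) m)).
  apply: sumsD; first exact: sumsZ.
  exact: (IH (fun i => a (lift ord0 i)) (fun i => f (lift ord0 i)) (fun i => l (lift ord0 i))).
by apply/funext => m; rewrite big_ord_recl.
Qed.

Lemma sums_le f g a b : (forall k, f k <= g k) ->
  series f @ \oo --> a -> series g @ \oo --> b -> a <= b.
Proof.
move=> fg fa gb; rewrite -(cvg_lim _ fa) // -(cvg_lim _ gb) //.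
by apply: lim_series_le => //; [apply/cvg_ex; exists a|apply/cvg_ex; exists b].
Qed.

Lemma sums_ge_part f l n : (forall k, 0 <= f k) -> series f @ \oo --> l ->
  \sum_(k < n) f k <= l.
Proof.
move=> f0 fl; rewrite -(cvg_lim _ fl) // -(big_mkord predT).
apply: (nondecreasing_cvgn_le _ (u_ := series f)).
  by apply: nondecreasing_series.
by apply/cvg_ex; exists l.
Qed.

Lemma sums_restrict f l n : series f @ \oo --> l ->
  series (fun k => if (k < n)%N then 0 else f k) @ \oo --> l - \sum_(k < n) f k.
Proof.
move=> fl; pose h k := if (k < n)%N then - f k else 0.
have hs : series h @ \oo --> - \sum_(k < n) f k.
  apply: (@cvg_trans _ ((fun=> - \sum_(k < n) f k : R) @ \oo)); last exact: cvg_cst.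
  apply: near_eq_cvg; exists n => // m /= nm.
  rewrite /series /= (@big_cat_nat _ _ _ n) //= [X in _ + X]big_nat_cond.
  rewrite [X in _ + X]big1 => [|k /andP[/andP[nk _] _]]; last by rewrite /h ltnNge nk.
  by rewrite addr0 -sumrN big_mkord; apply: eq_bigr => k _; rewrite /h ltn_ord.
rewrite (_ : (fun k => _) = (fun k => f k + h k)); first exact: sumsD.
by apply/funext => k; rewrite /h; case: ifP => _; rewrite ?subrr ?addr0.
Qed.

Lemma sums_tail_bound f g a b n : (forall k, 0 <= f k <= g k) ->
  series f @ \oo --> a -> series g @ \oo --> b ->
  `|a - \sum_(k < n) f k| <= b - \sum_(k < n) g k.
Proof.
move=> fg fa gb; rewrite ger0_norm.
  have := sums_le _ (@sums_restrict f a n fa) (@sums_restrict g b n gb); apply => k.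
  by case: ifP => // _; have /andP[] := fg k.
rewrite subr_ge0; apply: sums_ge_part => // k.
by have /andP[] := fg k.
Qed.

Lemma sums_tail_small f l tau : 0 < tau -> series f @ \oo --> l ->
  exists n0, forall n, (n0 <= n)%N -> l - \sum_(k < n) f k <= tau.
Proof.
move=> tau0 fl.
have /cvgrPdist_le/(_ _ tau0)[n0 _ H] := fl.
exists n0 => n nn; have := H n nn; rewrite /series /= big_mkord.
by apply: le_trans; apply: ler_norm.
Qed.

End Sums.

Section Unit_interval_lipschitz.
Variable R : realType.
Implicit Types f g : R -> R.

Definition lipschitz01 f : Prop := exists L b : R, [/\ 0 <= L, 0 <= b,
  forall x, 0 <= x <= 1 -> `|f x| <= b &
  forall x y, 0 <= x <= 1 -> 0 <= y <= 1 -> `|f x - f y| <= L * `|x - y|].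

Lemma lipschitz01_cst a : lipschitz01 (fun=> a).
Proof.
by exists 0, `|a|; split => // x y _ _; rewrite subrr normr0 mul0r.
Qed.

Lemma lipschitz01_id : lipschitz01 id.
Proof.
exists 1, 1; split => // [x /andP[x0 x1]|x y _ _]; first by rewrite ger0_norm.
by rewrite mul1r.
Qed.

Lemma lipschitz01D f g : lipschitz01 f -> lipschitz01 g -> lipschitz01 (fun x => f x + g x).
Proof.
move=> [L [b [L0 b0 fb fL]]] [L' [b' [L'0 b'0 gb gL]]]; exists (L + L'), (b + b').
split; [exact: addr_ge0|exact: addr_ge0|move=> x x01|move=> x y x01 y01].
  by apply: (le_trans (ler_normD _ _)); rewrite lerD ?fb ?gb.
have -> : f x + g x - (f y + g y) = (f x - f y) + (g x - g y) by ring.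
by apply: (le_trans (ler_normD _ _)); rewrite mulrDl lerD ?fL ?gL.
Qed.

Lemma lipschitz01M f g : lipschitz01 f -> lipschitz01 g -> lipschitz01 (fun x => f x * g x).
Proof.
move=> [L [b [L0 b0 fb fL]]] [L' [b' [L'0 b'0 gb gL]]]; exists (b * L' + b' * L), (b * b').
split; [by rewrite addr_ge0 ?mulr_ge0|exact: mulr_ge0|move=> x x01|move=> x y x01 y01].
  by rewrite normrM ler_pM ?fb ?gb.
have -> : f x * g x - f y * g y = f x * (g x - g y) + g y * (f x - f y) by ring.
apply: (le_trans (ler_normD _ _)); rewrite !normrM mulrDl -!mulrA.
by apply: lerD; apply: ler_pM; rewrite ?fb ?gb ?fL ?gL.
Qed.

Lemma lipschitz01X f n : lipschitz01 f -> lipschitz01 (fun x => f x ^+ n).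
Proof.
move=> lf; elim: n => [|n IH]; first exact: lipschitz01_cst.
have -> : (fun x => f x ^+ n.+1) = (fun x => f x * f x ^+ n).
  by apply/funext => x; rewrite exprS.
exact: lipschitz01M.
Qed.

Lemma lipschitz01_sum n (f : 'I_n -> R -> R) :
  (forall i, lipschitz01 (f i)) -> lipschitz01 (fun x => \sum_i f i x).
Proof.
elim: n f => [|n IH] f lf.
  have -> : (fun x => \sum_i f i x) = (fun=> 0) by apply/funext => x; rewrite big_ord0.
  exact: lipschitz01_cst.
have -> : (fun x => \sum_i f i x) = (fun x => f ord0 x + \sum_(i < n) f (lift ord0 i) x).
  by apply/funext => x; rewrite big_ord_recl.
by apply: lipschitz01D => //; apply: IH.
Qed.

Lemma continuous_big_sum n (f : 'I_n -> R -> R) :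
  (forall i, continuous (f i)) -> continuous (fun x => \sum_i f i x).
Proof.
elim: n f => [|n IH] f cf x.
  have -> : (fun x => \sum_i f i x) = (fun=> 0) by apply/funext => y; rewrite big_ord0.
  exact: cvg_cst.
have -> : (fun x => \sum_i f i x) = (fun x => f ord0 x + \sum_(i < n) f (lift ord0 i) x).
  by apply/funext => y; rewrite big_ord_recl.
by apply: cvgD; [exact: cf|apply: IH].
Qed.

(** Ratios such as |Q| / n may leave [0, 1], while the recursions want functions that are Lipschitz
    on the whole line; composing with [clamp] supplies them. *)
Definition clamp (x : R) : R := Num.max 0 (Num.min 1 x).

Lemma clamp01 x : 0 <= clamp x <= 1.
Proof. by rewrite /clamp le_max lexx /= ge_max ler01 ge_min lexx. Qed.

Lemma clamp_id x : 0 <= x <= 1 -> clamp x = x.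
Proof. by move=> /andP[x0 x1]; rewrite /clamp (min_idPr x1) (max_idPr x0). Qed.

Lemma clamp_lip x y : `|clamp x - clamp y| <= `|x - y|.
Proof.
wlog xy : x y / x <= y => [H|].
  have [xy|/ltW yx] := leP x y; first exact: H.
  by rewrite distrC [leRHS]distrC H.
rewrite distrC [leRHS]distrC (ger0_norm (x := y - x)) ?subr_ge0 // ler_norml.
by rewrite /clamp; case: (leP 1 x); case: (leP 1 y); rewrite ?(max_idPr (@ler01 R));
  case: (leP 0 x); case: (leP 0 y) => *; apply/andP; split; lra.
Qed.

Lemma lipschitz01_clamp f : lipschitz01 f ->
  exists2 L, 0 <= L & forall x y, `|f (clamp x) - f (clamp y)| <= L * `|x - y|.
Proof.
move=> [L [b [L0 b0 fb fL]]]; exists L => // x y.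
by apply: (le_trans (fL _ _ (clamp01 _) (clamp01 _))); rewrite ler_wpM2l ?clamp_lip.
Qed.

End Unit_interval_lipschitz.

(** * Binomial averages expressed by derivatives of the generating function *)

Section Unsaturated_mass.
Variables (R : realType) (pi : nat -> R) (mu : R) (C : nat).
Hypothesis pi_entire : entire pi.
Hypothesis pi_sum : series pi @ \oo --> (1 : R).
Hypothesis pi_mean : series (fun k => pi k * k%:R) @ \oo --> mu.
Hypothesis mu_gt0 : 0 < mu.
Hypothesis C_gt0 : (0 < C)%N.
Local Notation Dn := (gen_derive pi).

Let pi_ge0 k : 0 <= pi k. Proof. by have [] := pi_entire. Qed.

(* [unsaturated] is [Gamma] and [filled] is [C * limit_ratio], the mean of
   min(C, X) for X binomial with parameters a random degree and [g]. *)
Definition unsaturated (g : R) : R := \sum_(k < C) g ^+ k / k`!%:R * Dn k.+1 (1 - g).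

Definition filled (g : R) : R :=
  C%:R - \sum_(k < C) (C%:R - k%:R) / k`!%:R * g ^+ k * Dn k (1 - g).

Lemma gen_derive_ge0 j (x : R) : 0 <= x -> 0 <= Dn j x.
Proof.
move=> x0; have H := @gen_derive_sums R pi pi_entire j x.
by have := @sums_ge_part R _ _ 0 _ H; rewrite big_ord0; apply => k; rewrite !mulr_ge0 ?exprn_ge0.
Qed.

Lemma gen_derive_le j (x y : R) : 0 <= x <= y -> Dn j x <= Dn j y.
Proof.
move=> /andP[x0 xy].
apply: (sums_le _ (@gen_derive_sums R pi pi_entire j x) (@gen_derive_sums R pi pi_entire j y)) => k.
by rewrite ler_wpM2l ?mulr_ge0 // lerXn2r ?nnegrE // (le_trans x0).
Qed.

Lemma gen_derive_lip j : lipschitz01 (fun g => Dn j (1 - g)).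
Proof.
exists (Dn j.+1 1), (Dn j 1); split => [||x x01|x y x01 y01].
- exact: gen_derive_ge0.
- exact: gen_derive_ge0.
- by rewrite ger0_norm; [apply: gen_derive_le|apply: gen_derive_ge0]; lra.
wlog xy : x y x01 y01 / y <= x => [H|].
  have [yx|/ltW xy] := leP y x; first exact: H.
  by rewrite distrC [X in _ * X]distrC H.
have xy' : 1 - x <= 1 - y by rewrite lerB.
have dD (z : R) : z \in `](1 - x), (1 - y)[ -> is_derive z (1 : R) (Dn j) (Dn j.+1 z).
  by move=> _; apply: gen_derive_is_derive.
have cD : {within `[1 - x, 1 - y], continuous (Dn j)}.
  exact/continuous_subspaceT/gen_derive_continuous.
have [c] := MVT_segment xy' dD cD.
rewrite in_itv /= => /andP[c1 c2] E.
rewrite distrC E normrM; have -> : 1 - y - (1 - x) = x - y by ring.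
rewrite ler_wpM2r // ger0_norm; [apply: gen_derive_le|apply: gen_derive_ge0]; lra.
Qed.

Lemma unsaturated_lip : lipschitz01 unsaturated.
Proof.
apply: lipschitz01_sum => k; apply: lipschitz01M; last exact: gen_derive_lip.
apply: lipschitz01M; [exact/lipschitz01X/lipschitz01_id|exact: lipschitz01_cst].
Qed.

Lemma filled_lip : lipschitz01 filled.
Proof.
apply: lipschitz01D; first exact: lipschitz01_cst.
have -> : (fun x => - \sum_(k < C) (C%:R - k%:R) / k`!%:R * x ^+ k * Dn k (1 - x))
  = (fun x => -1 * \sum_(k < C) (C%:R - k%:R) / k`!%:R * x ^+ k * Dn k (1 - x)).
  by apply/funext => x; rewrite mulN1r.
apply: lipschitz01M; first exact: lipschitz01_cst.
apply: lipschitz01_sum => k; apply: lipschitz01M; last exact: gen_derive_lip.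
apply: lipschitz01M; [exact: lipschitz01_cst|exact/lipschitz01X/lipschitz01_id].
Qed.

Lemma unsaturated_continuous : continuous unsaturated.
Proof.
apply: continuous_big_sum => k g; apply: cvgM.
  by apply: cvgM; [exact: exprn_continuous|exact: cvg_cst].
have H : continuous (fun x : R => Dn k.+1 (1 - x)).
  move=> x; apply: (@continuous_comp _ _ _ (fun x : R => 1 - x) (Dn k.+1)).
    by apply: cvgB; [exact: cvg_cst|exact: cvg_id].
  exact: gen_derive_continuous.
exact: H.
Qed.

Lemma bin_mean_rev D (g : R) alpha : bin_mean D (1 - g) alpha =
  \sum_(k < D.+1) 'C(D, k)%:R * g ^+ k * (1 - g) ^+ (D - k) * alpha (D - k)%N.
Proof.
rewrite /bin_mean (reindex_inj rev_ord_inj) /=; apply: eq_bigr => k _.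
have kD : (k <= D)%N by rewrite -ltnS.
by rewrite subSS bin_sub // subKn // subKr; ring.
Qed.

(** Both sums live on k < C and k <= D: the left one by its condition, the right one because the
    binomials beyond [D] vanish. *)
Lemma bin_sum_cut D (g : R) (F : nat -> R) :
  \sum_(k < D.+1) (if (k < C)%N then 'C(D, k)%:R * F k else 0)
  = \sum_(k < C) 'C(D, k)%:R * F k.
Proof.
rewrite -(big_mkord predT (fun k => if (k < C)%N then 'C(D, k)%:R * F k else 0)).
rewrite -(big_mkord predT (fun k => 'C(D, k)%:R * F k)) -big_mkcond /=.
have [CD|DC] := leqP C D.+1.
  by rewrite (big_nat_widen _ _ _ _ _ CD).
rewrite (big_nat_widen _ _ _ _ _ (ltnW DC)) [RHS]big_nat_cond [LHS]big_nat_cond.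
rewrite [RHS](bigID (fun k => (k < D.+1)%N)) /= [X in _ = _ + X]big1 ?addr0.
  by apply: eq_bigl => k; case: (ltnP k D.+1) => kD; rewrite ?andbT ?andbF //=;
     move: (leq_trans kD (ltnW DC)) => ->; rewrite andbT.
by move=> k /andP[_ kD]; rewrite bin_small ?mul0r // ltnNge -ltnS.
Qed.

(** With X binomial of parameters D and g, this is the mean of D - X on the event X < C. Since k!
    C(D, k) (D - k) is the falling factorial of order k + 1, each term is one of a derivative series
    once a factor 1 - g is taken out. *)
Lemma open_mean D (g : R) : bin_mean D (1 - g) (open_half_edges R C D)
  = \sum_(k < C) g ^+ k / k`!%:R * (1 - g) * ((D ^_ k.+1)%:R * (1 - g) ^+ (D - k.+1)).
Proof.
rewrite bin_mean_rev; pose F k : R := g ^+ k * (1 - g) ^+ (D - k) * (D - k)%:R.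
transitivity (\sum_(k < D.+1) (if (k < C)%N then 'C(D, k)%:R * F k else 0)).
  apply: eq_bigr => k _; have kD : (k <= D)%N by rewrite -ltnS.
  by rewrite /open_half_edges subKn //; case: ifP => _; rewrite ?mulr0 // /F; ring.
rewrite bin_sum_cut //; apply: eq_bigr => k _; rewrite /F.
have f0 : k`!%:R != 0 :> R by rewrite pnatr_eq0 -lt0n fact_gt0.
have : 'C(D, k)%:R * k`!%:R = (D ^_ k)%:R :> R by rewrite -natrM bin_ffact.
rewrite ffactnSr natrM => <-; have [Dk|kD] := leqP D k.
  have -> : (D - k = 0)%N by apply/eqP; rewrite subn_eq0.
  by rewrite !mulr0 mul0r mulr0.
have -> : (D - k = (D - k.+1).+1)%N by rewrite subnSK.
by rewrite exprS; field.
Qed.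

(** From min(C, X) = C - (C - X)^+ with X binomial, the positive part being a sum over k < C. *)
Lemma capped_mean D (g : R) : bin_mean D (1 - g) (capped_load R C D)
  = C%:R - \sum_(k < C) (C%:R - k%:R) / k`!%:R * g ^+ k * ((D ^_ k)%:R * (1 - g) ^+ (D - k)).
Proof.
rewrite bin_mean_rev; pose F k : R := (C%:R - k%:R) * (g ^+ k * (1 - g) ^+ (D - k)).
transitivity (C%:R - \sum_(k < D.+1) (if (k < C)%N then 'C(D, k)%:R * F k else 0)).
  have CE : C%:R = \sum_(k < D.+1) 'C(D, k)%:R * g ^+ k * (1 - g) ^+ (D - k) * C%:R.
    have := bin_mean_bin D (1 - g) 0; rewrite bin_mean_rev bin0 expr0 mulr1 mulr1n.
    move=> E1; rewrite -mulr_suml -[LHS]mul1r; congr (_ * _).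
    by rewrite -[LHS]E1; apply: eq_bigr => k _; rewrite bin0 mulr1.
  rewrite [X in _ = X - _]CE -sumrB; apply: eq_bigr => k _.
  have kD : (k <= D)%N by rewrite -ltnS.
  rewrite /capped_load subKn //; case: ltnP => kC; rewrite ?subr0 /F //; ring.
rewrite bin_sum_cut //; congr (_ - _); apply: eq_bigr => k _; rewrite /F.
have f0 : k`!%:R != 0 :> R by rewrite pnatr_eq0 -lt0n fact_gt0.
have <- : 'C(D, k)%:R * k`!%:R = (D ^_ k)%:R :> R by rewrite -natrM bin_ffact.
by field.
Qed.

Lemma unsaturated_sums (g : R) :
  series (fun D => pi D * bin_mean D (1 - g) (open_half_edges R C D)) @ \oo -->
  (1 - g) * unsaturated g.
Proof.
have -> : (1 - g) * unsaturated g
    = \sum_(k < C) (g ^+ k / k`!%:R * (1 - g)) * Dn k.+1 (1 - g).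
  by rewrite mulr_sumr; apply: eq_bigr => k _; ring.
have -> : (fun D => pi D * bin_mean D (1 - g) (open_half_edges R C D))
  = (fun D => \sum_(k < C) (g ^+ k / k`!%:R * (1 - g)) *
       (pi D * (D ^_ k.+1)%:R * (1 - g) ^+ (D - k.+1))).
  apply/funext => D; rewrite open_mean mulr_sumr; apply: eq_bigr => k _; ring.
apply: (sums_lin (f := fun (k : 'I_C) D => pi D * (D ^_ k.+1)%:R * (1 - g) ^+ (D - k.+1))).
by move=> k; apply: gen_derive_sums.
Qed.

Lemma filled_sums (g : R) :
  series (fun D => pi D * bin_mean D (1 - g) (capped_load R C D)) @ \oo --> filled g.
Proof.
have -> : filled g = C%:R * 1
   + \sum_(k < C) (- ((C%:R - k%:R) / k`!%:R * g ^+ k)) * Dn k (1 - g).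
  rewrite mulr1 /filled -sumrN; congr (_ + _); apply: eq_bigr => k _; ring.
have -> : (fun D => pi D * bin_mean D (1 - g) (capped_load R C D))
  = (fun D => C%:R * pi D + \sum_(k < C) (- ((C%:R - k%:R) / k`!%:R * g ^+ k)) *
       (pi D * (D ^_ k)%:R * (1 - g) ^+ (D - k))).
  apply/funext => D; rewrite capped_mean mulrBr mulrC; congr (_ + _).
  rewrite mulr_sumr -sumrN; apply: eq_bigr => k _; ring.
apply: sumsD; first exact: sumsZ.
apply: (sums_lin (f := fun (k : 'I_C) D => pi D * (D ^_ k)%:R * (1 - g) ^+ (D - k))).
by move=> k; apply: gen_derive_sums.
Qed.

Definition mean_tail (D0 : nat) : R := mu - \sum_(k < D0) pi k * k%:R.

Lemma unsaturated_approx D0 (rho : R) : 0 <= rho <= 1 ->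
  `|(1 - rho) * unsaturated rho
    - \sum_(D < D0) pi D * bin_mean D (1 - rho) (open_half_edges R C D)| <= mean_tail D0.
Proof.
move=> r01; have := @unsaturated_sums rho => us.
apply: (@sums_tail_bound R _ _ _ _ D0 _ us pi_mean) => k.
rewrite mulr_ge0 ?ler_wpM2l //=.
  by apply: bin_mean_le => [|b bk]; [lra|have /andP[] := @open_half_edges_bound R C _ _ bk].
by apply: bin_mean_ge0 => [|b bk]; [lra|have /andP[] := @open_half_edges_bound R C _ _ bk].
Qed.

Lemma filled_approx D0 (rho : R) : 0 <= rho <= 1 ->
  `|filled rho - \sum_(D < D0) pi D * bin_mean D (1 - rho) (capped_load R C D)| <= mean_tail D0.
Proof.
move=> r01; have us := @filled_sums rho.
apply: (@sums_tail_bound R _ _ _ _ D0 _ us pi_mean) => k.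
rewrite mulr_ge0 ?ler_wpM2l //=.
  by apply: bin_mean_le => [|b bk]; [lra|have /andP[] := @capped_load_bound R C _ _ bk].
by apply: bin_mean_ge0 => [|b bk]; [lra|have /andP[] := @capped_load_bound R C _ _ bk].
Qed.

Lemma mean_tail_small tau : 0 < tau -> exists n0, forall n, (n0 <= n)%N -> mean_tail n <= tau.
Proof. by move=> tau0; apply: (sums_tail_small tau0 pi_mean). Qed.

Lemma filled_bound (g : R) : 0 <= g <= 1 -> 0 <= filled g <= C%:R.
Proof.
move=> g01; have us := @filled_sums g; apply/andP; split.
  have := @sums_ge_part R _ _ 0 _ us; rewrite big_ord0; apply => k; rewrite mulr_ge0 //.
  by apply: bin_mean_ge0 => [|b _]; [lra|rewrite ler0n].
have sC := @sumsZ R _ C%:R _ pi_sum; rewrite mulr1 in sC.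
apply: (sums_le _ us sC) => k; rewrite [leRHS]mulrC ler_wpM2l //.
apply: bin_mean_le => [|b _]; first lra.
by rewrite ler_nat geq_minl.
Qed.

Lemma unsaturated_ge0 (g : R) : 0 <= g <= 1 -> 0 <= unsaturated g.
Proof.
move=> g01; apply: sumr_ge0 => k _; rewrite mulr_ge0 //; last by apply: gen_derive_ge0; lra.
by rewrite divr_ge0 // exprn_ge0; lra.
Qed.

(** Open half-edges are unread half-edges, so (1 - g) Gamma(g) <= (1 - g) mu, which can be divided
    by 1 - g below 1; the endpoint follows from the Lipschitz bound. *)
Lemma unsaturated_le (g : R) : 0 <= g <= 1 -> unsaturated g <= mu.
Proof.
have lt1 (x : R) : 0 <= x < 1 -> unsaturated x <= mu.
  move=> x01; have x1 : 0 < 1 - x by lra.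
  rewrite -(ler_pM2l x1); have us := @unsaturated_sums x.
  apply: (sums_le _ us (@sumsZ R _ (1 - x) _ pi_mean)) => k.
  rewrite mulrCA ler_wpM2l //; have := bin_mean_bin k (1 - x) 1.
  rewrite bin1 expr1 mulrC => <-; apply: ler_sum => b _.
  rewrite ler_wpM2l ?mulr_ge0 ?exprn_ge0 //; try lra.
  by rewrite bin1 /open_half_edges; case: ifP.
move=> g01; have [g1|g1] := ltP g 1; first by apply: lt1; lra.
have -> : g = 1 by lra.
have [L [b [L0 _ _ HL]]] := unsaturated_lip.
apply/ler_addgt0Pl => e e0; pose t := Num.min 1 (e / (L + 1)).
have L1 : 0 < L + 1 by lra.
have t0 : 0 < t by rewrite lt_min ltr01 divr_gt0.
have t1 : t <= 1 by rewrite ge_min lexx.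
have te : L * t <= e.
  apply: (@le_trans _ _ ((L + 1) * t)); first by nra.
  by rewrite mulrC -ler_pdivlMr // ge_min lexx orbT.
have := lt1 (1 - t) ltac:(lra); have := HL 1 (1 - t) ltac:(lra) ltac:(lra).
rewrite [`|1 - (1 - t)|]ger0_norm; last lra.
by rewrite ler_norml => /andP[_ h1] h2; lra.
Qed.

(** The first derivative alone is positive at 1 - g > 0: a positive mean forces some positive degree
    to have mass. *)
Lemma unsaturated_gt0 (g : R) : 0 <= g < 1 -> 0 < unsaturated g.
Proof.
move=> g01; have [m m0 pm] : exists2 m, (0 < m)%N & 0 < pi m.
  apply/not_exists2P => H; have : mu <= 0.
    have z := @sumsZ R _ 0 _ pi_sum; rewrite mul0r in z.
    apply: (sums_le _ pi_mean z) => k; rewrite mul0r.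
    case: k => [|k]; first by rewrite mulr0.
    by have [//|/negP] := H k.+1; rewrite -leNgt => h; rewrite mulr_le0_ge0.
  by rewrite leNgt mu_gt0.
apply: (@lt_le_trans _ _ (Dn 1 (1 - g))).
  apply: (@lt_le_trans _ _ (\sum_(k < m.+1) pi k * (k ^_ 1)%:R * (1 - g) ^+ (k - 1))).
    rewrite big_ord_recr /= ltr_wpDl //.
      by apply: sumr_ge0 => k _; rewrite !mulr_ge0 ?exprn_ge0 //; lra.
    by rewrite !mulr_gt0 ?exprn_gt0 ?ltr0n ?ffactn1 //; lra.
  apply: (@sums_ge_part R _ _ m.+1 _ (@gen_derive_sums R pi pi_entire 1 (1 - g))) => k.
  by rewrite !mulr_ge0 ?exprn_ge0 //; lra.
rewrite /unsaturated; case: C C_gt0 => // n _.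
rewrite big_ord_recl /= expr0 divr1 mul1r lerDl sumr_ge0 // => k _.
rewrite mulr_ge0 //; last by apply: gen_derive_ge0; lra.
by rewrite divr_ge0 // exprn_ge0; lra.
Qed.

End Unsaturated_mass.

(** * Mean number of reads of a random vertex *)

Section Read_rate.
Variables (R : realType) (pi : nat -> R) (mu m2 : R).
Hypothesis pi_entire : entire pi.
Hypothesis pi_mean : series (fun k => pi k * k%:R) @ \oo --> mu.
Hypothesis pi_square : series (fun k => pi k * k%:R ^+ 2) @ \oo --> m2.
Hypothesis mu_gt0 : 0 < mu.

Let pi_ge0 k : 0 <= pi k. Proof. by have [] := pi_entire. Qed.

(* (1 - phi (1 - x)) / x, see [read_rate_gen]. *)
Definition read_rate (x : R) : R := limn (series (fun k => pi k * mean_reads k x)).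

Lemma read_rate_sums (x : R) : 0 <= x <= 1 ->
  series (fun k => pi k * mean_reads k x) @ \oo --> read_rate x.
Proof.
move=> x01; apply: (@series_le_cvg _ _ (fun k => pi k * k%:R)) => [k|k|k|].
- by rewrite mulr_ge0 //; have /andP[] := mean_reads_bound k x01.
- by rewrite mulr_ge0.
- by rewrite ler_wpM2l //; have /andP[] := mean_reads_bound k x01.
- by apply/cvg_ex; exists mu.
Qed.

Lemma read_rate_bound (x : R) : 0 <= x <= 1 -> 0 <= read_rate x <= mu.
Proof.
move=> x01; have qs := read_rate_sums x01; apply/andP; split; last first.
  apply: (sums_le _ qs pi_mean) => k.
  by rewrite ler_wpM2l //; have /andP[] := mean_reads_bound k x01.
have := @sums_ge_part R _ _ 0 _ qs; rewrite big_ord0; apply => k.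
by rewrite mulr_ge0 //; have /andP[] := mean_reads_bound k x01.
Qed.

Lemma read_rate_lip (x y : R) : 0 <= x <= 1 -> 0 <= y <= 1 ->
  `|read_rate x - read_rate y| <= m2 * `|x - y|.
Proof.
wlog xy : x y / read_rate y <= read_rate x => [H x01 y01|x01 y01].
  have [yx|/ltW yx] := leP (read_rate y) (read_rate x); first exact: H.
  by rewrite distrC (distrC x); apply: H.
rewrite ger0_norm ?subr_ge0 // lerBlDl [m2 * _]mulrC.
apply: (sums_le _ (read_rate_sums x01) (sumsD (read_rate_sums y01) (@sumsZ R _ `|x - y| _ pi_square))) => k.
rewrite mulrCA -mulrDr ler_wpM2l // -lerBlDl; apply: (le_trans (ler_norm _)).
by rewrite mulrC; apply: mean_reads_lip.
Qed.

(** A vertex of positive degree makes at least one read, so the mass of any such degree is a lower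
    bound, uniform down to x = 0 where the closed formula is 0 / 0. *)
Lemma read_rate_gt0 : exists2 c, 0 < c & forall x, 0 <= x <= 1 -> c <= read_rate x.
Proof.
have [m m0 pm] : exists2 m, (0 < m)%N & 0 < pi m.
  apply: contrapT => no; move: mu_gt0; suff -> : mu = 0 by rewrite ltxx.
  have := pi_mean; rewrite (_ : series _ = fun=> 0).
    by move=> h; apply: (cvg_unique (@norm_hausdorff _ _) h); apply: cvg_cst.
  apply/funext => n; rewrite /series /= big1 // => k _.
  have [->|k0] := posnP k; first by rewrite mulr0.
  have [->|pk] := eqVneq (pi k) 0; first by rewrite mul0r.
  by case: no; exists k => //; rewrite lt_neqAle eq_sym pk pi_ge0.
exists (pi m) => // x x01.
have qs := read_rate_sums x01.
have pos k : 0 <= pi k * mean_reads k x.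
  by rewrite mulr_ge0 //; have /andP[] := mean_reads_bound k x01.
have := @sums_ge_part R _ _ m.+1 pos qs; apply: le_trans.
rewrite big_ord_recr /= -[leLHS]add0r lerD ?sumr_ge0 //.
rewrite -[leLHS]mulr1 ler_wpM2l //; case: m m0 {pm} => // m _ /=.
by rewrite lerDl mulr_ge0 //; [lra|have /andP[] := mean_reads_bound m x01].
Qed.

Lemma mean_reads_geometric k (x : R) : x * mean_reads k x = 1 - (1 - x) ^+ k.
Proof. by elim: k => [|k IH] /=; rewrite ?mulr0 ?expr0 ?subrr // mulrDr mulrCA IH exprS; ring. Qed.

Lemma read_rate_gen (x : R) : series pi @ \oo --> (1 : R) -> 0 <= x <= 1 ->
  1 - gen_derive pi 0 (1 - x) = x * read_rate x.
Proof.
move=> pi_sum x01; have g := @gen_derive_sums R pi pi_entire 0 (1 - x).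
have := sumsD pi_sum (@sumsZ R _ (-1) _ g); rewrite mulN1r.
move=> h; apply: (cvg_unique (@norm_hausdorff _ _) h); have := @sumsZ R _ x _ (read_rate_sums x01).
rewrite (_ : (fun k => x * _) = (fun k => pi k + -1 * (pi k * (k ^_ 0)%:R * (1 - x) ^+ (k - 0)))) //.
by apply/funext => k; rewrite mulrCA mean_reads_geometric ffactn0 subn0; ring.
Qed.

Lemma read_rate_approx n (x : R) : 0 <= x <= 1 ->
  `|read_rate x - \sum_(k < n) pi k * mean_reads k x| <= mean_tail pi mu n.
Proof.
move=> x01; apply: (@sums_tail_bound R _ _ _ _ n _ (read_rate_sums x01) pi_mean) => k.
have /andP[m0 m1] := mean_reads_bound k x01.
by rewrite mulr_ge0 //= ler_wpM2l.
Qed.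

End Read_rate.

(* The mass beyond [B] is moved to [0], so that the truncation is again a
   probability distribution and dominates [pi] on [0, B]. *)
Section Truncated_law.
Variables (R : realType) (pi : nat -> R) (B : nat).
Hypothesis pi_ge0 : forall k, 0 <= pi k.
Hypothesis pi_sum : series pi @ \oo --> (1 : R).

Definition truncated (a : 'I_B.+1) : R :=
  pi a + (a == ord0)%:R * (1 - \sum_(k < B.+1) pi k).

Lemma truncated_ge (a : 'I_B.+1) : pi a <= truncated a.
Proof. by rewrite lerDl mulr_ge0 // subr_ge0; apply: sums_ge_part. Qed.

Lemma truncated_ge0 a : 0 <= truncated a.
Proof. exact: le_trans (truncated_ge a). Qed.

Lemma truncated_mean (psi : nat -> R) : psi 0%N = 0 ->
  \sum_a truncated a * psi a = \sum_(k < B.+1) pi k * psi k.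
Proof.
move=> psi0; apply: eq_bigr => a _; rewrite mulrDl.
by case: eqP => [->|_]; rewrite ?psi0 ?mulr0 ?mul0r addr0.
Qed.

Lemma truncated_sum : \sum_a truncated a = 1.
Proof.
rewrite big_split /= -mulr_suml [X in _ + X * _](bigD1 ord0) //= [X in _ + (1 + X) * _]big1 ?addr0 => [|a /negPf -> //].
by rewrite mul1r subrKC.
Qed.

Lemma truncated_moment j (m : R) : (0 < j)%N ->
  series (fun k => pi k * k%:R ^+ j) @ \oo --> m ->
  \sum_a truncated a * (a : nat)%:R ^+ j <= m.
Proof.
move=> j0 pm; rewrite (truncated_mean (psi := fun k => k%:R ^+ j)); last first.
  by rewrite expr0n gtn_eqF.
by apply: sums_ge_part pm => k; rewrite mulr_ge0.
Qed.

End Truncated_law.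

(** * The differential equation *)

Section Barrier.
Variable R : realType.

Lemma within_itv_eps (f : R -> R) (a b x e : R) :
  {within `[a, b], continuous f} -> a <= x <= b -> 0 < e ->
  exists2 r, 0 < r & forall y, a <= y <= b -> `|x - y| < r -> `|f x - f y| < e.
Proof.
move=> /subspace_continuousP cf xab e0.
have /cvgrPdist_lt/(_ _ e0) : f @ within `[a, b] (nbhs x) --> f x.
  by apply: cf; rewrite /= in_itv.
rewrite near_withinE => /nbhs_ballP[r /= r0 H]; exists r => // y yab xy.
by apply: H => //=; rewrite in_itv.
Qed.

Lemma derive_gt0_left (f : R -> R) (z l e : R) : is_derive z 1 f l -> 0 < l -> 0 < e ->
  exists r, [/\ z - e < r, r < z & f r < f z].
Proof.
move=> fz l0 e0; have /is_derive1_caratheodory[g [fE gc gz]] := fz.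
have : \forall y \near z, 0 < g y.
  have g0 : 0 < g z by rewrite gz.
  exact: (cvgr_gt _ gc _ g0).
move=> /nbhs_ballP[r /= r0 H]; pose m := Num.min r e / 2.
have min0 : 0 < Num.min r e by rewrite lt_min r0 e0.
have minr : Num.min r e <= r by rewrite ge_min lexx.
have mine : Num.min r e <= e by rewrite ge_min lexx orbT.
have [m0 mr me] : [/\ 0 < m, m < r & m < e] by rewrite /m; split; lra.
exists (z - m); split; [lra|lra|].
have := fE (z - m); have : 0 < g (z - m).
  by apply: H; rewrite /ball /= opprB addrC subrK ger0_norm // ltW.
by move=> gp; nra.
Qed.

(** At the first point where the value is at most [L], continuity forces equality, and a positive
    derivative there would put smaller values just before it. *)
Lemma barrier (f : R -> R) (L b : R) : 0 < b ->
  {within `[0, b], continuous f} -> L < f 0 ->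
  (forall z, 0 < z < b -> f z = L -> exists2 l, 0 < l & is_derive z 1 f l) ->
  forall s, 0 <= s < b -> L < f s.
Proof.
move=> b0 cf f0 der s /andP[s0 sb]; rewrite ltNge; apply/negP => fsL.
pose E := [set r : R | 0 <= r <= s /\ f r <= L].
have Es : E s by split => //; rewrite s0 lexx.
have lE : has_lbound E by exists 0 => r [/andP[]].
have iE : has_inf E by split; [exists s|].
pose z := inf E.
have z0 : 0 <= z by apply: lb_le_inf; [exists s|move=> r [/andP[]]].
have zs : z <= s by apply: ge_inf.
have zb : 0 <= z <= b by rewrite z0 (le_trans zs) // ltW.
have before r : 0 <= r < z -> L < f r.
  move=> /andP[r0 rz]; rewrite ltNge; apply/negP => frL.
  have : E r by split => //; rewrite r0 (le_trans (ltW rz)).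
  by move=> /(ge_inf lE); rewrite leNgt rz.
have fzL : f z <= L.
  rewrite leNgt; apply/negP => Lfz.
  have e0 : 0 < f z - L by rewrite subr_gt0.
  have [r r0 H] := within_itv_eps cf zb e0.
  have [y Ey yz] := inf_adherent r0 iE.
  have zy : z <= y by apply: ge_inf.
  have [/andP[y0 ys] fyL] := Ey.
  have := H y; rewrite y0 (le_trans ys (ltW sb)) => /(_ isT).
  rewrite ler0_norm ?subr_le0 // opprB ltrBlDl => /(_ yz).
  by rewrite ltr_norml => /andP[_]; lra.
have zpos : 0 < z.
  by rewrite lt_neqAle z0 andbT; apply/eqP => ez; move: fzL; rewrite -ez leNgt f0.
have fzE : f z = L.
  apply/eqP; rewrite eq_le fzL /= leNgt; apply/negP => fzlt.
  have cz : {within `[0, z], continuous f}.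
    apply: continuous_subspaceW cf => r /=; rewrite !in_itv /= => /andP[-> rz] /=.
    by case/andP: zb => _; apply: le_trans.
  have [|c] := @IVT R f 0 z ((f z + L) / 2) z0 cz.
    by rewrite ge_min le_max; apply/andP; split; apply/orP; [right|left]; lra.
  rewrite in_itv /= => /andP[c0 cz'] fc.
  have : c < z.
    by rewrite lt_neqAle cz' andbT; apply/eqP => ce; move: fc; rewrite ce; lra.
  by move=> cltz; have := before c; rewrite c0 cltz => /(_ isT); lra.
have [|l l0 fl] := der z _ fzE; first by rewrite zpos (le_lt_trans zs).
have [r [rz1 rz2 frz]] := derive_gt0_left fl l0 zpos.
have r0 : 0 <= r < z by rewrite rz2 andbT ltW //; lra.
by have := before r r0; rewrite -fzE ltNge (ltW frz).
Qed.

End Barrier.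

(** * Existence and uniqueness by separation of variables *)

Section Autonomous_ode.
Variables (R : realType) (h rhs : R -> R) (c : R).
Hypothesis c_gt0 : 0 < c.
Hypothesis h_bound : forall g, c <= h g <= 1.
Hypothesis h_cont : continuous h.
Hypothesis rhs_h : forall g : R, 0 <= g < 1 -> rhs g = h g.
Hypothesis rhs_cont0 : {for 0, continuous rhs}.

Let h_gt0 g : 0 < h g.
Proof. by apply: lt_le_trans c_gt0 _; have /andP[] := h_bound g. Qed.

Let inv_h g := (h g)^-1.

Let inv_h_cont : continuous inv_h.
Proof. by move=> g; apply: cvgV; [rewrite gt_eqF|exact: h_cont]. Qed.

(** Based at -1 so that the primitive is differentiable on both sides at 0 and at 1. *)
Let prim (x : R) : R := (\int[@lebesgue_measure R]_(t in `[(-1 : R), x]) inv_h t)%R.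

Let prim_derive (x : R) : -1 < x < 2 -> is_derive x 1 prim (inv_h x).
Proof.
move=> /andP[x1 x2].
have [||||d e] := @continuous_FTC1_closed R inv_h (-1) x 2.
- exact: x2.
- apply: continuous_compact_integrable; first exact: segment_compact.
  exact: continuous_subspaceT.
- exact: x1.
- exact: inv_h_cont.
- by apply: (DeriveDef d); rewrite -derive1E; exact: e.
Qed.

(* Separation of variables: the solution is the inverse of the time needed to
   reach [x] at speed [h]. *)
Definition time_of (x : R) : R := prim x - prim 0.

Lemma time_of0 : time_of 0 = 0.
Proof. by rewrite /time_of subrr. Qed.

Lemma time_of_derive (x : R) : -1 < x < 2 -> is_derive x 1 time_of (inv_h x).
Proof.
move=> xx; have := prim_derive xx => dp.
rewrite -[inv_h x]subr0; apply: is_deriveB.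
Qed.

Lemma time_of_cont (x : R) : -1 < x < 2 -> {for x, continuous time_of}.
Proof.
move=> /time_of_derive[dx _]; exact/differentiable_continuous/derivable1_diffP.
Qed.

Lemma time_of_within (x y : R) : 0 <= x -> y <= 1 -> {within `[x, y], continuous time_of}.
Proof.
move=> x0 y1; apply: continuous_in_subspaceT => z; rewrite inE /= in_itv /= => /andP[xz zy].
by apply: time_of_cont; apply/andP; split; lra.
Qed.

Lemma time_of_grow (x y : R) : 0 <= x -> x <= y -> y <= 1 -> y - x <= time_of y - time_of x.
Proof.
move=> x0 xy y1.
have dD (z : R) : z \in `]x, y[ -> is_derive z (1 : R) time_of (inv_h z).
  by rewrite in_itv /= => /andP[xz zy]; apply: time_of_derive; apply/andP; split; lra.
have [z _ ->] := MVT_segment xy dD (time_of_within x0 y1).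
rewrite -[leLHS]mul1r ler_wpM2r ?subr_ge0 // /inv_h -[leLHS]invr1 lef_pV2 ?posrE //.
by have /andP[] := h_bound z.
Qed.

Lemma time_of_inj (x y : R) : 0 <= x <= 1 -> 0 <= y <= 1 -> time_of x = time_of y -> x = y.
Proof.
move=> /andP[x0 x1] /andP[y0 y1] e; have [xy|yx] := leP x y.
  by have := time_of_grow x0 xy y1; rewrite e subrr; lra.
by have := time_of_grow y0 (ltW yx) x1; rewrite e subrr; lra.
Qed.

Lemma time_of_surj (s : R) : 0 <= s <= 1 -> exists g, 0 <= g <= 1 /\ time_of g = s.
Proof.
move=> /andP[s0 s1].
have S1 : 1 <= time_of 1.
  by have := time_of_grow (lexx 0) (@ler01 R) (lexx 1); rewrite time_of0 !subr0.
have [|g] := @IVT R time_of 0 1 s (@ler01 R) (time_of_within (lexx 0) (lexx 1)).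
  by rewrite time_of0 ge_min le_max s0 (le_trans s1 S1) orbT.
by rewrite in_itv /= => g01 gs; exists g.
Qed.

(** Clamping the time to [0, 1] keeps the set nonempty for every real [s], so the default of [xget]
    is never taken. *)
Definition flow (s : R) : R :=
  xget 0 [set g | 0 <= g <= 1 /\ time_of g = Num.max 0 (Num.min 1 s)].

Lemma flowP (s : R) : 0 <= s <= 1 -> 0 <= flow s <= 1 /\ time_of (flow s) = s.
Proof.
move=> s01; have [g gP] := time_of_surj s01.
have sE : Num.max 0 (Num.min 1 s) = s.
  by case/andP: s01 => s0 s1; rewrite (min_idPr s1) (max_idPr s0).
by rewrite /flow sE; case: xgetP => [y _ yP //|/(_ g)].
Qed.

Lemma flow_unique (s g : R) : 0 <= s <= 1 -> 0 <= g <= 1 -> time_of g = s -> flow s = g.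
Proof.
move=> s01 g01 gs; have [f01 fs] := flowP s01.
by apply: time_of_inj => //; rewrite fs gs.
Qed.

Lemma flow0 : flow 0 = 0.
Proof. by apply: flow_unique; rewrite ?lexx ?ler01 ?time_of0. Qed.

Lemma flow_lip (s t : R) : 0 <= s <= 1 -> 0 <= t <= 1 -> `|flow s - flow t| <= `|s - t|.
Proof.
wlog st : s t / flow s <= flow t => [H s01 t01|s01 t01].
  have [st|/ltW ts] := leP (flow s) (flow t); first exact: H.
  by rewrite distrC [leRHS]distrC H.
have [/andP[s0 s1] sE] := flowP s01; have [/andP[t0 t1] tE] := flowP t01.
have := time_of_grow s0 st t1; rewrite sE tE => g.
rewrite distrC [leRHS]distrC (ger0_norm (x := flow t - _)) ?subr_ge0 //.
exact: le_trans g (ler_norm _).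
Qed.

Lemma flow_le (s : R) : 0 <= s <= 1 -> 0 <= flow s <= s.
Proof.
move=> s01; have [/andP[s0 s1] sE] := flowP s01; rewrite s0 /=.
by have := time_of_grow (lexx 0) s0 s1; rewrite sE time_of0 !subr0.
Qed.

Lemma flow_within : {within `[0, 1], continuous flow}.
Proof.
apply/subspace_continuousP => x; rewrite /= in_itv /= => x01.
apply/cvgrPdist_lt => e e0; rewrite near_withinE; near=> y.
rewrite /= in_itv /= => y01; apply: le_lt_trans (flow_lip x01 y01) _.
by near: y; apply: cvgr_dist_lt.
Unshelve. all: by end_near. Qed.

(** The inverse function theorem at [flow s], which lies strictly between 0 and 1: it is at most [s]
    because the speed is at most 1. *)
Lemma flow_derive (s : R) : 0 < s < 1 -> is_derive s 1 flow (h (flow s)).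
Proof.
move=> /andP[s0 s1]; have s01 : 0 <= s <= 1 by rewrite !ltW.
have [/andP[f0 f1] fE] := flowP s01; have /andP[_ fs] := flow_le s01.
set x := flow s in f0 f1 fE fs *.
have x0 : 0 < x.
  by rewrite lt_neqAle f0 andbT; apply/eqP => e; move: s0; rewrite -fE -e time_of0 ltxx.
have x2 : -1 < x < 2 by apply/andP; split; lra.
have dx := time_of_derive x2.
have xlt : x < 1 by apply: le_lt_trans s1.
have nx : \forall y \near x, 0 <= y <= 1.
  near=> y; apply/andP; split; apply: ltW; near: y; [exact: lt_nbhsr|exact: lt_nbhsl].
have cK : {near x, cancel time_of flow}.
  have ts : \forall y \near x, 0 <= time_of y <= 1.
    have cx := time_of_cont x2.
    near=> y; apply/andP; split; apply: ltW; near: y.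
      by apply: (cvgr_gt _ cx); rewrite fE.
    by apply: (cvgr_lt _ cx); rewrite fE.
  by near=> y; apply: flow_unique => //; near: y.
have cc : {near x, continuous time_of}.
  near=> y; apply: time_of_cont.
  have : 0 <= y <= 1 by near: y.
  by move=> y01; apply/andP; split; lra.
have := is_derive_inverse cK cc dx; rewrite fE /inv_h invrK; apply.
by rewrite invr_eq0 gt_eqF.
Unshelve. all: by end_near. Qed.

Lemma flow_solution (s : R) : 0 < s < 1 -> is_derive s 1 flow (rhs (flow s)).
Proof.
move=> s01; have /andP[s0 s1] := s01.
have sI : 0 <= s <= 1 by rewrite !ltW.
have /andP[f0 fs] := flow_le sI.
rewrite rhs_h; first exact: flow_derive.
by rewrite f0 (le_lt_trans fs).
Qed.

(* [rhs] is only known on [0, 1), so a solution must first be confined to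
   [0 <= H s <= s], by barriers slightly below 0 and slightly above s. *)
Section Uniqueness.
Variable H : R -> R.
Hypothesis H_within : {within `[0, 1], continuous H}.
Hypothesis H0 : H 0 = 0.
Hypothesis H_derive : forall s : R, 0 < s < 1 -> is_derive s 1 H (rhs (H s)).

Lemma solution_ge0 (s : R) : 0 <= s < 1 -> 0 <= H s.
Proof.
move=> s01; have r0 : 0 < rhs 0 by rewrite rhs_h ?lexx ?ltr01.
have : \forall y \near (0 : R), 0 < rhs y by exact: (cvgr_gt _ rhs_cont0 _ r0).
move=> /nbhs_ballP[r /= rp rhs_pos].
rewrite leNgt; apply/negP => Hs.
(* The level [- dl] lies where [rhs] is still positive by continuity at 0, and is at least the
   supposed negative value [H s], which the barrier then contradicts. *)
pose dl := Num.min (r / 2) (- H s).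
have [d1 d2] : dl <= r / 2 /\ dl <= - H s by rewrite /dl !ge_min !lexx orbT.
have d0 : 0 < dl by rewrite lt_min divr_gt0 //= oppr_gt0.
have := @barrier R H (- dl) 1 ltr01 H_within.
rewrite H0 oppr_lt0 => /(_ d0) B.
have : - dl < H s.
  apply: B s01 => z z01 Hz; exists (rhs (H z)); last exact: H_derive.
  by apply: rhs_pos; rewrite /ball /= Hz sub0r opprK ger0_norm ?ltW //; lra.
by lra.
Qed.

Lemma solution_le (s : R) : 0 <= s < 1 -> H s <= s.
Proof.
move=> /andP[s0 s1]; apply/ler_addgt0Pl => e e0.
(* The comparison line (1 + eta) x + eta has slope above the speed bound 1. On [0, b] it stays below
   1, so [rhs] is known wherever [H] touches it, and at [s] it exceeds [s] by at most [e]. *)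
pose b := (1 + s) / 2; pose eta := Num.min (e / 2) ((1 - b) / 4).
have [b0 sb b1] : [/\ 0 < b, s < b & b < 1] by rewrite /b; split; lra.
have [t1 t2] : eta <= e / 2 /\ eta <= (1 - b) / 4 by rewrite /eta !ge_min !lexx orbT.
have t0 : 0 < eta by rewrite lt_min; apply/andP; split; lra.
pose f (x : R) := (1 + eta) * x + eta - H x.
have cf : {within `[0, b], continuous f}.
  have cH : {within `[0, b], continuous H}.
    apply: continuous_subspaceW H_within => x /=; rewrite !in_itv /= => /andP[-> xb] /=.
    by lra.
  move=> x; apply: cvgB; last exact: cH.
  apply: cvgD; last exact: cvg_cst.
  apply: cvgM; first exact: cvg_cst.
  exact: (@continuous_subspaceT _ _ `[0, b] id (fun=> cvg_id)).
have f0 : 0 < f 0 by rewrite /f H0 mulr0 add0r subr0.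
have : 0 < f s.
  apply: (barrier b0 cf f0); last by rewrite s0 sb.
  move=> z /andP[z0 zb] fz; have z01 : 0 < z < 1 by rewrite z0 (lt_trans zb).
  have Hz : H z = (1 + eta) * z + eta by move: fz; rewrite /f; lra.
  have dz := H_derive z01.
  exists (1 + eta - rhs (H z)).
    rewrite rhs_h; last by rewrite Hz; apply/andP; split; nra.
    by have /andP[_] := h_bound (H z); lra.
  have dlin : is_derive z 1 (fun x : R => (1 + eta) * x + eta) (1 + eta).
    have -> : (fun x : R => (1 + eta) * x + eta) = ((1 + eta) *: id + cst eta).
      by apply/funext => x.
    rewrite -[X in is_derive _ _ _ X]addr0; apply: is_deriveD.
    have := @is_deriveZ R R R id (1 + eta) z 1 1 (is_derive_id _ _).
    by rewrite /GRing.scale /= mulr1.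
  by apply: is_deriveB.
by rewrite /f; nra.
Qed.

(** Along a solution, [time_of] of the position has derivative 1, hence equals the time. *)
Lemma solution_flow (s : R) : 0 <= s < 1 -> H s = flow s.
Proof.
move=> s01; have /andP[s0 s1] := s01.
have sI : 0 <= s <= 1 by rewrite s0 ltW.
apply/esym/flow_unique => //; first by rewrite solution_ge0 //= (le_trans (solution_le s01)) // ltW.
have H01 (x : R) : 0 <= x <= s -> 0 <= H x < 1.
  move=> /andP[x0 xs]; have x01 : 0 <= x < 1 by rewrite x0 (le_lt_trans xs).
  rewrite solution_ge0 //= (le_lt_trans (solution_le x01)) // (le_lt_trans xs) //.
have dD (z : R) : z \in `]0, s[ -> is_derive z (1 : R) (time_of \o H) ((fun=> 1) z).
  rewrite in_itv /= => /andP[z0 zs].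
  have z01 : 0 < z < 1 by rewrite z0 (lt_trans zs).
  have Hz : 0 <= H z < 1 by apply: H01; rewrite !ltW.
  have dz := H_derive z01.
  have Hz2 : -1 < H z < 2 by apply/andP; split; lra.
  have dt := time_of_derive Hz2.
  have e1 : inv_h (H z) * rhs (H z) = 1 by rewrite rhs_h // /inv_h mulVf // gt_eqF.
  by have := is_derive1_comp dt dz; rewrite e1.
have cD : {within `[0, s], continuous (time_of \o H)}.
  apply/subspace_continuousP => x; rewrite /= in_itv /= => xs.
  have Hx : 0 <= H x < 1 by exact: H01.
  have cH : {within `[0, s], continuous H}.
    apply: continuous_subspaceW H_within => y /=; rewrite !in_itv /= => /andP[-> ys] /=.
    exact: le_trans ys (ltW s1).
  move/subspace_continuousP : cH => /(_ x); rewrite /= in_itv /= => /(_ xs) cx.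
  apply: (cvg_comp _ _ cx); apply: time_of_cont; apply/andP; split; lra.
have [z _] := MVT_segment s0 dD cD.
by rewrite /= H0 time_of0 !subr0 mul1r.
Qed.

Lemma solution_unique (s : R) : 0 <= s <= 1 -> H s = flow s.
Proof.
move=> /andP[s0]; rewrite le_eqVlt => /orP[/eqP ->|s1]; last by apply: solution_flow; rewrite s0.
have i1 : 0 <= (1 : R) <= 1 by rewrite ler01 lexx.
apply/eqP; rewrite -subr_eq0 -normr_le0; apply/ler_addgt0Pl => e e0; rewrite addr0.
have e2 : 0 < e / 2 by rewrite divr_gt0.
have [r1 r10 h1] := within_itv_eps H_within i1 e2.
have [r2 r20 h2] := within_itv_eps flow_within i1 e2.
pose m := Num.min 1 (Num.min r1 r2) / 2.
have [m0 [m1 [m2 m3]]] : 0 < m /\ (m < 1 /\ (m < r1 /\ m < r2)).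
  have : 0 < Num.min 1 (Num.min r1 r2) by rewrite !lt_min ltr01 r10 r20.
  have : Num.min 1 (Num.min r1 r2) <= 1 by rewrite ge_min lexx.
  have : Num.min 1 (Num.min r1 r2) <= r1 by rewrite !ge_min lexx orbT.
  have : Num.min 1 (Num.min r1 r2) <= r2 by rewrite !ge_min lexx !orbT.
  by rewrite /m; move=> *; repeat split; lra.
have y01 : 0 <= 1 - m <= 1 by apply/andP; split; lra.
have d1 : `|1 - (1 - m)| < r1 by rewrite ger0_norm; lra.
have d2 : `|1 - (1 - m)| < r2 by rewrite ger0_norm; lra.
have := h1 _ y01 d1; have := h2 _ y01 d2.
have -> : H (1 - m) = flow (1 - m) by apply: solution_flow; apply/andP; split; lra.
move=> a1 a2; have -> : H 1 - flow 1 = (H 1 - flow (1 - m)) - (flow 1 - flow (1 - m)) by ring.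
apply: (le_trans (ler_normB _ _)); lra.
Qed.

End Uniqueness.
End Autonomous_ode.

(** * The differential equation of the theorem *)

Section Fluid_limit.
Variables (R : realType) (piU piV : probability nat R) (C : nat).
Hypotheses (hU : sub_gaussian piU) (hV : sub_gaussian piV).
Hypotheses (muU_gt0 : 0 < mean piU) (muV_gt0 : 0 < mean piV) (C_gt0 : (0 < C)%N).

Lemma mass_entire (pi : probability nat R) : sub_gaussian pi -> entire (mass pi).
Proof. by move=> h; split=> [k|r r0]; [exact: mass_ge0|exact: exp_moment]. Qed.

Definition moment (pi : probability nat R) (j : nat) : R :=
  limn (series (fun k => mass pi k * k%:R ^+ j)).

Lemma sums_moment (pi : probability nat R) (j : nat) : sub_gaussian pi ->
  series (fun k => mass pi k * k%:R ^+ j) @ \oo --> moment pi j.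
Proof. by move=> h; apply: (@poly_moment R pi h j). Qed.

Let entU := mass_entire hU.
Let entV := mass_entire hV.

Definition hit_prob (g : R) : R := unsaturated (mass piU) C (clamp g) / mean piU.

Lemma hit_prob01 (g : R) : 0 <= hit_prob g <= 1.
Proof.
have c01 := clamp01 g.
rewrite /hit_prob divr_ge0 ?(ltW muU_gt0) //=; last exact: (unsaturated_ge0 C entU).
rewrite ler_pdivrMr // mul1r; apply: unsaturated_le => //; exact: sums_mean.
Qed.

Lemma hit_prob_lip : exists2 L, 0 <= L & forall x y, `|hit_prob x - hit_prob y| <= L * `|x - y|.
Proof.
have [L L0 H] := lipschitz01_clamp (unsaturated_lip C entU).
exists (L / mean piU); first by rewrite divr_ge0 // ltW.
move=> x y; rewrite /hit_prob -mulrBl normrM [`|_^-1|]ger0_norm ?invr_ge0 ?(ltW muU_gt0) //.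
by rewrite mulrAC ler_wpM2r // invr_ge0 ltW.
Qed.

Definition read_flow (g : R) : R := read_rate (mass piV) (hit_prob g).

Lemma read_flow_bound (g : R) : 0 <= read_flow g <= mean piV.
Proof. by apply: read_rate_bound => //; [exact: sums_mean|exact: hit_prob01]. Qed.

Lemma read_flow_lip : exists2 L, 0 <= L & forall x y, `|read_flow x - read_flow y| <= L * `|x - y|.
Proof.
have [L L0 H] := hit_prob_lip.
have m0 : 0 <= moment piV 2.
  have := @sums_ge_part R _ _ 0 _ (@sums_moment piV 2 hV); rewrite big_ord0; apply => k.
  by rewrite mulr_ge0 ?mass_ge0.
exists (moment piV 2 * L); first exact: mulr_ge0.
move=> x y; apply: (@le_trans _ _ (moment piV 2 * `|hit_prob x - hit_prob y|)).
  apply: (read_rate_lip (mu := mean piV)) => //; try exact: hit_prob01.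
    exact: sums_mean.
  exact: sums_moment.
by rewrite -mulrA ler_wpM2l.
Qed.

Definition speed (g : R) : R := read_flow g / mean piV.

Lemma speed_bound : exists2 c, 0 < c & forall g, c <= speed g <= 1.
Proof.
have [c c0 H] := read_rate_gt0 entV (sums_mean hV) muV_gt0.
exists (c / mean piV); first exact: divr_gt0.
move=> g; have /andP[_ q1] := read_flow_bound g.
by rewrite /speed ler_pM2r ?invr_gt0 // H ?hit_prob01 //= ler_pdivrMr // mul1r.
Qed.

Lemma speed_lip : exists2 L, 0 <= L & forall x y, `|speed x - speed y| <= L * `|x - y|.
Proof.
have [L L0 H] := read_flow_lip; exists (L / mean piV); first by rewrite divr_ge0 // ltW.
move=> x y; rewrite /speed -mulrBl normrM [`|_^-1|]ger0_norm ?invr_ge0 ?(ltW muV_gt0) //.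
by rewrite mulrAC ler_wpM2r // invr_ge0 ltW.
Qed.

Lemma speed_continuous : continuous speed.
Proof.
have [L L0 H] := speed_lip.
have L1 : 0 < L + 1 by rewrite ltr_wpDl.
move=> x; apply/cvgrPdist_lt => e e0; have er : 0 < e / (L + 1) by rewrite divr_gt0.
near=> y; apply: le_lt_trans (H x y) _.
have xy : `|x - y| < e / (L + 1) by near: y; apply: cvgr_dist_lt.
apply: (@le_lt_trans _ _ ((L + 1) * `|x - y|)); first by rewrite ler_wpM2r // lerDl.
by rewrite mulrC -ltr_pdivlMr.
Unshelve. all: by end_near. Qed.

Lemma gen_fun_derive (pi : probability nat R) j : sub_gaussian pi ->
  derive1n j (gen_fun pi) = gen_derive (mass pi) j.
Proof. by move=> h; apply: (@derive1n_gen R (mass pi) (mass_entire h)). Qed.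

Lemma Gamma_unsaturated : Gamma piU C = unsaturated (mass piU) C.
Proof.
apply/funext => g; rewrite /Gamma /unsaturated -derive1n1 (gen_fun_derive 1 hU).
rewrite -(big_mkord predT (fun k => g ^+ k / k`!%:R * gen_derive (mass piU) k.+1 (1 - g))).
rewrite [RHS]big_ltn // expr0 divr1 mul1r; congr (_ + _).
by apply: eq_bigr => k _; rewrite gen_fun_derive.
Qed.

Lemma limit_ratio_filled (g : R) : C%:R * limit_ratio piU C g = filled (mass piU) C g.
Proof.
rewrite /limit_ratio /filled mulrBr mulr1 big_mkord mulr_sumr; congr (_ - _).
apply: eq_bigr => k _; rewrite gen_fun_derive //; field.
by rewrite !pnatr_eq0 -!lt0n C_gt0 fact_gt0.
Qed.

(** Below 1 the hit probability is positive and the quotient of the equation is the division-free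
    average [read_rate]. At 1 it may be 0 / 0, where [speed] still makes sense. *)
Lemma rhs_speed (g : R) : 0 <= g < 1 -> ode_rhs piU piV C g = speed g.
Proof.
move=> /andP[g0 g1]; have g01 : 0 <= g <= 1 by rewrite g0 ltW.
have Gg : 0 < unsaturated (mass piU) C g.
  apply: (unsaturated_gt0 entU (@sums_mass R piU) (sums_mean hU)) => //; by rewrite g0.
rewrite /ode_rhs Gamma_unsaturated /speed /read_flow [(mean piU)^-1 * _]mulrC.
have -> : unsaturated (mass piU) C g / mean piU = hit_prob g by rewrite /hit_prob clamp_id.
have p0 : 0 < hit_prob g by rewrite /hit_prob clamp_id // divr_gt0.
rewrite [gen_fun _ _](_ : _ = gen_derive (mass piV) 0 (1 - hit_prob g)) //.
rewrite (read_rate_gen entV (sums_mean hV) (@sums_mass R piV) (hit_prob01 g)).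
have -> : mean piV / mean piU * unsaturated (mass piU) C g = mean piV * hit_prob g.
  by rewrite /hit_prob clamp_id //; ring.
by field; rewrite !gt_eqF.
Qed.

(** Two-sided at 0, because the uniqueness argument evaluates the right-hand side slightly below
    0. *)
Lemma rhs_continuous0 : {for 0, continuous (ode_rhs piU piV C)}.
Proof.
have cG := unsaturated_continuous (C := C) entU.
have cV := gen_derive_continuous (j := 0) entV.
have G0 : 0 < unsaturated (mass piU) C 0.
  by apply: (unsaturated_gt0 entU (@sums_mass R piU) (sums_mean hU)) => //; rewrite lexx ltr01.
rewrite /ode_rhs Gamma_unsaturated /=.
apply: cvgM; last first.
  apply: cvgV; first by rewrite gt_eqF // mulr_gt0 // divr_gt0.
  by apply: cvgM; [exact: cvg_cst|exact: cG].
apply: cvgB; first exact: cvg_cst.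
apply: (@cvg_comp _ _ _ (fun g => 1 - (mean piU)^-1 * unsaturated (mass piU) C g)
  (gen_derive (mass piV) 0)); last exact: cV.
apply: cvgB; first exact: cvg_cst.
by apply: cvgM; [exact: cvg_cst|exact: cG].
Qed.

Definition fluid : R -> R := flow speed.

Lemma fluid_solution : is_solution piU piV C fluid.
Proof.
have [c c0 cb] := speed_bound; have cc := speed_continuous.
split; [exact: (flow_within c0 cb cc)|exact: (flow0 c0 cb cc)|move=> s s01].
exact: (flow_solution c0 cb cc rhs_speed s01).
Qed.

Lemma fluid_unique (H : R -> R) : is_solution piU piV C H ->
  forall s : R, 0 <= s <= 1 -> H s = fluid s.
Proof.
move=> [Hc H0 Hd] s s01; have [c c0 cb] := speed_bound; have cc := speed_continuous.
apply: (solution_unique c0 cb cc rhs_speed rhs_continuous0 Hc H0 Hd s01).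
Qed.

End Fluid_limit.

(** * From the random degrees to the fluid limit *)

Lemma card_halfU N T (d : degrees N T) :
  #|{: halfU d}| = maxn (\sum_i d.1 i) (\sum_j d.2 j).
Proof.
rewrite card_tagged sumnE big_map big_enum /=.
under eq_bigr do rewrite card_ord.
rewrite (bigD1 None) //= (reindex_omap Some id) /=; last by case.
under [X in (_ + X)%N]eq_bigl do rewrite eqxx.
by rewrite addnC -maxnE.
Qed.

(** The large degrees are estimated through their complement: their sum is the total degree minus
    that of the small classes, both of which are controlled. *)
Lemma degree_error_bound (R : realType) (D0 N T : nat) (d : degrees N T) (pi : nat -> R) (mu : R) :
  degree_error D0 d pi <= `|(\sum_i d.1 i)%:R / N%:R - mu| + mean_tail pi mu D0
    + 2 * \sum_(D < D0) D%:R * `|(degree_count d D)%:R / N%:R - pi D|.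
Proof.
rewrite /degree_error /mean_tail.
set S := \sum_(D < D0) D%:R * _.
have cnt (D : nat) : \sum_(i | d.1 i == D) (d.1 i)%:R = D%:R * (degree_count d D)%:R :> R.
  rewrite (eq_bigr (fun=> D%:R)) => [|i /eqP -> //].
  by rewrite sumr_const mulr_natr.
have := @sum_by_degree R D0 N T d (fun i => (d.1 i)%:R).
rewrite (eq_bigr _ (fun (D : 'I_D0) _ => cnt D)).
rewrite -natr_sum => E.
have := ler_norm ((\sum_i d.1 i)%:R / N%:R - mu); rewrite E mulrDl mulr_suml => E1.
have E2 : \sum_(D < D0) pi D * D%:R <= \sum_(D < D0) D%:R * (degree_count d D)%:R / N%:R + S.
  rewrite -big_split /=; apply: ler_sum => D _.
  rewrite -[D%:R * _ / _]mulrA -mulrDr mulrC ler_wpM2l // -lerBlDl.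
  by apply: (le_trans (ler_norm _)); rewrite distrC.
have S0 : 0 <= S by apply: sumr_ge0 => D _; rewrite mulr_ge0.
lra.
Qed.

Section Fluid_deviation.
Variables (R : realType) (piU piV : probability nat R) (C : nat).
Hypotheses (hU : sub_gaussian piU) (hV : sub_gaussian piV).
Hypotheses (muU_gt0 : 0 < mean piU) (muV_gt0 : 0 < mean piV) (C_gt0 : (0 < C)%N).

Local Notation muU := (mean piU).
Local Notation muV := (mean piV).
Local Notation G := (fluid piU piV C).

Let entU := mass_entire hU.

Lemma fluid01 (s : R) : 0 <= s <= 1 -> 0 <= G s <= s.
Proof.
move=> s01; have [c c0 cb] := speed_bound C hU hV muU_gt0 muV_gt0.
exact: (flow_le c0 cb (@speed_continuous R piU piV C hU hV muU_gt0 muV_gt0)).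
Qed.

Lemma fluid_lip (s t : R) : 0 <= s <= 1 -> 0 <= t <= 1 -> `|G s - G t| <= `|s - t|.
Proof.
move=> s01 t01; have [c c0 cb] := speed_bound C hU hV muU_gt0 muV_gt0.
exact: (flow_lip c0 cb (@speed_continuous R piU piV C hU hV muU_gt0 muV_gt0)).
Qed.

Lemma fluid_derive (s : R) : 0 < s < 1 -> is_derive s 1 G (speed piU piV C (G s)).
Proof.
move=> s01; have [c c0 cb] := speed_bound C hU hV muU_gt0 muV_gt0.
exact: (flow_derive c0 cb (@speed_continuous R piU piV C hU hV muU_gt0 muV_gt0)).
Qed.

Lemma fluid_within : {within `[0, 1], continuous G}.
Proof. by have [] := fluid_solution hU hV muU_gt0 muV_gt0 C_gt0. Qed.

Lemma fluid0 : G 0 = 0.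
Proof. by have [] := fluid_solution hU hV muU_gt0 muV_gt0 C_gt0. Qed.

(** The mean value theorem over a time step 1 / T: the speed is taken at an intermediate point,
    which costs one Lipschitz constant times the step. *)
Lemma fluid_step (L : R) (T t : nat) : (t < T)%N ->
  (forall x y, `|read_flow piU piV C x - read_flow piU piV C y| <= L * `|x - y|) -> 0 <= L ->
  `|muV * T%:R * (G (t.+1%:R / T%:R) - G (t%:R / T%:R)) - read_flow piU piV C (G (t%:R / T%:R))|
  <= L / T%:R.
Proof.
move=> tT Llip L0; have T0 : 0 < T%:R :> R by rewrite ltr0n (leq_ltn_trans _ tT).
set a := t%:R / T%:R; set b := t.+1%:R / T%:R.
have ba : b - a = T%:R^-1 by rewrite /a /b -mulrBl -natr1 addrC addKr mul1r.
have iT : 0 < T%:R^-1 :> R by rewrite invr_gt0.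
have a0 : 0 <= a by rewrite divr_ge0.
have b1 : b <= 1 by rewrite ler_pdivrMr // mul1r ler_nat.
have ab : a < b by rewrite -subr_gt0 ba.
have dD (z : R) : z \in `]a, b[ -> is_derive z (1 : R) G (speed piU piV C (G z)).
  by rewrite in_itv /= => /andP[az zb]; apply: fluid_derive; apply/andP; split; lra.
have cD : {within `[a, b], continuous G}.
  apply: continuous_subspaceW fluid_within => z /=; rewrite !in_itv /= => /andP[az zb].
  by apply/andP; split; lra.
have [z] := MVT_segment (ltW ab) dD cD; rewrite in_itv /= => /andP[az zb] ->.
rewrite ba /speed.
have -> : muV * T%:R * (read_flow piU piV C (G z) / muV / T%:R) = read_flow piU piV C (G z).
  by field; rewrite !gt_eqF.
apply: (le_trans (Llip _ _)); rewrite ler_wpM2l //.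
apply: (le_trans (fluid_lip _ _)); [lra|lra|].
by rewrite ger0_norm ?subr_ge0 // -ba; lra.
Qed.

Definition filled_clamp (g : R) : R := filled (mass piU) C (clamp g).

Variables (s0 lip K3 : R).
Hypotheses (s01 : 0 <= s0 < 1) (lip_ge0 : 0 <= lip).
Hypothesis p_lip : forall x y,
  `|hit_prob piU C x - hit_prob piU C y| <= lip * `|x - y|.
Hypothesis filled_lip : forall x y, `|filled_clamp x - filled_clamp y| <= lip * `|x - y|.

Let delta : R := (1 - s0) / 4.
Let Qc : R := quenched_const muU lip delta K3.

Lemma quenched_fluid (theta : R) (D0 : nat) :
  0 < theta <= 1 / 2 -> theta <= delta -> mean_tail (mass piU) muU D0 <= theta / 4 ->
  exists N0 : nat, forall (N T : nat) (d : degrees N T) (g : nat -> R),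
  let n := muU * N%:R in let k := Num.truncn (s0 * T%:R) in
  (N0 <= N)%N -> 0 < n -> n = muV * T%:R ->
  `|(\sum_i d.1 i)%:R / n - 1| <= theta ->
  `|(\sum_i d.1 i)%:R / N%:R - muU| <= theta / 4 ->
  `|(\sum_j d.2 j)%:R / n - 1| <= theta ->
  (spent d k)%:R <= n * (s0 + theta) ->
  \sum_(D < D0) D%:R * `|(degree_count d D)%:R / N%:R - mass piU D| <= theta / 4 ->
  \sum_(t < T) (d.2 t)%:R ^+ 3 <= K3 * N%:R ->
  g 0%N = 0 ->
  (forall t : 'I_T, n * g t.+1 = n * g t + mean_reads (d.2 t) (hit_prob piU C (g t))) ->
  expect C (fun Q : {set halfU d} =>
     ((\sum_i loads C Q i)%:R / N%:R - filled (mass piU) C (G s0)) ^+ 2) k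
  <= 2 * (Qc * theta ^+ 2) + 2 * (lip * `|g k - G s0|) ^+ 2.
Proof.
move=> th12 thd tail; have /andP[th0 thalf] := th12; have /andP[s00 s11] := s01.
have delta0 : 0 < delta by rewrite /delta; lra.
have sU := sums_mean hU.
have apU : approximates (mass piU) (fun rho => muU * (1 - rho) * hit_prob piU C rho)
    (open_half_edges R C) D0 theta.
  move=> rho r01; apply: le_trans (_ : mean_tail (mass piU) muU D0 <= theta); last lra.
  have -> : muU * (1 - rho) * hit_prob piU C rho = (1 - rho) * unsaturated (mass piU) C rho.
    by rewrite /hit_prob clamp_id //; field; rewrite gt_eqF.
  by apply: unsaturated_approx.
have apF : approximates (mass piU) filled_clamp (capped_load R C) D0 theta.
  move=> rho r01; apply: le_trans (_ : mean_tail (mass piU) muU D0 <= theta); last lra.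
  by rewrite /filled_clamp clamp_id //; apply: filled_approx => //; exact: sums_mass.
have [N0 H] := @quenched_matching R C (mass piU) muU lip delta K3 (hit_prob piU C) filled_clamp
   muU_gt0 lip_ge0 delta0 (hit_prob01 C hU muU_gt0) p_lip filled_lip theta D0 th12 apU apF.
exists N0 => N T d g n k N0N n0 nT sumU sumU' sumV sp cnt cube g0 grec.
have N0' : 0 < N%:R :> R by move: n0; rewrite /n pmulr_rgt0.
have T0' : 0 < T%:R :> R by move: n0; rewrite nT pmulr_rgt0.
have kT : (k <= T)%N.
  rewrite -(ler_nat R); apply: (@le_trans _ _ (s0 * T%:R)).
    by rewrite /k; have /andP[] := truncn_itv (mulr_ge0 s00 (ltW T0')).
  by rewrite ler_piMl // ltW.
have cM : #|{: halfU d}| = maxn (\sum_i d.1 i) (\sum_j d.2 j) := card_halfU d.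
have Mn : `|#|{: halfU d}|%:R / n - 1| <= theta.
  by rewrite cM /maxn; case: ifP.
have derr : degree_error D0 d (mass piU) <= theta.
  apply: (le_trans (degree_error_bound _ _ _ muU)).
  apply: (@le_trans _ _ (theta / 4 + theta / 4 + 2 * (theta / 4))); last lra.
  by rewrite lerD ?ler_pM2l // lerD.
(* With s0 = 1 - 4 delta and theta <= delta, at most (1 - 3 delta) n half-edges are spent, while (1
   - delta)(1 - theta) >= 1 - 2 delta and M >= (1 - theta) n. *)
have spM : delta * #|{: halfU d}|%:R + (spent d k)%:R <= #|{: halfU d}|%:R.
  move: Mn; rewrite ler_norml; set M := #|_|%:R => /andP[m1 _].
  have m2 : (1 - theta) * n <= M by rewrite -ler_pdivlMr //; lra.
  have sE : s0 = 1 - 4 * delta by rewrite /delta; lra.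
  have c1 : s0 + theta <= (1 - delta) * (1 - theta).
    by rewrite sE; nra.
  have c2 : 0 <= 1 - delta by rewrite /delta; lra.
  have : (s0 + theta) * n <= (1 - delta) * ((1 - theta) * n).
    by rewrite mulrA ler_pM2r.
  have : (1 - delta) * ((1 - theta) * n) <= (1 - delta) * M by rewrite ler_wpM2l.
  by lra.
have := H N T d k g N0N kT Mn derr cube spM g0 grec => {}H.
have Gs : 0 <= G s0 <= 1.
  have s0i : 0 <= s0 <= 1 by rewrite s00 ltW.
  by have /andP[-> h] := fluid01 s0i; lra.
have E0 : filled (mass piU) C (G s0) = filled_clamp (G s0) by rewrite /filled_clamp clamp_id.
rewrite E0.
pose X (Q : {set halfU d}) : R := (\sum_i loads C Q i)%:R / N%:R - filled_clamp (g k).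
have a0 : 0 <= 2 * (lip * `|g k - G s0|) ^+ 2 by rewrite mulr_ge0 ?sqr_ge0.
apply: (@le_trans _ _ (expect C (fun Q => 2 * X Q ^+ 2 + 2 * (lip * `|g k - G s0|) ^+ 2) k)).
  apply: expect_le => f _; set Q := reads _ _ _.
  have -> : (\sum_i loads C Q i)%:R / N%:R - filled_clamp (G s0)
     = X Q + (filled_clamp (g k) - filled_clamp (G s0)) by rewrite /X; ring.
  apply: (le_trans (sqrD_le _ _)); rewrite lerD2l ler_pM2l //.
  exact: sqr_le_norm (filled_lip _ _).
rewrite expectD expectZ; apply: lerD; first by rewrite ler_pM2l.
exact: (@expect_cst_le R N T C d).
Qed.

End Fluid_deviation.

(** * Second moments of degree sums under the truncated laws *)

Section Truncated_sums.
Variables (R : realType) (pi : nat -> R) (B T : nat).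
Hypothesis pi_ge0 : forall k, 0 <= pi k.
Hypothesis pi_sum : series pi @ \oo --> (1 : R).
Local Notation w := (@truncated R pi B).

Let w_ge0 := @truncated_ge0 R pi B pi_ge0 pi_sum.
Let w_sum := @truncated_sum R pi B.

Definition centered (mu : R) (a : 'I_B.+1) : R := (a : nat)%:R - mu.

Lemma truncated_centered_sq (mu m2 : R) (k : nat) : (k <= T)%N ->
  series (fun k => pi k * k%:R ^+ 2) @ \oo --> m2 ->
  iid_mean w (fun c : {ffun 'I_T -> 'I_B.+1} => psum (centered mu) k c ^+ 2)
  <= T%:R * (2 * m2 + 2 * mu ^+ 2) + T%:R ^+ 2 * mean_tail pi mu B.+1 ^+ 2.
Proof.
move=> kT sm2; apply: (le_trans (iid_psum_sq w_ge0 w_sum _ kT)).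
have kTr : k%:R <= T%:R :> R by rewrite ler_nat.
have -> : \sum_a w a * centered mu a = - mean_tail pi mu B.+1.
  rewrite /centered; under eq_bigr do rewrite mulrBr.
  rewrite big_split /= sumrN -mulr_suml w_sum mul1r.
  by rewrite (@truncated_mean R pi B (fun k => k%:R)) // /mean_tail opprB.
rewrite sqrrN; apply: lerD; apply: ler_pM => //.
- by apply: sumr_ge0 => a _; rewrite mulr_ge0 ?sqr_ge0.
- apply: (@le_trans _ _ (\sum_a (2 * (w a * (a : nat)%:R ^+ 2) + w a * (2 * mu ^+ 2)))).
    apply: ler_sum => a _; rewrite [X in _ <= X + _]mulrCA -mulrDr ler_wpM2l //.
    by have := sqrD_le (a : nat)%:R (- mu); rewrite sqrrN.
  rewrite big_split /= -mulr_sumr -mulr_suml w_sum mul1r lerD2r ler_pM2l //.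
  exact: truncated_moment.
- exact: sqr_ge0.
- by rewrite lerXn2r ?nnegrE.
Qed.

(** The factor [D] is the weight of [degree_error]; it also annihilates the class 0, the only one
    whose frequency is altered by truncation. *)
Definition counter (D : nat) (a : 'I_B.+1) : R := D%:R * ((a == D :> nat)%:R - pi D).

Lemma truncated_counter_sq (D : nat) : (D <= B)%N ->
  iid_mean w (fun c : {ffun 'I_T -> 'I_B.+1} => psum (counter D) T c ^+ 2) <= T%:R * D%:R ^+ 2.
Proof.
move=> DB; have pi1 : pi D <= 1.
  apply: le_trans (@sums_ge_part R _ _ D.+1 pi_ge0 pi_sum).
  by rewrite big_ord_recr /= lerDr sumr_ge0.
apply: (le_trans (iid_psum_sq w_ge0 w_sum _ (leqnn T))).
have -> : \sum_a w a * counter D a = 0.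
  rewrite /counter; under eq_bigr do rewrite mulrBr mulrBr mulrCA.
  rewrite big_split /= -mulr_sumr sumrN -mulr_suml w_sum mul1r.
  have [->|D0] := posnP D; first by rewrite !mul0r subrr.
  rewrite (@truncated_mean R pi B (fun k => (k == D)%:R)); last by rewrite ltn_eqF.
  rewrite (bigD1 (Ordinal (DB : (D < B.+1)%N))) //= eqxx mulr1 big1 ?addr0 ?subrr // => i.
  by rewrite -val_eqE /= => /negPf ->; rewrite mulr0.
rewrite expr0n mulr0 addr0 ler_wpM2l //.
rewrite -[leRHS]mul1r -[X in _ <= X * _]w_sum mulr_suml; apply: ler_sum => a _.
rewrite ler_wpM2l // exprMn ler_piMr ?sqr_ge0 // -[leRHS](expr1n _ 2).
apply: sqr_le_norm; have := pi_ge0 D.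
by case: eqP => _ p0; rewrite ler_norml ?mulr1n ?mulr0n; apply/andP; split; lra.
Qed.

Lemma truncated_cube (m3 : R) :
  series (fun k => pi k * k%:R ^+ 3) @ \oo --> m3 ->
  iid_mean w (fun c : {ffun 'I_T -> 'I_B.+1} => psum (fun a : 'I_B.+1 => (a : nat)%:R ^+ 3) T c)
  <= T%:R * m3.
Proof.
by move=> s3; rewrite iid_psum // ler_wpM2l // truncated_moment.
Qed.

End Truncated_sums.

Section Bounded_degrees.
Variables (R : realType) (N T B : nat).
Variables (a : {ffun 'I_N -> 'I_B.+1}) (b : {ffun 'I_T -> 'I_B.+1}).

Definition degs : degrees N T := ([ffun i => nat_of_ord (a i)], [ffun j => nat_of_ord (b j)]).

Lemma psum_centered (mu : R) (k : nat) : (k <= T)%N ->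
  psum (centered mu) k b = (spent degs k)%:R - k%:R * mu.
Proof.
move=> kT; rewrite /psum /centered big_split /= sumrN /spent natr_sum.
congr (_ - _); first by apply: eq_bigr => t _; rewrite ffunE.
by rewrite -(big_ord_widen T (fun=> mu) kT) sumr_const card_ord mulr_natl.
Qed.

Lemma psum_counter (pi : nat -> R) (D : nat) :
  psum (counter pi D) N a = D%:R * ((degree_count degs D)%:R - N%:R * pi D).
Proof.
rewrite /psum /counter (eq_bigl predT) => [|i]; last by rewrite ltn_ord.
rewrite -mulr_sumr big_split /= sumrN sumr_const card_ord [N%:R * _]mulr_natl; congr (_ * (_ - _)).
rewrite /degree_count -sum1_card natr_sum [RHS]big_mkcond /=.
by apply: eq_bigr => i _; rewrite inE ffunE; case: eqP.
Qed.

End Bounded_degrees.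

Lemma psum_centered_all (R : realType) N B (a : {ffun 'I_N -> 'I_B.+1}) (mu : R) :
  psum (centered mu) N a = (\sum_i (a i : nat))%:R - N%:R * mu.
Proof.
rewrite /psum [LHS](eq_bigl predT) => [|i]; last exact: ltn_ord.
by rewrite big_split /= sumrN sumr_const card_ord mulr_natl natr_sum.
Qed.

Lemma sqr_lt_norm (R : realType) (x t : R) : 0 < t -> x ^+ 2 / t ^+ 2 < 1 -> `|x| <= t.
Proof.
move=> t0; rewrite ltr_pdivrMr ?exprn_gt0 // mul1r => /ltW.
by rewrite -[x ^+ 2]real_normK ?num_real // ler_pXn2r // nnegrE // ltW.
Qed.

Section Deviation.
Variables (R : realType) (C N T : nat).

Definition deviation (d : degrees N T) (k : nat) (L : R) : R :=
  expect C (fun Q : {set halfU d} => ((\sum_i loads C Q i)%:R / N%:R - L) ^+ 2) k.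

Lemma deviation_ge0 d k L : 0 <= deviation d k L.
Proof. by apply: expect_ge0 => Q; exact: sqr_ge0. Qed.

Lemma deviation_le d k L : (0 < N)%N -> 0 <= L <= C%:R -> deviation d k L <= C%:R ^+ 2.
Proof.
move=> N0 /andP[L0 LC]; apply: (@le_trans _ _ (expect C (fun Q : {set halfU d} => C%:R ^+ 2 : R) k)).
  apply: expect_le => f _; apply: sqr_le_norm.
  have : (\sum_i loads C (reads C f k) i)%:R / N%:R <= C%:R :> R.
    rewrite ler_pdivrMr ?ltr0n // -natrM ler_nat.
    apply: (@leq_trans (\sum_(i < N) C)); last by rewrite sum_nat_const card_ord mulnC.
    by apply: leq_sum => i _; rewrite ffunE geq_minl.
  have : 0 <= (\sum_i loads C (reads C f k) i)%:R / N%:R :> R by rewrite divr_ge0.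
  by rewrite ler_norml => *; apply/andP; split; lra.
by apply: (@expect_cst_le R N T C d); exact: sqr_ge0.
Qed.

End Deviation.

Lemma quenched_const_ge0 (R : realType) (mu lip delta K3 : R) :
  0 < mu -> 0 <= lip -> 0 < delta -> 0 <= K3 -> 0 <= quenched_const mu lip delta K3.
Proof.
move=> mu0 l0 d0 K0; have q1 : 0 <= quenched_const1 mu lip delta.
  by rewrite mulr_ge0 // addr_ge0 ?sqr_ge0 // addr_ge0 ?sqr_ge0 // mulr_ge0 ?sqr_ge0.
have K1 : 0 <= K3 / mu by rewrite divr_ge0 // ltW.
rewrite addr_ge0 // mulr_ge0 ?mulr_ge0 ?sqr_ge0 // addr_ge0 // mulr_ge0 //.
apply: mulr_ge0; first by apply: mulr_ge0 => //; exact: expR_ge0.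
by rewrite !addr_ge0.
Qed.

(** * Paying for atypical degrees *)

Section Degree_penalty.
Variables (R : realType) (piU piV : probability nat R) (C : nat).
Hypotheses (hU : sub_gaussian piU) (hV : sub_gaussian piV).
Hypotheses (muU_gt0 : 0 < mean piU) (muV_gt0 : 0 < mean piV).
Variables (s0 lip K3 theta : R) (D0 : nat).
Hypotheses (s01 : 0 <= s0 < 1) (lip_ge0 : 0 <= lip) (K3_gt0 : 0 < K3).
Hypothesis p_lip : forall x y,
  `|hit_prob piU C x - hit_prob piU C y| <= lip * `|x - y|.
Hypothesis F_lip : forall x y,
  `|filled_clamp piU C x - filled_clamp piU C y| <= lip * `|x - y|.
Hypothesis theta12 : 0 < theta <= 1 / 2.
Hypothesis theta_delta : theta <= (1 - s0) / 4.
Hypothesis tail_theta : mean_tail (mass piU) (mean piU) D0 <= theta / 4.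

Local Notation muU := (mean piU).
Local Notation muV := (mean piV).
Local Notation G := (fluid piU piV C).
Local Notation L := (filled (mass piU) C (G s0)).
Local Notation Qc := (quenched_const muU lip ((1 - s0) / 4) K3).

(** One threshold for two requirements on the first total degree: within [theta] of 1 after division
    by n, and within [theta / 4] of the mean after division by N. *)
Definition theta1 : R := Num.min theta (theta / 4 / muU).
(** Shares [theta / 4] among [D0] classes; the successor avoids a division by 0. *)
Definition theta2 : R := theta / 4 / D0.+1%:R.

Lemma theta1_gt0 : 0 < theta1.
Proof. by have /andP[t0 _] := theta12; rewrite lt_min t0 !divr_gt0. Qed.

Lemma theta2_gt0 : 0 < theta2.
Proof. by have /andP[t0 _] := theta12; rewrite !divr_gt0. Qed.

(* At least 1 when the degrees are atypical; [deviation_le] is then enough. *)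
Definition penalty N T B (a : {ffun 'I_N -> 'I_B.+1}) (b : {ffun 'I_T -> 'I_B.+1}) (k : nat) : R :=
  let n := muU * N%:R in
  (psum (centered muU) N a / n) ^+ 2 / theta1 ^+ 2
  + (psum (centered muV) T b / n) ^+ 2 / theta1 ^+ 2
  + (psum (centered muV) k b / n) ^+ 2 / theta1 ^+ 2
  + \sum_(D < D0) (psum (counter (mass piU) D) N a / N%:R) ^+ 2 / theta2 ^+ 2
  + psum (fun x : 'I_B.+1 => (x : nat)%:R ^+ 3) T b / (K3 * N%:R).

Lemma deviation_penalty : exists N0 : nat, forall (N T B : nat)
    (a : {ffun 'I_N -> 'I_B.+1}) (b : {ffun 'I_T -> 'I_B.+1}),
  let n := muU * N%:R in let k := Num.truncn (s0 * T%:R) in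
  (N0 <= N)%N -> (0 < N)%N -> n = muV * T%:R ->
  deviation C (degs a b) k L
  <= 2 * (Qc * theta ^+ 2) + 2 * (lip * `|mean_path n (hit_prob piU C) b k - G s0|) ^+ 2
     + C%:R ^+ 2 * penalty a b k.
Proof.
have [N0 H] := quenched_fluid hU hV muU_gt0 muV_gt0 K3 s01 lip_ge0 p_lip F_lip
  theta12 theta_delta tail_theta.
exists N0 => N T B a b n k N0N N1 nT; have N0' : 0 < N%:R :> R by rewrite ltr0n.
have n0 : 0 < n by rewrite mulr_gt0.
have T0 : 0 < T%:R :> R by move: n0; rewrite nT pmulr_rgt0.
have /andP[s00 s0lt] := s01.
have ks : k%:R <= s0 * T%:R by have /andP[] := truncn_itv (mulr_ge0 s00 (ltW T0)).
have kT : (k <= T)%N by rewrite -(ler_nat R) (le_trans ks) // ler_piMl // ltW.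
have t1 := theta1_gt0; have t2 := theta2_gt0; have /andP[th0 _] := theta12.
have Qc0 : 0 <= 2 * (Qc * theta ^+ 2).
  apply: mulr_ge0 => //; apply: mulr_ge0; last exact: sqr_ge0.
  by apply: quenched_const_ge0 => //; [rewrite divr_gt0 // subr_gt0|exact: ltW].
have Ls : 0 <= L <= C%:R.
  have s0i : 0 <= s0 <= 1 by rewrite s00 ltW.
  apply: filled_bound; [exact: mass_entire|exact: sums_mass|].
  by have /andP[-> h] := fluid01 C hU hV muU_gt0 muV_gt0 s0i; lra.
pose g := mean_path n (hit_prob piU C) b.
set e1 := (psum (centered muU) N a / n) ^+ 2 / theta1 ^+ 2.
set e2 := (psum (centered muV) T b / n) ^+ 2 / theta1 ^+ 2.
set e3 := (psum (centered muV) k b / n) ^+ 2 / theta1 ^+ 2.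
set e4 := \sum_(D < D0) (psum (counter (mass piU) D) N a / N%:R) ^+ 2 / theta2 ^+ 2.
set e5 := psum (fun x : 'I_B.+1 => (x : nat)%:R ^+ 3) T b / (K3 * N%:R).
have sq_div (x t : R) : 0 <= x ^+ 2 / t ^+ 2 by rewrite divr_ge0 ?sqr_ge0.
have p1 : 0 <= e1 by exact: sq_div.
have p2 : 0 <= e2 by exact: sq_div.
have p3 : 0 <= e3 by exact: sq_div.
have p4 : 0 <= e4 by apply: sumr_ge0 => D _; exact: sq_div.
have p5 : 0 <= e5.
  by rewrite divr_ge0 ?mulr_ge0 ?(ltW K3_gt0) //; apply: sumr_ge0 => t _; rewrite exprn_ge0.
have pE : penalty a b k = e1 + e2 + e3 + e4 + e5 by [].
have lz : 0 <= 2 * (lip * `|g k - G s0|) ^+ 2 by rewrite mulr_ge0 ?sqr_ge0.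
(* All five terms are nonnegative, so a penalty below 1 bounds each by 1, which yields the
   typicality conditions of the quenched estimate. *)
have [bad|good] := leP 1 (penalty a b k).
  apply: (le_trans (deviation_le (degs a b) k N1 Ls)).
  have : C%:R ^+ 2 * 1 <= C%:R ^+ 2 * penalty a b k by rewrite ler_wpM2l ?sqr_ge0.
  by rewrite -/g; lra.
have [g1 g2 g3 g4 g5] : [/\ e1 < 1, e2 < 1, e3 < 1, e4 < 1 & e5 < 1].
  by move: good; rewrite pE; split; lra.
have q1 := sqr_lt_norm t1 g1; have q2 := sqr_lt_norm t1 g2; have q3 := sqr_lt_norm t1 g3.
have [t1a t1b] : theta1 <= theta /\ theta1 <= theta / 4 / muU.
  by rewrite /theta1 !ge_min !lexx orbT.
have sU : (\sum_i (degs a b).1 i)%:R = (\sum_i (a i : nat))%:R :> R.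
  by congr (_%:R); apply: eq_bigr => i _; rewrite ffunE.
have sV : (\sum_j (degs a b).2 j)%:R = (\sum_j (b j : nat))%:R :> R.
  by congr (_%:R); apply: eq_bigr => i _; rewrite ffunE.
have pen0 : 0 <= C%:R ^+ 2 * penalty a b k.
  by rewrite mulr_ge0 ?sqr_ge0 // pE !addr_ge0.
apply: (@le_trans _ _ (2 * (Qc * theta ^+ 2) + 2 * (lip * `|g k - G s0|) ^+ 2)); last first.
  by rewrite lerDl.
apply: (H N T (degs a b) g) => //.
- rewrite sU; move: q1; rewrite psum_centered_all.
  have -> : ((\sum_i (a i : nat))%:R - N%:R * muU) / n = (\sum_i (a i : nat))%:R / n - 1.
    by rewrite /n; field; rewrite !gt_eqF.
  by move=> h; apply: le_trans h _.
- rewrite sU; move: q1; rewrite psum_centered_all.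
  have -> : ((\sum_i (a i : nat))%:R - N%:R * muU) / n
     = ((\sum_i (a i : nat))%:R / N%:R - muU) / muU.
    by rewrite /n; field; rewrite !gt_eqF.
  rewrite normrM [`|_^-1|]ger0_norm ?invr_ge0 ?(ltW muU_gt0) // => h.
  by have := le_trans h t1b; rewrite ler_pM2r // invr_gt0.
- rewrite sV; move: q2; rewrite psum_centered_all.
  have -> : ((\sum_j (b j : nat))%:R - T%:R * muV) / n = (\sum_j (b j : nat))%:R / n - 1.
    by rewrite nT; field; rewrite !gt_eqF.
  by move=> h; apply: le_trans h _.
- move: q3; rewrite (psum_centered a) // normrM [`|_^-1|]ger0_norm ?invr_ge0 ?(ltW n0) //.
  rewrite ler_pdivrMr // ler_norml => /andP[_].
  have : k%:R * muV <= n * s0 by rewrite nT; nra.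
  have : theta1 * n <= theta * n by rewrite ler_pM2r.
  by rewrite -/n -/k => *; lra.
- apply: (@le_trans _ _ (\sum_(D < D0) theta2)); last first.
    rewrite sumr_const card_ord -[leLHS]mulr_natl /theta2 mulrA ler_pdivrMr ?ltr0n //.
    by rewrite mulrC ler_pM2l ?ler_nat // divr_gt0.
  apply: ler_sum => D _.
  have : (psum (counter (mass piU) D) N a / N%:R) ^+ 2 / theta2 ^+ 2 < 1.
    by apply: le_lt_trans g4; rewrite /e4 (bigD1 D) //= lerDl sumr_ge0.
  move/(sqr_lt_norm t2); apply: le_trans; rewrite (psum_counter a b).
  rewrite -mulrA normrM ger0_norm // ler_wpM2l // mulrBl [N%:R * _]mulrC mulfK // gt_eqF //.
- move: g5; rewrite /e5 ltr_pdivrMr ?mulr_gt0 // mul1r => /ltW; apply: le_trans.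
  rewrite /psum [leRHS](eq_bigl predT) => [|t]; last exact: ltn_ord.
  by rewrite le_eqVlt; apply/orP; left; apply/eqP/eq_bigr => t _; rewrite ffunE.
- move=> t; rewrite /g mean_pathS ffunE mulrDr mulrCA divff ?mulr1 // gt_eqF //.
Qed.

End Degree_penalty.

Section Product_mean.
Variables (R : realType) (A B : finType) (N T : nat) (u : A -> R) (v : B -> R).
Hypotheses (u_ge0 : forall x, 0 <= u x) (v_ge0 : forall y, 0 <= v y).
Hypotheses (u_sum : \sum_x u x = 1) (v_sum : \sum_y v y = 1).
Implicit Types F : {ffun 'I_N -> A} -> {ffun 'I_T -> B} -> R.

Definition pair_mean F : R := iid_mean u (fun a => iid_mean v (F a)).

Lemma pair_mean_le F1 F2 : (forall a b, F1 a b <= F2 a b) -> pair_mean F1 <= pair_mean F2.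
Proof. by move=> F12; apply: iid_le => // a; apply: iid_le. Qed.

Lemma pair_meanD F1 F2 : pair_mean (fun a b => F1 a b + F2 a b) = pair_mean F1 + pair_mean F2.
Proof. by rewrite -iid_D; apply: eq_bigr => a _; rewrite iid_D. Qed.

Lemma pair_meanZ x F : pair_mean (fun a b => x * F a b) = x * pair_mean F.
Proof. by rewrite -iid_Z; apply: eq_bigr => a _; rewrite iid_Z. Qed.

Lemma pair_mean_fst f : pair_mean (fun a _ => f a) = iid_mean u f.
Proof. by apply: eq_bigr => a _; rewrite iid_const. Qed.

Lemma pair_mean_snd f : pair_mean (fun _ b => f b) = iid_mean v f.
Proof. exact: iid_const. Qed.

Lemma pair_mean_const x : pair_mean (fun _ _ => x) = x.
Proof. by rewrite pair_mean_fst iid_const. Qed.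

End Product_mean.

Lemma scaled_sq_mean (R : realType) (A : finType) (w : A -> R) (m : nat) (t n x : R)
  (P : {ffun 'I_m -> A} -> R) :
  iid_mean w (fun c => P c ^+ 2) <= x ->
  iid_mean w (fun c => (P c / n) ^+ 2 / t ^+ 2) <= x / (n ^+ 2 * t ^+ 2).
Proof.
move=> H; rewrite (_ : iid_mean _ _ = (n ^+ 2 * t ^+ 2)^-1 * iid_mean w (fun c => P c ^+ 2)).
  by rewrite [leRHS]mulrC ler_wpM2l // invr_ge0 mulr_ge0 ?sqr_ge0.
rewrite -iid_Z; apply: eq_bigr => c _; congr (_ * _).
by rewrite expr_div_n [RHS]mulrC [X in _ = _ * X]invfM mulrA.
Qed.

(** * The mean square deviation over bounded random degrees *)

Section Mean_deviation.
Variables (R : realType) (piU piV : probability nat R) (C : nat).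
Hypotheses (hU : sub_gaussian piU) (hV : sub_gaussian piV).
Hypotheses (muU_gt0 : 0 < mean piU) (muV_gt0 : 0 < mean piV) (C_gt0 : (0 < C)%N).
Variables (s0 lip K3 theta : R) (D0 : nat).
Hypotheses (s01 : 0 <= s0 < 1) (lip_ge0 : 0 <= lip) (K3_gt0 : 0 < K3).

Local Notation muU := (mean piU).
Local Notation muV := (mean piV).
Local Notation G := (fluid piU piV C).
Local Notation wU B := (@truncated R (mass piU) B).
Local Notation wV B := (@truncated R (mass piV) B).
Local Notation tailU B := (mean_tail (mass piU) muU B.+1).
Local Notation tailV B := (mean_tail (mass piV) muV B.+1).

Let pU0 := @mass_ge0 R piU.
Let pV0 := @mass_ge0 R piV.
Let sU := @sums_mass R piU.
Let sV := @sums_mass R piV.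

Let varU : R := 2 * moment piU 2 + 2 * muU ^+ 2.
Let varV : R := 2 * moment piV 2 + 2 * muV ^+ 2.

Lemma moment_ge0 (pi : probability nat R) j : sub_gaussian pi -> 0 <= moment pi j.
Proof.
move=> h; have := @sums_ge_part R _ _ 0 _ (@sums_moment R pi j h); rewrite big_ord0; apply => k.
by rewrite mulr_ge0 ?mass_ge0.
Qed.

Section Fixed_size.
Variables (N T B k : nat).
Hypotheses (N_gt0 : (0 < N)%N) (NT : muU * N%:R = muV * T%:R) (kT : (k <= T)%N).

Let N0 : 0 < N%:R :> R. Proof. by rewrite ltr0n. Qed.
Let n0 : 0 < muU * N%:R. Proof. exact: mulr_gt0. Qed.
Let T0 : 0 < T%:R :> R. Proof. by move: n0; rewrite NT pmulr_rgt0. Qed.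
Let invT : T%:R^-1 = muV / muU / N%:R :> R.
Proof. by have -> : T%:R = muU * N%:R / muV; [rewrite NT; field|field]; rewrite ?gt_eqF. Qed.

Let A1 : R := (theta1 piU theta ^+ 2)^-1.
Let A2 : R := (theta2 theta D0 ^+ 2)^-1.

(** Collects the variances, which decay like 1 / N; [penalty_const2] collects the truncation biases,
    which decay only with [B]. *)
Definition penalty_const1 : R :=
  A1 * (varU / muU ^+ 2 + 2 * (varV / (muU * muV))) + A2 * \sum_(D < D0) D%:R ^+ 2.
Definition penalty_const2 : R := A1 * (muU ^- 2 + 2 * muV ^- 2).

Lemma centeredU_mean :
  iid_mean (wU B) (fun a : {ffun 'I_N -> 'I_B.+1} =>
    (psum (centered muU) N a / (muU * N%:R)) ^+ 2 / theta1 piU theta ^+ 2)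
  <= A1 * (varU / muU ^+ 2 / N%:R + muU ^- 2 * tailU B ^+ 2).
Proof.
have := truncated_centered_sq B pU0 sU muU (leqnn N) (@sums_moment R piU 2 hU).
move/(scaled_sq_mean (theta1 piU theta) (muU * N%:R))/le_trans; apply.
rewrite -/varU le_eqVlt; apply/orP; left; apply/eqP; rewrite /A1 [X in _ * X]invfM.
set y := (theta1 _ _ ^+ 2)^-1.
by field; rewrite !gt_eqF.
Qed.

Lemma centeredV_mean j : (j <= T)%N ->
  iid_mean (wV B) (fun b : {ffun 'I_T -> 'I_B.+1} =>
    (psum (centered muV) j b / (muU * N%:R)) ^+ 2 / theta1 piU theta ^+ 2)
  <= A1 * (varV / (muU * muV) / N%:R + muV ^- 2 * tailV B ^+ 2).
Proof.
move=> jT; have := truncated_centered_sq B pV0 sV muV jT (@sums_moment R piV 2 hV).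
move/(scaled_sq_mean (theta1 piU theta) (muU * N%:R))/le_trans; apply.
rewrite -/varV le_eqVlt; apply/orP; left; apply/eqP; rewrite /A1 [X in _ * X]invfM.
set y := (theta1 _ _ ^+ 2)^-1.
have -> : T%:R = muU * N%:R / muV :> R by rewrite NT; field; rewrite gt_eqF.
by field; rewrite !gt_eqF.
Qed.

Lemma counter_mean D : (D <= B)%N ->
  iid_mean (wU B) (fun a : {ffun 'I_N -> 'I_B.+1} =>
    (psum (counter (mass piU) D) N a / N%:R) ^+ 2 / theta2 theta D0 ^+ 2)
  <= A2 * D%:R ^+ 2 / N%:R.
Proof.
move=> DB; have := truncated_counter_sq N pU0 sU DB.
move/(scaled_sq_mean (theta2 theta D0) N%:R)/le_trans; apply.
rewrite le_eqVlt; apply/orP; left; apply/eqP; rewrite /A2 [X in _ * X]invfM.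
set y := (theta2 _ _ ^+ 2)^-1.
by field; rewrite !gt_eqF.
Qed.

Lemma cube_mean :
  iid_mean (wV B) (fun b : {ffun 'I_T -> 'I_B.+1} =>
    psum (fun x : 'I_B.+1 => (x : nat)%:R ^+ 3) T b / (K3 * N%:R))
  <= muU / muV * moment piV 3 / K3.
Proof.
rewrite (_ : iid_mean _ _ = (K3 * N%:R)^-1 * iid_mean (wV B)
   (fun b : {ffun 'I_T -> 'I_B.+1} => psum (fun x : 'I_B.+1 => (x : nat)%:R ^+ 3) T b)).
  apply: (@le_trans _ _ ((K3 * N%:R)^-1 * (T%:R * moment piV 3))).
    rewrite ler_wpM2l ?invr_ge0 ?mulr_ge0 ?(ltW K3_gt0) //.
    exact: (truncated_cube B T pV0 (@sums_moment R piV 3 hV)).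
  rewrite le_eqVlt; apply/orP; left; apply/eqP.
  have -> : T%:R = muU * N%:R / muV :> R by rewrite NT; field; rewrite gt_eqF.
  by field; rewrite !gt_eqF.
by rewrite -iid_Z; apply: eq_bigr => b _; congr (_ * _); exact: mulrC.
Qed.

Lemma penalty_mean : (D0 <= B)%N ->
  pair_mean (wU B) (wV B) (fun (a : {ffun 'I_N -> 'I_B.+1}) (b : {ffun 'I_T -> 'I_B.+1}) =>
    penalty piU piV K3 theta D0 a b k)
  <= muU / muV * moment piV 3 / K3
     + (penalty_const1 / N%:R + penalty_const2 * (tailU B ^+ 2 + tailV B ^+ 2)).
Proof.
move=> DB; rewrite /penalty.
have v1 := truncated_sum (mass piV) B.
have u1 := truncated_sum (mass piU) B.
rewrite !pair_meanD !(@pair_mean_fst R _ _ N T _ _ v1) !(@pair_mean_snd R _ _ N T _ _ u1).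
rewrite (iid_sum _ predT (fun (D : 'I_D0) (a : {ffun 'I_N -> 'I_B.+1}) => (psum (counter (mass piU) D) N a / N%:R) ^+ 2
  / theta2 theta D0 ^+ 2)).
have E1 := centeredU_mean; have E2 := centeredV_mean (leqnn T); have E3 := centeredV_mean kT.
have E5 := cube_mean.
have E4 : \sum_(D < D0) iid_mean (wU B) (fun a : {ffun 'I_N -> 'I_B.+1} =>
    (psum (counter (mass piU) D) N a / N%:R) ^+ 2 / theta2 theta D0 ^+ 2)
  <= A2 * (\sum_(D < D0) D%:R ^+ 2) / N%:R.
  rewrite mulr_sumr mulr_suml; apply: ler_sum => D _.
  by apply: counter_mean; rewrite (leq_trans _ DB) // ltnW.
apply: (le_trans (lerD (lerD (lerD (lerD E1 E2) E3) E4) E5)).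
have tu := sqr_ge0 (tailU B); have tv := sqr_ge0 (tailV B).
have a1 : 0 <= A1 by rewrite invr_ge0 sqr_ge0.
have mu : 0 <= muU ^- 2 by rewrite invr_ge0 sqr_ge0.
have mv : 0 <= muV ^- 2 by rewrite invr_ge0 sqr_ge0.
have x1 : 0 <= A1 * (2 * muV ^- 2 * tailU B ^+ 2 + muU ^- 2 * tailV B ^+ 2).
  by rewrite mulr_ge0 // addr_ge0 // mulr_ge0 // mulr_ge0.
rewrite -subr_ge0; apply: le_trans x1 _; rewrite le_eqVlt; apply/orP; left; apply/eqP.
rewrite /penalty_const1 /penalty_const2; ring.
Qed.

Variable Lq : R.
Hypothesis Lq_ge0 : 0 <= Lq.
Hypothesis flow_lip : forall x y,
  `|read_flow piU piV C x - read_flow piU piV C y| <= Lq * `|x - y|.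

Definition path_const : R := expR ((2 * Lq + 1) / muV)
  * (2 / muV + 2 * Lq ^+ 2 / muU + (2 * moment piV 2 + 2 * (muV + Lq) ^+ 2) / (muV * muU)).

Lemma path_mean :
  iid_mean (wV B) (fun b : {ffun 'I_T -> 'I_B.+1} =>
    (mean_path (muU * N%:R) (hit_prob piU C) b k - G (k%:R / T%:R)) ^+ 2)
  <= path_const * (N%:R^-1 + tailV B ^+ 2).
Proof.
have w0 := @truncated_ge0 R (mass piV) B pV0 sV.
have w1 := truncated_sum (mass piV) B.
have tv0 : 0 <= tailV B.
  by rewrite subr_ge0; apply: (@sums_ge_part R _ _ B.+1 _ (sums_mean hV)) => j; rewrite mulr_ge0.
have app x : `|\sum_a wV B a * mean_reads a (hit_prob piU C x) - read_flow piU piV C x| <= tailV B.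
  rewrite (@truncated_mean R (mass piV) B (fun j => mean_reads j (hit_prob piU C x))) // distrC.
  exact: (read_rate_approx (mass_entire hV) (sums_mean hV) B.+1 (hit_prob01 C hU muU_gt0 x)).
have fb x : `|read_flow piU piV C x| <= muV.
  by have /andP[f0 f1] := read_flow_bound C hU hV muU_gt0 x; rewrite ger0_norm.
have st (t : nat) : (t < T)%N -> `|muU * N%:R * (G (t.+1%:R / T%:R) - G (t%:R / T%:R))
   - read_flow piU piV C (G (t%:R / T%:R))| <= Lq / T%:R.
  by move=> tT; rewrite NT; apply: (fluid_step hU hV muU_gt0 muV_gt0 C_gt0 tT flow_lip Lq_ge0).
have g0 : G (0%:R / T%:R) = 0 by rewrite mul0r; exact: (fluid0 hU hV muU_gt0 muV_gt0 C_gt0).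
have m2 : \sum_a wV B a * (a : nat)%:R ^+ 2 <= moment piV 2.
  exact: (@truncated_moment R _ B pV0 2 _ isT (@sums_moment R piV 2 hV)).
(* The reference path is [G] at times t / T; the tail of the second law measures the truncation, and
   [Lq / T] the time discretisation. *)
have := @mean_path_deviation R B.+1 T (wV B) w0 w1 (muU * N%:R) (hit_prob piU C)
  (read_flow piU piV C) (fun t => G (t%:R / T%:R)) Lq (tailV B) (Lq / T%:R) muV (moment piV 2)
  n0 (hit_prob01 C hU muU_gt0) app flow_lip g0 st fb m2 Lq_ge0 k kT.
move/le_trans; apply.
have -> : T%:R * ((2 * Lq + 1) / (muU * N%:R)) = (2 * Lq + 1) / muV.
  by rewrite NT; field; rewrite !gt_eqF.
rewrite /path_const -mulrA ler_wpM2l ?expR_ge0 //.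
set tv := tailV B in tv0 *; pose y := N%:R^-1 : R.
have y0 : 0 < y by rewrite invr_gt0.
have T1 : T%:R^-1 <= 1 :> R.
  by rewrite invf_le1 // ler1n -(ltr0n R).
have iT0 : 0 < T%:R^-1 :> R by rewrite invr_gt0.
have kap : Lq / T%:R <= Lq by rewrite ler_piMr.
have kap2 : (Lq / T%:R) ^+ 2 <= Lq ^+ 2 * (muV / muU * y).
  rewrite exprMn ler_wpM2l ?sqr_ge0 // -[muV / muU * y]/(muV / muU / N%:R) -invT.
  by rewrite expr2 ler_piMr // ltW.
have sq1 := sqrD_le tv (Lq / T%:R).
have sq2 : (muV + Lq / T%:R) ^+ 2 <= (muV + Lq) ^+ 2.
  by rewrite lerXn2r ?nnegrE ?addr_ge0 ?divr_ge0 ?(ltW muV_gt0) ?(ltW T0) // lerD2l.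
set q := Lq / T%:R in kap kap2 sq1 sq2 *.
have m0 := moment_ge0 2 hV.
apply: (@le_trans _ _ (2 / muV * tv ^+ 2 + 2 * Lq ^+ 2 / muU * y
  + (2 * moment piV 2 + 2 * (muV + Lq) ^+ 2) / (muV * muU) * y)).
  have -> : T%:R * ((tv + q) ^+ 2 / (muU * N%:R)
      + (2 * moment piV 2 + 2 * (muV + q) ^+ 2) / (muU * N%:R) ^+ 2)
    = (tv + q) ^+ 2 / muV + (2 * moment piV 2 + 2 * (muV + q) ^+ 2) / (muV * muU) * y.
    have -> : T%:R = muU * N%:R / muV :> R by rewrite NT; field; rewrite gt_eqF.
    by rewrite /y; field; rewrite !gt_eqF.
  apply: lerD; last first.
    rewrite ler_pM2r // ler_pM2r ?invr_gt0 ?mulr_gt0 // lerD2l ler_pM2l //.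
  rewrite ler_pdivrMr //; apply: (le_trans sq1).
  have -> : (2 / muV * tv ^+ 2 + 2 * Lq ^+ 2 / muU * y) * muV
     = 2 * tv ^+ 2 + 2 * (Lq ^+ 2 * (muV / muU * y)) by field; rewrite !gt_eqF.
  by rewrite lerD2l ler_pM2l.
have c1 : 0 <= 2 / muV by rewrite divr_ge0 // ltW.
have c2 : 0 <= 2 * Lq ^+ 2 / muU by rewrite divr_ge0 ?mulr_ge0 ?sqr_ge0 // ltW.
have c3 : 0 <= (2 * moment piV 2 + 2 * (muV + Lq) ^+ 2) / (muV * muU).
  apply: divr_ge0; last by apply: mulr_ge0; exact: ltW.
  by apply: addr_ge0; apply: mulr_ge0 => //; exact: sqr_ge0.
have tv2 := sqr_ge0 tv.
set x1 := 2 / muV in c1 *; set x2 := 2 * Lq ^+ 2 / muU in c2 *; set x3 := _ / (muV * muU) in c3 *.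
rewrite -/y; nra.
Qed.

End Fixed_size.

(** The second term is made small by a large [K3], then the first by a small [theta]; only the last
    depends on [N] and [B]. Since [N0] and [K] precede [B], the bound is uniform as the supremum
    over outcomes demands. *)
Lemma deviation_mean (Lq : R) :
  0 <= Lq ->
  (forall x y, `|read_flow piU piV C x - read_flow piU piV C y| <= Lq * `|x - y|) ->
  (forall x y, `|hit_prob piU C x - hit_prob piU C y| <= lip * `|x - y|) ->
  (forall x y, `|filled_clamp piU C x - filled_clamp piU C y| <= lip * `|x - y|) ->
  0 < theta <= 1 / 2 -> theta <= (1 - s0) / 4 ->
  mean_tail (mass piU) muU D0 <= theta / 4 ->
  exists N0 K, [/\ 0 <= K & forall N T B : nat,
    (N0 <= N)%N -> (0 < N)%N -> (D0 <= B)%N -> muU * N%:R = muV * T%:R ->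
    pair_mean (wU B) (wV B) (fun (a : {ffun 'I_N -> 'I_B.+1}) (b : {ffun 'I_T -> 'I_B.+1}) =>
      deviation C (degs a b) (Num.truncn (s0 * T%:R)) (filled (mass piU) C (G s0)))
    <= 2 * (quenched_const muU lip ((1 - s0) / 4) K3 * theta ^+ 2)
       + C%:R ^+ 2 * (muU / muV * moment piV 3 / K3)
       + K * (N%:R^-1 + tailU B ^+ 2 + tailV B ^+ 2)].
Proof.
move=> Lq0 flow_lip p_lip F_lip th12 thd tailth.
have [N0 H] := deviation_penalty hU hV muU_gt0 muV_gt0 s01 lip_ge0 K3_gt0 p_lip F_lip
   th12 thd tailth.
pose K := C%:R ^+ 2 * (penalty_const1 + penalty_const2)
   + 4 * lip ^+ 2 * (path_const Lq + muV / muU).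
have t1 := theta1_gt0 muU_gt0 th12; have t2 := theta2_gt0 D0 th12.
have pc1 : 0 <= penalty_const1.
  have vU : 0 <= varU by apply: addr_ge0; apply: mulr_ge0; rewrite ?sqr_ge0 ?moment_ge0.
  have vV : 0 <= varV by apply: addr_ge0; apply: mulr_ge0; rewrite ?sqr_ge0 ?moment_ge0.
  rewrite /penalty_const1; apply: addr_ge0; apply: mulr_ge0; rewrite ?invr_ge0 ?sqr_ge0 //.
    apply: addr_ge0; first by rewrite divr_ge0 ?sqr_ge0.
    by apply: mulr_ge0 => //; apply: divr_ge0 => //; apply: mulr_ge0; exact: ltW.
  by apply: sumr_ge0 => D _; exact: sqr_ge0.
have pc2 : 0 <= penalty_const2.
  rewrite /penalty_const2; apply: mulr_ge0; first by rewrite invr_ge0 sqr_ge0.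
  by rewrite addr_ge0 ?mulr_ge0 ?invr_ge0 ?sqr_ge0.
have pc3 : 0 <= path_const Lq.
  have mV := moment_ge0 2 hV.
  rewrite /path_const; apply: mulr_ge0; first exact: expR_ge0.
  apply: addr_ge0; first by apply: addr_ge0; apply: divr_ge0;
    rewrite ?mulr_ge0 ?sqr_ge0 // ltW.
  apply: divr_ge0; last by apply: mulr_ge0; exact: ltW.
  by apply: addr_ge0; apply: mulr_ge0 => //; exact: sqr_ge0.
have mm : 0 <= muV / muU by rewrite divr_ge0 // ltW.
exists N0, K; split.
  apply: addr_ge0; first by apply: mulr_ge0; [exact: sqr_ge0|exact: addr_ge0].
  by apply: mulr_ge0; [apply: mulr_ge0 => //; exact: sqr_ge0|exact: addr_ge0].
move=> N T B N0N N1 DB NT.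
have N0' : 0 < N%:R :> R by rewrite ltr0n.
have n0 : 0 < muU * N%:R by rewrite mulr_gt0.
have T0 : 0 < T%:R :> R by move: n0; rewrite NT pmulr_rgt0.
have /andP[s00 s0lt] := s01.
set k := Num.truncn _.
have /andP[ks ks'] : k%:R <= s0 * T%:R < k.+1%:R by apply/truncn_itv/mulr_ge0 => //; exact: ltW.
have kT : (k <= T)%N by rewrite -(ler_nat R) (le_trans ks) // ler_piMl // ltW.
have w0 := @truncated_ge0 R (mass piV) B pV0 sV.
have w1 := truncated_sum (mass piV) B.
have u0 := @truncated_ge0 R (mass piU) B pU0 sU.
have u1 := truncated_sum (mass piU) B.
set Qc := quenched_const _ _ _ _.
pose z (b : {ffun 'I_T -> 'I_B.+1}) : R :=
  mean_path (muU * N%:R) (hit_prob piU C) b k - G (k%:R / T%:R).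
have invT : T%:R^-1 = muV / muU / N%:R :> R.
  by have -> : T%:R = muU * N%:R / muV; [rewrite NT; field|field]; rewrite ?gt_eqF.
have T1 : T%:R^-1 <= 1 :> R by rewrite invf_le1 // ler1n -(ltr0n R).
have iT0 : 0 < T%:R^-1 :> R by rewrite invr_gt0.
(* Rounding [s0 * T] down shifts the time by less than 1 / T, and [G] has Lipschitz constant 1. *)
have gap : `|G (k%:R / T%:R) - G s0| <= T%:R^-1.
  apply: (le_trans (fluid_lip C hU hV muU_gt0 muV_gt0 _ _)).
  - by rewrite divr_ge0 //= ler_pdivrMr // mul1r ler_nat.
  - by rewrite s00 ltW.
  have -> : k%:R / T%:R - s0 = - ((s0 * T%:R - k%:R) / T%:R) by field; rewrite gt_eqF.
  rewrite normrN ger0_norm; last by apply: divr_ge0; [rewrite subr_ge0|exact: ltW].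
  by rewrite ler_pdivrMr // mulVf ?gt_eqF // lerBlDl natr1 ltW.
apply: (@le_trans _ _ (pair_mean (wU B) (wV B)
   (fun (a : {ffun 'I_N -> 'I_B.+1}) (b : {ffun 'I_T -> 'I_B.+1}) =>
     (2 * (Qc * theta ^+ 2) + 4 * lip ^+ 2 * (muV / muU / N%:R)) +
     (4 * lip ^+ 2 * z b ^+ 2 + C%:R ^+ 2 * penalty piU piV K3 theta D0 a b k)))).
  apply: pair_mean_le => // a b; apply: (le_trans (H N T B a b N0N N1 NT)).
  rewrite -/k -/Qc [leRHS]addrA lerD2r -[leRHS]addrA lerD2l.
  rewrite exprMn real_normK ?num_real //.
  have -> : mean_path (muU * N%:R) (hit_prob piU C) b k - G s0
     = z b + (G (k%:R / T%:R) - G s0) by rewrite /z; ring.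
  have s1 := sqrD_le (z b) (G (k%:R / T%:R) - G s0).
  have s2 : (G (k%:R / T%:R) - G s0) ^+ 2 <= muV / muU / N%:R.
    rewrite -invT; apply: (le_trans (sqr_le_norm gap)).
    by rewrite expr2 ler_piMr // ltW.
  have l2 := sqr_ge0 lip.
  set X := (z b + _) ^+ 2 in s1 *; set Y := (G (k%:R / T%:R) - G s0) ^+ 2 in s1 s2.
  set W := muV / muU / N%:R in s2 *; set Z := z b ^+ 2 in s1 *; set l := lip ^+ 2 in l2 *.
  have : l * X <= l * (2 * Z + 2 * W) by rewrite ler_wpM2l //; lra.
  by lra.
rewrite pair_meanD (@pair_mean_const R _ _ N T _ _ u1 w1) pair_meanD !pair_meanZ.
rewrite (@pair_mean_snd R _ _ N T _ _ u1).
have E1 := path_mean B N1 NT kT Lq0 flow_lip; have E2 := penalty_mean N1 NT kT DB.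
have e1 : 4 * lip ^+ 2 * iid_mean (wV B) (fun b => z b ^+ 2)
   <= 4 * lip ^+ 2 * (path_const Lq * (N%:R^-1 + tailV B ^+ 2)).
  by rewrite ler_wpM2l ?mulr_ge0 ?sqr_ge0.
have e2 := ler_wpM2l (sqr_ge0 (C%:R : R)) E2.
apply: (le_trans (lerD (lexx _) (lerD e1 e2))).
rewrite /K; have tu := sqr_ge0 (tailU B); have tv := sqr_ge0 (tailV B).
have y0 : 0 <= N%:R^-1 :> R by rewrite invr_ge0 ltW.
set tU := tailU B ^+ 2 in tu *; set tV := tailV B ^+ 2 in tv *; set y := N%:R^-1 in y0 *.
have c2 : 0 <= C%:R ^+ 2 :> R by exact: sqr_ge0.
have l2 : 0 <= 4 * lip ^+ 2 by rewrite mulr_ge0 ?sqr_ge0.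
set cc := C%:R ^+ 2 in c2 *; set ll := 4 * lip ^+ 2 in l2 *.
set q1 := penalty_const1 in pc1 *; set q2 := penalty_const2 in pc2 *.
set q3 := path_const Lq in pc3 *; set m := muV / muU in mm *.
have : 0 <= cc * (q1 * (tU + tV)) + cc * (q2 * y) + ll * (q3 * tU) + ll * (m * (tU + tV)).
  by rewrite !addr_ge0 // mulr_ge0 // mulr_ge0 // addr_ge0.
move=> P; rewrite -subr_ge0; apply: le_trans P _; rewrite le_eqVlt; apply/orP; left; apply/eqP.
ring.
Qed.

End Mean_deviation.

(** Each [w] of the duplicate-free list is reached by some index, and overcounting is harmless for a
    nonnegative [F]. *)
Lemma ler_sum_cover (R : realType) (I J : eqType) (s : seq I) (r : seq J) (h : J -> I) (F : I -> R) :
  (forall w, 0 <= F w) -> {in s, forall w, exists2 j, j \in r & h j = w} -> uniq s ->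
  \sum_(w <- s) F w <= \sum_(j <- r) F (h j).
Proof.
move=> F0 cover us.
apply: (@le_trans _ _ (\sum_(w <- s) \sum_(j <- r | h j == w) F w)).
  rewrite big_seq [leRHS]big_seq; apply: ler_sum => w ws; have [j jr <-] := cover w ws.
  rewrite -big_filter; have : j \in [seq i <- r | h i == h j] by rewrite mem_filter eqxx.
  case: [seq _ <- _ | _] => // i l _.
  by rewrite big_cons lerDl sumr_ge0.
rewrite (exchange_big_dep predT) //=; apply: ler_sum => j _.
rewrite (eq_bigr (fun=> F (h j))) => [|w /eqP -> //].
rewrite -big_filter; set l := [seq _ <- _ | _].
have ul : uniq l by apply: filter_uniq.
case El : l ul => [|x [|y l']] //=; first by rewrite big_nil.
  by rewrite big_cons big_nil addr0.
have : x \in l by rewrite El mem_head.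
have : y \in l by rewrite El !inE eqxx orbT.
rewrite !mem_filter => /andP[/eqP <- _] /andP[/eqP <- _].
by rewrite inE eqxx.
Qed.

(** * From probabilities of outcomes to truncated means *)

Section Greedy_tail.
Variables (R : realType) (piU piV : probability nat R) (C N T : nat).
Local Notation Out := (outcome N T).
Local Notation W := (@weight R piU piV C N T).
Local Notation wU B := (@truncated R (mass piU) B).
Local Notation wV B := (@truncated R (mass piV) B).

Lemma weight_ge0 (w : Out) : 0 <= W w.
Proof.
case: w => d [f c] /=; apply: mulr_ge0; last by apply: prodr_ge0 => t _; exact: step_ge0.
apply: mulr_ge0; last by rewrite divr_ge0.
by apply: mulr_ge0; apply: prodr_ge0 => i _; exact: mass_ge0.
Qed.

Lemma sum_weight_sq (d : degrees N T) (k : nat) (L : R) : (k <= T)%N ->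
  \sum_(x : pairing d * choices d)
    W (Tagged (fun d : degrees N T => (pairing d * choices d)%type) x)
    * (#|matching_after x.2 k|%:R / N%:R - L) ^+ 2
  = (\prod_i mass piU (d.1 i)) * (\prod_j mass piV (d.2 j)) * deviation C d k L.
Proof.
move=> kT; transitivity (\sum_(f : pairing d) \sum_(c : choices d)
  W (Tagged (fun d : degrees N T => (pairing d * choices d)%type) (f, c))
    * (#|matching_after c k|%:R / N%:R - L) ^+ 2).
  by rewrite pair_bigA; apply: eq_bigr => -[f c].
rewrite /=.
set P := _ * (\prod_j _).
rewrite /deviation /expect.
rewrite -(@sum_greedy R N T C d k (fun m => (m%:R / N%:R - L) ^+ 2) kT).
rewrite mulrA mulr_sumr mulr_suml [RHS]big_mkcond /=; apply: eq_bigr => f _.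
case: (boolP (f \in _)) => fP; last first.
  by rewrite big1 // => c _; rewrite mul0r mulr0 !mul0r.
rewrite mulr_sumr mulr_suml; apply: eq_bigr => c _; rewrite mul1r.
by ring.
Qed.

(** The listed outcomes are covered by all outcomes with degrees at most [B], and the truncated laws
    dominate the true masses there, so the finite sum is at most a mean. *)
Lemma sum_weight_le (s : seq Out) (B k : nat) (L : R) : uniq s -> (k <= T)%N ->
  (forall w, w \in s -> (forall i, (tag w).1 i <= B)%N /\ (forall j, (tag w).2 j <= B)%N) ->
  \sum_(w <- s) W w * (#|out_matching w k|%:R / N%:R - L) ^+ 2
  <= pair_mean (wU B) (wV B) (fun (a : {ffun 'I_N -> 'I_B.+1}) (b : {ffun 'I_T -> 'I_B.+1}) =>
       deviation C (degs a b) k L).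
Proof.
move=> us kT bnd.
pose FF := ({ffun 'I_N -> 'I_B.+1} * {ffun 'I_T -> 'I_B.+1})%type.
pose J := {ab : FF & (pairing (degs ab.1 ab.2) * choices (degs ab.1 ab.2))%type}.
pose h (j : J) : Out := Tagged (fun d : degrees N T => (pairing d * choices d)%type) (tagged j).
pose F (w : Out) : R := W w * (#|out_matching w k|%:R / N%:R - L) ^+ 2.
have F0 w : 0 <= F w by apply: mulr_ge0; [exact: weight_ge0|exact: sqr_ge0].
have cover : {in s, forall w, exists2 j, j \in enum {: J} & h j = w}.
  move=> w /bnd; case: w => d x /= [dU dV].
  pose a : {ffun 'I_N -> 'I_B.+1} := [ffun i => inord (d.1 i)].
  pose b : {ffun 'I_T -> 'I_B.+1} := [ffun j => inord (d.2 j)].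
  have E : d = degs a b.
    rewrite /degs; case: d dU dV @a @b {x} => d1 d2 /= dU dV; congr pair; apply/ffunP => i;
    by rewrite !ffunE inordK // ltnS.
  move: x; rewrite E => x; exists (existT (fun ab : FF => (pairing (degs ab.1 ab.2) * choices (degs ab.1 ab.2))%type)
    (a, b) x) => //.
  by rewrite mem_enum.
apply: (le_trans (ler_sum_cover F0 cover us)); rewrite big_enum /=.
rewrite [leLHS](_ : _
   = \sum_(ab : FF) \sum_(x : pairing (degs ab.1 ab.2) * choices (degs ab.1 ab.2))
       F (Tagged (fun d : degrees N T => (pairing d * choices d)%type) x)); last first.
  by rewrite sig_big_dep; apply: eq_big => -[].
rewrite (eq_bigr (fun ab : FF => (\prod_i mass piU (ab.1 i)) * (\prod_j mass piV (ab.2 j))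
   * deviation C (degs ab.1 ab.2) k L)) => [|[a b] _] /=; last first.
  rewrite sum_weight_sq //; congr (_ * _ * _); apply: eq_bigr => i _; by rewrite ffunE.
rewrite -(pair_bigA _ (fun (a : {ffun 'I_N -> 'I_B.+1}) (b : {ffun 'I_T -> 'I_B.+1}) => (\prod_i mass piU (a i)) * (\prod_j mass piV (b j))
   * deviation C (degs a b) k L)) /=.
have pV0 := @mass_ge0 R piV; have pU0 := @mass_ge0 R piU.
rewrite /pair_mean /iid_mean /Ew; apply: ler_sum => a _; rewrite mulr_sumr.
apply: ler_sum => b _; rewrite -mulrA; apply: ler_pM.
- by apply: prodr_ge0.
- by apply: mulr_ge0; [apply: prodr_ge0|exact: deviation_ge0].
- apply: ler_prod => i _; rewrite pU0 /=.
  by apply: truncated_ge => //; exact: sums_mass.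
apply: ler_wpM2r; first exact: deviation_ge0.
apply: ler_prod => i _; rewrite pV0 /=.
by apply: truncated_ge => //; exact: sums_mass.
Qed.

(* [esum] is a supremum of finite sums, and finitely many outcomes have degrees
   below some [B]. *)
Lemma greedy_prob_le (k B0 : nat) (L eps eta : R) : (k <= T)%N -> 0 < eps ->
  (forall B, (B0 <= B)%N -> pair_mean (wU B) (wV B)
    (fun (a : {ffun 'I_N -> 'I_B.+1}) (b : {ffun 'I_T -> 'I_B.+1}) =>
       deviation C (degs a b) k L) <= eta) ->
  (@greedy_prob R piU piV C N T
     [set w | (eps < `|#|out_matching w k|%:R / N%:R - L|)%R] <= (eta / eps ^+ 2)%:E)%E.
Proof.
move=> kT e0 H; apply: ge_ereal_sup => _ [X [finX XA] <-].
rewrite fsbig_finite //= sumEFin lee_fin.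
set s := finmap.enum_fset (fset_set X).
have us : uniq s by exact: finmap.fset_uniq.
have sX (w : Out) : w \in s -> (eps < `|#|out_matching w k|%:R / N%:R - L|).
  by move=> ws; apply: XA; have := in_fset_set finX w; rewrite [_ \in _]ws => /esym/set_mem.
pose dmax (w : Out) : nat := maxn (\max_i (tag w).1 i) (\max_j (tag w).2 j).
pose B := maxn B0 (\max_(w <- s) dmax w).
have bnd w : w \in s -> (forall i, (tag w).1 i <= B)%N /\ (forall j, (tag w).2 j <= B)%N.
  move=> ws; have wB : (dmax w <= B)%N.
    by rewrite leq_max; apply/orP; right; apply: (@leq_bigmax_seq _ _ _ dmax).
  split=> i; apply: leq_trans wB; rewrite leq_max; apply/orP; [left|right].
    exact: (leq_bigmax (F := fun i => (tag w).1 i)).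
  exact: (leq_bigmax (F := fun i => (tag w).2 i)).
(* Chebyshev's inequality on the finite set: each of its outcomes has squared deviation above
   [eps ^ 2]. *)
rewrite ler_pdivlMr ?exprn_gt0 // mulr_suml.
apply: le_trans (H B (leq_maxl _ _)); apply: le_trans (sum_weight_le L us kT bnd).
rewrite big_seq [leRHS]big_seq; apply: ler_sum => w /sX lt.
rewrite ler_wpM2l ?weight_ge0 //.
by rewrite -[leRHS]real_normK ?num_real // lerXn2r ?nnegrE ?normr_ge0 // ltW.
Qed.

End Greedy_tail.

Lemma greedy_prob_mono (R : realType) (piU piV : probability nat R) (C N T : nat)
  (A A' : set (outcome N T)) : A `<=` A' ->
  (greedy_prob piU piV C A <= greedy_prob piU piV C A')%E.
Proof.
move=> AA'; apply: ereal_sup_le => x [X [finX XA] <-]; exists X => //.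
by split => // w /XA /AA'.
Qed.

(** * Choice of the parameters and convergence in probability *)

Section Convergence.
Variables (R : realType) (piU piV : probability nat R) (C : nat).
Hypotheses (hU : sub_gaussian piU) (hV : sub_gaussian piV).
Hypotheses (muU_gt0 : 0 < mean piU) (muV_gt0 : 0 < mean piV) (C_gt0 : (0 < C)%N).

Local Notation muU := (mean piU).
Local Notation muV := (mean piV).
Local Notation G := (fluid piU piV C).
Local Notation wU B := (@truncated R (mass piU) B).
Local Notation wV B := (@truncated R (mass piV) B).

Let C0 : 0 < C%:R :> R. Proof. by rewrite ltr0n. Qed.

Lemma mean_tail_ge0 (pi : probability nat R) B : sub_gaussian pi ->
  0 <= mean_tail (mass pi) (mean pi) B.
Proof.
move=> h; rewrite subr_ge0; apply: (@sums_ge_part R _ _ B _ (sums_mean h)) => j.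
by rewrite mulr_ge0 ?mass_ge0.
Qed.

Lemma mean_deviation_small (s0 eta : R) : 0 <= s0 < 1 -> 0 < eta ->
  exists N0 B0, forall N T B : nat, (N0 <= N)%N -> (B0 <= B)%N -> muU * N%:R = muV * T%:R ->
    pair_mean (wU B) (wV B) (fun (a : {ffun 'I_N -> 'I_B.+1}) (b : {ffun 'I_T -> 'I_B.+1}) =>
      deviation C (degs a b) (Num.truncn (s0 * T%:R)) (filled (mass piU) C (G s0))) <= eta.
Proof.
move=> s01 eta0; have /andP[s00 s0lt] := s01.
have [Lq Lq0 flow_lip] := read_flow_lip C hU hV muU_gt0.
have [L1 L10 p_lip] := hit_prob_lip C hU muU_gt0.
have [L2 L20 F_lip] := lipschitz01_clamp (filled_lip C (mass_entire hU)).
pose lip := L1 + L2; have lip0 : 0 <= lip by rewrite addr_ge0.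
have p_lip' x y : `|hit_prob piU C x - hit_prob piU C y| <= lip * `|x - y|.
  by apply: le_trans (p_lip x y) _; rewrite ler_wpM2r // lerDl.
have F_lip' x y : `|filled_clamp piU C x - filled_clamp piU C y| <= lip * `|x - y|.
  by apply: le_trans (F_lip x y) _; rewrite ler_wpM2r // lerDr.
pose m3 := C%:R ^+ 2 * (muU / muV * moment piV 3).
have m30 : 0 <= m3.
  apply: mulr_ge0; first exact: sqr_ge0.
  by apply: mulr_ge0; [rewrite divr_ge0 // ltW|exact: moment_ge0].
(* [K3] comes first: it lets the cubed degrees cost at most eta / 4 whatever [N] is; adding 1 keeps
   it positive. *)
pose K3 := 4 * (m3 + 1) / eta; have K30 : 0 < K3 by rewrite divr_gt0 // mulr_gt0 // ltr_wpDl.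
pose delta := (1 - s0) / 4; have delta0 : 0 < delta by rewrite divr_gt0 // subr_gt0.
pose Qc := quenched_const muU lip delta K3.
have Qc0 : 0 <= Qc by apply: quenched_const_ge0 => //; exact: ltW.
(* Only now [theta], since [Qc] depends on [K3]: the last bound gives 2 * Qc * theta ^ 2 <= eta /
   4. *)
pose theta := Num.min (1 / 2) (Num.min delta (eta / (8 * (Qc + 1)))).
have Q1 : 0 < 8 * (Qc + 1) by rewrite mulr_gt0 // ltr_wpDl.
have [th1 th2 th3] : [/\ theta <= 1 / 2, theta <= delta & theta <= eta / (8 * (Qc + 1))].
  by rewrite /theta !ge_min !lexx !orbT.
have th0 : 0 < theta by rewrite /theta !lt_min delta0 !divr_gt0.
have [D0 HD] : exists n0, forall n, (n0 <= n)%N -> mean_tail (mass piU) muU n <= theta / 4.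
  by apply: (mean_tail_small (sums_mean hU)); rewrite divr_gt0.
have th12 : 0 < theta <= 1 / 2 by rewrite th0.
have [N0 [K [K0 H]]] := deviation_mean hU hV muU_gt0 muV_gt0 C_gt0 s01 lip0 K30
  Lq0 flow_lip p_lip' F_lip' th12 th2 (HD D0 (leqnn _)).
(* The inverse of [N] and the two squared tails are each brought below [x0], for a total cost of eta
   / 2. *)
pose x0 := eta / (6 * (K + 1)); have K1 : 0 < 6 * (K + 1) by rewrite mulr_gt0 // ltr_wpDl.
have x00 : 0 < x0 by rewrite divr_gt0.
(* Since [t0 <= 1], a tail at most [t0] has a square at most [x0]. *)
pose t0 := Num.min 1 x0; have t00 : 0 < t0 by rewrite lt_min ltr01.
have [t01 t0x] : t0 <= 1 /\ t0 <= x0 by rewrite /t0 !ge_min !lexx orbT.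
have [BU HU] := mean_tail_small (sums_mean hU) t00.
have [BV HV] := mean_tail_small (sums_mean hV) t00.
exists (maxn N0 (Num.truncn x0^-1).+1), (maxn D0 (maxn BU BV)) => N T B.
rewrite !geq_max => /andP[N0N xN] /and3P[DB UB VB] NT.
have N1 : (0 < N)%N by apply: leq_trans xN.
have iN : N%:R^-1 <= x0.
  rewrite -[leRHS]invrK lef_pV2 ?posrE ?invr_gt0 ?ltr0n //.
  by apply: ltW; apply: (lt_le_trans (truncnS_gt _)); rewrite ler_nat.
apply: (le_trans (H N T B N0N N1 DB NT)); rewrite -/Qc.
have tail2 (pi : probability nat R) : sub_gaussian pi -> mean_tail (mass pi) (mean pi) B.+1 <= t0 ->
    mean_tail (mass pi) (mean pi) B.+1 ^+ 2 <= x0.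
  move=> h tt; have t2 := mean_tail_ge0 B.+1 h; apply: (@le_trans _ _ (t0 * 1)); last by rewrite mulr1.
  by rewrite expr2 ler_pM // (le_trans tt).
have e1 := tail2 _ hU (HU _ (leqW UB)); have e2 := tail2 _ hV (HV _ (leqW VB)).
have e3 : 2 * (Qc * theta ^+ 2) <= eta / 4.
  apply: (@le_trans _ _ (2 * ((Qc + 1) * theta))).
    rewrite ler_pM2l //; apply: ler_pM => //; first by rewrite sqr_ge0.
      by rewrite lerDl.
    by rewrite expr2 ler_piMr ?(ltW th0) // (le_trans th1) // ler_pdivrMr // mul1r ler1n.
  have : (8 * (Qc + 1)) * theta <= eta by rewrite mulrC -ler_pdivlMr.
  by lra.
have e4 : C%:R ^+ 2 * (muU / muV * moment piV 3 / K3) <= eta / 4.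
  rewrite mulrA -/m3 ler_pdivrMr // /K3.
  have -> : eta / 4 * (4 * (m3 + 1) / eta) = m3 + 1 by field; rewrite gt_eqF.
  by rewrite lerDl.
have e5 : K * (N%:R^-1 + mean_tail (mass piU) muU B.+1 ^+ 2 + mean_tail (mass piV) muV B.+1 ^+ 2)
    <= eta / 2.
  apply: (@le_trans _ _ ((K + 1) * (x0 + x0 + x0))).
    apply: ler_pM => //; [|by rewrite lerDl|by rewrite !lerD].
    by rewrite !addr_ge0 ?sqr_ge0.
  rewrite le_eqVlt; apply/orP; left; apply/eqP; rewrite /x0; field.
  by rewrite gt_eqF // ltr_wpDl.
lra.
Qed.

Lemma ratio_event (N m : nat) (l eps : R) : (0 < N)%N ->
  (eps < `|m%:R / (C%:R * N%:R) - l|) = (C%:R * eps < `|m%:R / N%:R - C%:R * l|).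
Proof.
move=> N0; have -> : m%:R / N%:R - C%:R * l = C%:R * (m%:R / (C%:R * N%:R) - l).
  by field; rewrite !gt_eqF // ltr0n.
by rewrite normrM ger0_norm // ltr_pM2l.
Qed.

Lemma size_relation (N T : nat) : T%:R = muU / muV * N%:R -> muU * N%:R = muV * T%:R.
Proof. by move=> ->; field; rewrite gt_eqF. Qed.

Lemma greedy_cvg_before (s : R) : 0 <= s < 1 ->
  greedy_cvg_in_prob piU piV C
    (fun N T w => #|out_matching w (Num.truncn (s * T%:R))|%:R / (C%:R * N%:R))
    (limit_ratio piU C (G s)).
Proof.
move=> s01 eps delta eps0 delta0; have /andP[s0 s1] := s01.
have ce : 0 < C%:R * eps by rewrite mulr_gt0.
have eta0 : 0 < delta / 2 * (C%:R * eps) ^+ 2 by rewrite mulr_gt0 ?divr_gt0 ?exprn_gt0.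
have [N0 [B0 H]] := mean_deviation_small s01 eta0.
exists (maxn N0 1) => // N /=; rewrite geq_max => /andP[N0N N1] T TN.
have NT := size_relation TN.
have kT : (Num.truncn (s * T%:R) <= T)%N.
  rewrite -(ler_nat R); have /andP[h _] := truncn_itv (mulr_ge0 s0 (ler0n R T)).
  by apply: (le_trans h); rewrite ler_piMl // ltW.
apply: le_lt_trans (_ : (delta / 2)%:E < delta%:E)%E; last by rewrite lte_fin; lra.
have -> : delta / 2 = delta / 2 * (C%:R * eps) ^+ 2 / (C%:R * eps) ^+ 2.
  by rewrite mulfK // gt_eqF // exprn_gt0.
apply: le_trans (greedy_prob_le kT ce (fun B BB => H N T B N0N BB NT)).
apply: greedy_prob_mono => w /=.
by rewrite ratio_event // limit_ratio_filled.
Qed.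

Lemma greedy_cvg_end :
  greedy_cvg_in_prob piU piV C
    (fun N T w => #|out_matching w T|%:R / (C%:R * N%:R)) (limit_ratio piU C (G 1)).
Proof.
move=> eps delta eps0 delta0.
have [L L0 F_lip] := lipschitz01_clamp (filled_lip C (mass_entire hU)).
pose K := muU / muV + L; have K0 : 0 < K by rewrite ltr_pwDl // divr_gt0.
(* Stopping at 1 - h changes |M| / N by at most h muU / muV + 1 / N and the limit by at most L h.
   With h K and 1 / N at most C eps / 4 each, half of C eps is left for the convergence at time 1 -
   h. *)
pose h := Num.min (1 / 2) (C%:R * eps / (4 * K)).
have ce : 0 < C%:R * eps by rewrite mulr_gt0.
have h0 : 0 < h by rewrite lt_min !divr_gt0 // mulr_gt0.
have [h1 h2] : h <= 1 / 2 /\ h <= C%:R * eps / (4 * K) by rewrite /h !ge_min !lexx orbT.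
pose s := 1 - h; have s01 : 0 <= s < 1 by rewrite /s; apply/andP; split; lra.
have /andP[s0 s1] := s01; have sI : 0 <= s <= 1 by rewrite s0 ltW.
have i1 : 0 <= (1 : R) <= 1 by rewrite ler01 lexx.
have [N0 _ H] := greedy_cvg_before s01 (divr_gt0 eps0 (ltr0n R 2)) delta0.
exists (maxn N0 (Num.truncn (4 / (C%:R * eps))).+1) => // N /=.
rewrite geq_max => /andP[N0N Nx] T TN; apply: le_lt_trans (H N N0N T TN).
have N1 : (0 < N)%N by apply: leq_trans Nx.
have N0' : 0 < N%:R :> R by rewrite ltr0n.
have Nbig : 1 / N%:R <= C%:R * eps / 4.
  rewrite ler_pdivrMr // mulrC -ler_pdivrMr ?divr_gt0 //.
  have -> : 1 / (C%:R * eps / 4) = 4 / (C%:R * eps) by field; rewrite !gt_eqF.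
  by apply: ltW; apply: (lt_le_trans (truncnS_gt _)); rewrite ler_nat.
apply: greedy_prob_mono => w /=; rewrite !ratio_event // !limit_ratio_filled //.
set k := Num.truncn _ => big.
have /andP[ks ks'] : k%:R <= s * T%:R < k.+1%:R by apply/truncn_itv/mulr_ge0.
have kT : (k <= T)%N by rewrite -(ler_nat R) (le_trans ks) // ler_piMl // ltW.
have m1 : #|out_matching w k|%:R <= #|out_matching w T|%:R :> R.
  by rewrite ler_nat; exact: matching_after_mono.
have m2 : #|out_matching w T|%:R <= #|out_matching w k|%:R + (T%:R - k%:R) :> R.
  rewrite -natrB // -natrD ler_nat.
  by have := card_matching_after_le (tagged w).2 k (T - k); rewrite subnKC.
have gap : T%:R - k%:R <= h * T%:R + 1 by move: ks'; rewrite -natr1 /s; lra.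
have [G0 G1] : 0 <= G s <= 1 /\ 0 <= G 1 <= 1.
  have /andP[-> b] := fluid01 C hU hV muU_gt0 muV_gt0 sI.
  have /andP[-> b'] := fluid01 C hU hV muU_gt0 muV_gt0 i1.
  by rewrite b'; split => //=; lra.
have Fl : `|filled (mass piU) C (G 1) - filled (mass piU) C (G s)| <= L * h.
  have := F_lip (G 1) (G s); rewrite !clamp_id // => /le_trans; apply.
  rewrite ler_wpM2l //; apply: (le_trans (fluid_lip C hU hV muU_gt0 muV_gt0 i1 sI)).
  by rewrite /s opprB addrC subrK ger0_norm // ltW.
set FG1 := filled _ _ (G 1) in big Fl; set FGs := filled _ _ (G s) in Fl *.
have mm : `|#|out_matching w T|%:R / N%:R - #|out_matching w k|%:R / N%:R|
    <= h * (muU / muV) + 1 / N%:R.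
  rewrite -mulrBl normrM ger0_norm ?subr_ge0 // ger0_norm ?invr_ge0 ?(ltW N0') //.
  rewrite ler_pdivrMr // mulrDl divfK ?gt_eqF // -mulrA -TN.
  by lra.
have hK : h * K <= C%:R * eps / 4.
  have := h2; rewrite invfM mulrA ler_pdivlMr // => /le_trans; apply.
set X := #|out_matching w T|%:R / N%:R in big mm; set Y := #|out_matching w k|%:R / N%:R in mm *.
have tri : `|X - FG1| <= `|X - Y| + `|Y - FGs| + `|FG1 - FGs|.
  have -> : X - FG1 = (X - Y) + (Y - FGs) - (FG1 - FGs) by ring.
  by apply: (le_trans (ler_normB _ _)); rewrite lerD2r ler_normD.
move: hK; rewrite /K mulrDr [h * L]mulrC => hK.
set a := `|X - FG1| in big tri; set b := `|X - Y| in mm tri; set e := `|FG1 - FGs| in Fl tri.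
set y := `|Y - FGs| in tri *; set u := h * (muU / muV) in mm hK; set v := L * h in Fl hK.
set z := 1 / N%:R in Nbig mm; set ce' := C%:R * eps in Nbig hK big.
rewrite mulrA -/ce'; clear - Nbig hK big Fl mm tri; lra.
Qed.

End Convergence.

Theorem theorem2 (R : realType) (piU piV : probability nat R) (C : nat)
    (hU : sub_gaussian piU) (hV : sub_gaussian piV)
    (muU_gt0 : 0 < mean piU) (muV_gt0 : 0 < mean piV) (C_gt0 : (1 <= C)%N) :
  exists G : R -> R,
    [/\ is_solution piU piV C G,
        forall H : R -> R, is_solution piU piV C H ->
          forall s : R, 0 <= s <= 1 -> H s = G s,
        greedy_cvg_in_prob piU piV C
          (fun N T w => #|out_matching w T|%:R / (C%:R * N%:R))
          (limit_ratio piU C (G 1)) &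
        forall s : R, 0 <= s <= 1 ->
          greedy_cvg_in_prob piU piV C
            (fun N T w =>
               #|out_matching w (Num.truncn (s * T%:R))|%:R / (C%:R * N%:R))
            (limit_ratio piU C (G s))].
Proof.
exists (fluid piU piV C); split.
- exact: fluid_solution.
- exact: (fluid_unique hU hV muU_gt0 muV_gt0 C_gt0).
- exact: greedy_cvg_end.
move=> s /andP[s0]; rewrite le_eqVlt => /orP[/eqP ->|s1]; last first.
  by apply: greedy_cvg_before => //; rewrite s0.
move=> eps delta eps0 delta0.
have [N0 _ H] := greedy_cvg_end hU hV muU_gt0 muV_gt0 C_gt0 eps0 delta0.
by exists N0 => // N NN T /(H N NN T); rewrite /= mul1r natrK.
Qed.
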